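(* Let $n\ge3$. Then the choice $f(t)=t$ is not admissible in the strong stability inequality for convexity, neither for nearly spherical sets nor for general sets of finite perimeter. Precisely: (i) There do not exist constants $\overline\sigma,\overline\lambda>0$ and $\overline C>1$ (depending only on $n$), with $\overline\sigma<1$, such that for all $\sigma\in(0,\overline\sigma)$, all $\lambda\in(0,\overline\lambda)$ and every $\sigma$-nearly spherical set $E\subset\mathbb R^n$ with $|E|=|B|$ there are $x_0\in\mathbb R^n$ and a uniformly convex set $F=x_0+(B+v)$ of class $C^2$ with $\|v\|_{C^1(\mathbb S^{n-1})}\le\overline C\frac{\lambda}{|\log\sigma|}$, $\|D^2_\tau v\|_{C^0(\mathbb S^{n-1})}\le\overline C\lambda$, $|F|=|E|$, and $$P(E)-P(F)\ge\lambda\,|E\Delta F|.$$ (ii) There do not exist constants $\overline\lambda,c>0$ (depending only on $n$) such that for every set of finite perimeter $E\subset\mathbb R^n$ with $|E|=|B|$ and every $0<\lambda\le\overline\lambda$ there is a uniformly convex set $F\in\mathscr C_\lambda$ with $$P(E)-P(F)\ge c\,\lambda\,|E\Delta F|.$$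
   Context: $B$ is the open unit ball of $\mathbb R^n$ centered at the origin, $\mathbb S^{n-1}$ the unit sphere, $|\cdot|$ Lebesgue measure, $P(\cdot)$ the (Euclidean, De Giorgi) perimeter, $E\Delta F$ the symmetric difference, and $D_\tau,D^2_\tau$ the tangential gradient and Hessian on $\mathbb S^{n-1}$. For a continuous $v:\mathbb S^{n-1}\to\mathbb R$ with $\|v\|_{L^\infty(\mathbb S^{n-1})}\le\frac12$, define $$B+v=\{y\in\mathbb R^n:\ y=t\,\omega(1+v(\omega))\ \text{for some }\omega\in\mathbb S^{n-1},\ 0\le t<1\},$$ and let $x+(B+v)$ denote its translation by $x\in\mathbb R^n$. It is understood that all functions $v$ appearing satisfy $\|v\|_{L^\infty}\le\frac12$. For small $\sigma>0$, a set $E$ is $\sigma$-nearly spherical if $E=B+u$ with $\|u\|_{W^{1,\infty}(\mathbb S^{n-1})}\le\sigma$. For $\lambda>0$, $$\mathscr C_\lambda=\{F=x+(B+v):\ v\in C^2(\mathbb S^{n-1}),\ \|v\|_{C^2(\mathbb S^{n-1})}\le\lambda,\ x\in\mathbb R^n,\ |F|=|B|\}.$$ A bounded set with $C^2$ boundary is uniformly convex if it is convex and all principal curvatures of its boundary are bounded below by a positive constant. *)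

(* Defs.v *)
(* R^n is the space 'rV[R]_n of row vectors; its library
   norm `|x| is the sup norm (used only through the topology it induces), so
   the Euclidean norm is defined separately as enorm. *)
From HB Require Import structures.
From mathcomp Require Import all_boot all_order all_algebra.
From mathcomp Require Import all_classical all_reals all_analysis ess_sup_inf.

Set Implicit Arguments.
Unset Strict Implicit.
Unset Printing Implicit Defensive.

Import Order.TTheory GRing.Theory Num.Theory.
Import numFieldNormedType.Exports.

Local Open Scope classical_set_scope.
Local Open Scope ring_scope.

Definition rV_display : measure_display -> measure_display.
Proof. exact. Qed.

(* Borel sigma-algebra of R^n: generated by the n coordinate functions. *)
Section borel_rV.
Variables (R : realType) (n : nat).

Definition rV_coord (i : 'I_n) (x : 'rV[R]_n) : measurableTypeR R := x 0 i.

Let rV_set0 : g_sigma_preimage rV_coord set0.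
Proof. exact: sigma_algebra0. Qed.

Let rV_setC A : g_sigma_preimage rV_coord A ->
  g_sigma_preimage rV_coord (~` A).
Proof. exact: sigma_algebraC. Qed.

Let rV_bigcup (F : (set 'rV[R]_n)^nat) :
  (forall i, g_sigma_preimage rV_coord (F i)) ->
  g_sigma_preimage rV_coord (\bigcup_i F i).
Proof. exact: sigma_algebra_bigcup. Qed.

HB.instance Definition _ := @isMeasurable.Build
  (rV_display (R.-ocitv.-measurable).-sigma) 'rV[R]_n
  (g_sigma_preimage rV_coord) rV_set0 rV_setC rV_bigcup.

End borel_rV.

Lemma measurable_rV_coord (R : realType) n (i : 'I_n) :
  measurable_fun [set: 'rV[R]_n] (@rV_coord R n i).
Proof.
move=> _ A mA; rewrite setTI; apply: sub_sigma_algebra => /=.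
rewrite -bigcup_seq/=; exists i => /=; first by rewrite mem_index_enum.
by exists A => //; rewrite setTI.
Qed.

Lemma measurable_fun_rV (R : realType) n d (T : measurableType d)
    (f : T -> 'rV[R]_n) :
  (forall i, measurable_fun [set: T] (@rV_coord R n i \o f)) ->
  measurable_fun [set: T] f.
Proof.
move=> mf.
suff H : g_sigma_preimage (fun i => @rV_coord R n i \o f) `<=` measurable.
  move=> _ A mA; rewrite setTI; apply: H.
  by rewrite g_sigma_preimage_comp; exists A => //; rewrite setTI.
apply: smallest_sub; first exact: sigma_algebra_measurable.
case: n => [|n] in f mf *; first by rewrite big_ord0.
rewrite -bigcup_mkord_ord; apply: bigcup_sub => k _ A [B mB <-].
exact: mf.
Qed.

(* (x, y) |-> the vector of R^(1 + n) with first coordinate x and tail y. *)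
Section rV_cons.
Variables (R : realType) (n : nat).

Definition rV_cons (p : measurableTypeR R * 'rV[R]_n) : 'rV[R]_n.+1 :=
  row_mx (p.1 : R)%:M p.2 : 'rV[R]_(1 + n).

Lemma measurable_rV_cons : measurable_fun [set: _] rV_cons.
Proof.
apply: measurable_fun_rV => i; case: (@split_ordP 1 n i) => j jE.
  rewrite [X in measurable_fun _ X](_ : _ = fst); first exact: measurable_fst.
  apply/funext => p; rewrite /comp /rV_coord /rV_cons jE.
  by rewrite (@row_mxEl _ 1 1 n) mxE !ord1 eqxx mulr1n.
rewrite [X in measurable_fun _ X](_ : _ = @rV_coord R n j \o snd).
  exact: measurableT_comp (measurable_rV_coord j) measurable_snd.
apply/funext => p.
by rewrite /comp /rV_coord /rV_cons jE (@row_mxEr _ 1 1 n).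
Qed.

Definition rV_uncons (x : 'rV[R]_n.+1) : measurableTypeR R * 'rV[R]_n :=
  (rV_coord ord0 x, \row_i x 0 (lift ord0 i)).

Lemma measurable_rV_uncons : measurable_fun [set: _] rV_uncons.
Proof.
apply/measurable_fun_pair; first exact: measurable_rV_coord.
apply: measurable_fun_rV => i.
rewrite [X in measurable_fun _ X](_ : _ = @rV_coord R n.+1 (lift ord0 i)).
  exact: measurable_rV_coord.
by apply/funext => x; rewrite /rV_coord /= mxE.
Qed.

Lemma rV_consK : rV_uncons \o rV_cons = id.
Proof.
apply/funext => -[x y]; rewrite /comp /rV_uncons /rV_coord /rV_cons/=.
congr pair.
  rewrite (_ : ord0 = lshift n (0 : 'I_1)); last exact/val_inj.
  by rewrite (@row_mxEl _ 1 1 n) mxE eqxx mulr1n.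
apply/rowP => i; rewrite mxE.
rewrite (_ : lift _ _ = rshift 1 i); last exact/val_inj.
by rewrite (@row_mxEr _ 1 1 n).
Qed.

End rV_cons.

Section cons_measure.
Variables (R : realType) (n : nat).
Variable m : {sigma_finite_measure set 'rV[R]_n -> \bar R}.
Local Open Scope ereal_scope.

Definition cons_measure : set 'rV[R]_n.+1 -> \bar R :=
  pushforward (@lebesgue_measure R \x m) (@rV_cons R n).

Let M := measure_function_pushforward__canonical__measure_function_Measure
  (@lebesgue_measure R \x m) (@measurable_rV_cons R n).

Let cons_measure0 : cons_measure set0 = 0.
Proof. exact: (measure0 M). Qed.

Let cons_measure_ge0 A : 0 <= cons_measure A.
Proof. exact: (measure_ge0 M). Qed.

Let cons_measure_sigma_additive : semi_sigma_additive cons_measure.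
Proof. exact: (@measure_semi_sigma_additive _ _ _ M). Qed.

HB.instance Definition _ := isMeasure.Build _ _ _ cons_measure
  cons_measure0 cons_measure_ge0 cons_measure_sigma_additive.

Let cons_measure_sigma_finite : sigma_finite setT cons_measure.
Proof.
have /sigma_finiteP[F [FT ndF Foo]] := sigma_finiteT (@lebesgue_measure R).
have /sigma_finiteP[G [GT ndG Goo]] := sigma_finiteT m.
exists (fun k => (@rV_uncons R n) @^-1` (F k `*` G k)).
  rewrite -preimage_bigcup (_ : \bigcup_k (F k `*` G k) = setT).
    by rewrite preimage_setT.
  apply/seteqP; split => // -[x y] _.
  have [i _ Fix] : (\bigcup_k F k) x by rewrite -FT.
  have [j _ Gjy] : (\bigcup_k G k) y by rewrite -GT.
  exists (maxn i j) => //; split.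
    by move: Fix; exact/subsetPset/ndF/leq_maxl.
  by move: Gjy; exact/subsetPset/ndG/leq_maxr.
move=> k; have [mF Fk] := Foo k; have [mG Gk] := Goo k.
have mFG : measurable (F k `*` G k) by exact: measurableX.
split; first by rewrite -[X in measurable X]setTI; exact: measurable_rV_uncons.
rewrite /cons_measure /pushforward -comp_preimage rV_consK preimage_id.
by rewrite product_measure1E// lte_mul_pinfty// ge0_fin_numE.
Qed.

HB.instance Definition _ := @Measure_isSigmaFinite.Build _ _ _ cons_measure
  cons_measure_sigma_finite.

End cons_measure.

(* The n-fold product of the one-dimensional Lebesgue measure, on Borel sets;
   R^0 is a point of mass 1. *)
Fixpoint borel_lebesgue (R : realType) (n : nat) :
    {sigma_finite_measure set 'rV[R]_n -> \bar R} :=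
  match n with
  | 0 => \d_(0 : 'rV[R]_0)
  | k.+1 => cons_measure (borel_lebesgue R k)
  end.

Definition lebesgue_type (R : realType) (n : nat) :=
  caratheodory_type (borel_lebesgue R n)^*%mu.

HB.instance Definition _ (R : realType) n := Measurable.on (lebesgue_type R n).

(* Lebesgue measure on the (complete) sigma-algebra of Lebesgue measurable
   sets of R^n. *)
Definition lebesgue (R : realType) (n : nat) : set (lebesgue_type R n) -> \bar R :=
  @completed_measure_extension _ _ _ (borel_lebesgue R n).

HB.instance Definition _ (R : realType) n := Measure.on (@lebesgue R n).

Definition vol (R : realType) (n : nat) (E : set 'rV[R]_n) : \bar R :=
  @lebesgue R n E.

Section calculus.
Variables (R : realType) (n : nat).
Implicit Types (f : 'rV[R]_n -> R) (U : set 'rV[R]_n) (x : 'rV[R]_n).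

Definition dot (x y : 'rV[R]_n) : R := (x *m y^T) 0 0.

(* Euclidean norm of a vector, Frobenius norm of a matrix. *)
Definition enorm (m k : nat) (A : 'M[R]_(m, k)) : R :=
  Num.sqrt (\sum_i \sum_j A i j ^+ 2).

Definition partial (i : 'I_n) f : 'rV[R]_n -> R :=
  fun x => 'D_(delta_mx 0 i) f x.

Definition grad f x : 'rV[R]_n := \row_i partial i f x.

Definition hess f x : 'M[R]_n := \matrix_(i, j) partial j (partial i f) x.

(* To be used with an open set U. *)
Definition C1_on U f := forall i x, U x ->
  derivable f x (delta_mx 0 i) /\ {for x, continuous (partial i f)}.

Definition C2_on U f := C1_on U f /\ forall i, C1_on U (partial i f).

(* Orthogonal projection onto the hyperplane normal to w, for w != 0; the
   matrix is symmetric and acts on row vectors from the right. *)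
Definition tproj (w : 'rV[R]_n) : 'M[R]_n :=
  1%:M - (dot w w)^-1 *: (w^T *m w).

Definition supp (V : zmodType) (g : 'rV[R]_n -> V) : set 'rV[R]_n :=
  closure [set x | g x != 0].

Definition boundary (A : set 'rV[R]_n) : set 'rV[R]_n := closure A `\` A^°.

End calculus.

Section perimeter.
Variables (R : realType) (n : nat).

Definition div (T : 'rV[R]_n -> 'rV[R]_n) (x : 'rV[R]_n) : R :=
  \sum_i partial i (fun y => T y 0 i) x.

Definition test_field (T : 'rV[R]_n -> 'rV[R]_n) :=
  [/\ forall i, C1_on setT (fun x => T x 0 i), compact (supp T) &
      forall x, enorm (T x) <= 1].

Definition perimeter (E : set 'rV[R]_n) : \bar R :=
  ereal_sup [set (\int[@lebesgue R n]_(x in E) (div T x)%:E)%E |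
             T in test_field].

Definition finite_perimeter (E : set 'rV[R]_n) :=
  measurable (E : set (lebesgue_type R n)) /\ (perimeter E < +oo)%E.

End perimeter.

(* A function on the sphere S^(n-1) is represented by a function on R^n of
   which only the values on the sphere are used. *)
Section sphere.
Variables (R : realType) (n : nat).
Implicit Types (v : 'rV[R]_n -> R) (x : 'rV[R]_n).

Definition unit_ball : set 'rV[R]_n := [set x | enorm x < 1].

Definition sphere : set 'rV[R]_n := [set x | enorm x = 1].

(* The extension of v to R^n \ {0} that is constant along rays. Tangential
   smoothness and derivatives of v on the sphere are those of this extension:
   it has no radial derivative, so its gradient at a point w of the sphere is
   the tangential gradient, and the compression of its Hessian to the tangent
   space is the tangential (covariant) Hessian. *)
Definition hext v : 'rV[R]_n -> R := fun x => v ((enorm x)^-1 *: x).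

Definition C2_sphere v := C2_on [set x | x != 0] (hext v).

Definition tgrad v (w : 'rV[R]_n) : 'rV[R]_n := grad (hext v) w.

Definition thess v (w : 'rV[R]_n) : 'M[R]_n :=
  tproj w *m hess (hext v) w *m tproj w.

(* C^0 norm on the sphere of a scalar, vector or matrix valued function. *)
Definition C0_norm (m k : nat) (g : 'rV[R]_n -> 'M[R]_(m, k)) : \bar R :=
  ereal_sup [set (enorm (g w))%:E | w in sphere].

Definition sup_norm v : \bar R := ereal_sup [set `|v w|%:E | w in sphere].

Definition C1_norm v : \bar R := (sup_norm v + C0_norm (tgrad v))%E.

Definition C2_norm v : \bar R := (C1_norm v + C0_norm (thess v))%E.

(* g is the distributional gradient of the radial extension of u on
   R^n \ {0}. *)
Definition weak_grad (u : 'rV[R]_n -> R) (g : 'rV[R]_n -> 'rV[R]_n) :=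
  (forall i, measurable_fun [set: lebesgue_type R n]
     (fun x => (g x 0 i : measurableTypeR R))) /\
  forall (i : 'I_n) (phi : 'rV[R]_n -> R),
    C1_on setT phi -> compact (supp phi) -> ~ supp phi 0 ->
    (\int[@lebesgue R n]_x (hext u x * partial i phi x)%:E =
     - \int[@lebesgue R n]_x (g x 0 i * phi x)%:E)%E.

(* W^(1,oo) norm on the sphere, for u continuous there. The gradient of the
   radial extension of u at x is the tangential gradient of u at x / |x|
   divided by |x|, so the essential supremum of |x| |g x| over R^n is the one
   of |D_tau u| over the sphere. The infimum is +oo if u has no weak gradient
   and otherwise its value does not depend on g, which is unique up to null
   sets. *)
Definition W1inf_norm (u : 'rV[R]_n -> R) : \bar R :=
  (sup_norm u +
   ereal_inf [set ess_sup (@lebesgue R n)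
                (fun x => (enorm x * enorm (g x))%:E) |
              g in weak_grad u])%E.

Definition ball_graph v : set 'rV[R]_n :=
  [set y | exists2 w, sphere w &
           exists2 t : R, 0 <= t < 1 & y = (t * (1 + v w)) *: w].

Definition translate (x : 'rV[R]_n) (A : set 'rV[R]_n) : set 'rV[R]_n :=
  [set x + y | y in A].

Definition nearly_spherical (sigma : R) (E : set 'rV[R]_n) :=
  exists u : 'rV[R]_n -> R,
    [/\ {within sphere, continuous u}, (sup_norm u <= (2^-1)%:E)%E,
        (W1inf_norm u <= sigma%:E)%E & E = ball_graph u].

Definition C2_class (lambda : R) (F : set 'rV[R]_n) :=
  exists (x : 'rV[R]_n) (v : 'rV[R]_n -> R),
    [/\ C2_sphere v, (sup_norm v <= (2^-1)%:E)%E,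
        (C2_norm v <= lambda%:E)%E, F = translate x (ball_graph v) &
        vol F = vol unit_ball].

End sphere.

Section convexity.
Variables (R : realType) (n : nat).
Implicit Types (A : set 'rV[R]_n) (p : 'rV[R]_n) (psi : 'rV[R]_n -> R).

(* psi is a C^2 function such that near p the (open) set A is {psi < 0}. *)
Definition defining_function A p psi :=
  exists U, [/\ open_nbhs p U, C2_on U psi, grad psi p != 0 &
                A `&` U = [set x | psi x < 0] `&` U].

Definition C2_boundary A :=
  forall p, boundary A p -> exists psi, defining_function A p psi.

(* kappa is an eigenvalue of the Weingarten map of the boundary of A at p,
   oriented so that the curvatures of a ball are positive. In terms of a
   defining function psi, this map sends a tangent vector tau to the
   tangential part of tau *m hess psi p / |grad psi p|. *)
Definition principal_curvature A p (kappa : R) :=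
  exists psi (tau : 'rV[R]_n),
    [/\ defining_function A p psi, tau != 0, dot tau (grad psi p) = 0 &
        (enorm (grad psi p))^-1 *: (tau *m hess psi p *m tproj (grad psi p)) =
        kappa *: tau].

(* For an open set A. *)
Definition uniformly_convex A :=
  [/\ bounded_set A, C2_boundary A,
      convex_set (A : set (convex_lmodType 'rV[R]_n)) &
      exists2 c : R, 0 < c &
        forall p kappa, boundary A p -> principal_curvature A p kappa ->
                        c <= kappa].

End convexity.

(* Main.v *)
(* Let Q = x_0^2 - x_1^2 and s = x_0^2 + x_1^2, and let E be the set where
   |x|^2 - a Q log (|x|^2 / (s + eta |x|^2)) < k^2, with k fixed by the volume.
   Uniformly in eta, the perturbation of |x|^2 is of order a in C^1 and has a
   Laplacian of order a, so the mean curvature of the boundary of E is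
   n - 1 + O(a); but its Hessian blows up like a log eta on the subspace s = 0,
   which meets the sphere because n >= 3, and E is not convex once
   eta << exp (- 2 / a).

   Suppose that F is convex, F is a translate of a graph over the sphere, and
   eps |E + F| <= P(E) - P(F), where + is the symmetric difference.  By the
   isoperimetric inequality (obtained from Prekopa-Leindler) the right-hand side
   is O(a), so |E + F| is small and, F being convex, E + F lies in a thin shell
   around the unit sphere.  There the unit normal field X to the level sets has
   |div X - (n - 1)| <= eps / 2; it calibrates E, and
   P(E) - P(F) <= int_E div X - int_F div X <= (eps / 2) |E + F|.  Hence
   |E + F| = 0, which is impossible because E is not convex up to null sets. *)
Require Import Defs.
From HB Require Import structures.
From mathcomp Require Import all_boot all_order all_algebra.
From mathcomp Require Import all_classical all_reals all_analysis.
From mathcomp Require Import ess_sup_inf measurable_realfun ring lra.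

Set Implicit Arguments.
Unset Strict Implicit.
Unset Printing Implicit Defensive.

Import Order.TTheory GRing.Theory Num.Theory.
Import numFieldNormedType.Exports.

Local Open Scope classical_set_scope.
Local Open Scope ring_scope.

(** * Borel and Lebesgue measure on row vectors *)

(** The saddle exploits that the Laplacian does not control the Hessian in the sup norm: [Q] is
    harmonic, so the unbounded factor [log] drops out of the Laplacian of [Q log] but stays in its
    Hessian. The mean curvature is however not the Laplacian alone: it also contains the second
    derivative in the normal direction, which does meet the logarithm. There the normal is almost
    radial, and its component in the plane of [x_0, x_1] is small where the logarithm is large;
    quantifying this pairing is the heart of the curvature estimate.

    The perturbed square is homogeneous of degree two, so [E] is an explicit graph and a dilation
    adjusts its volume.

    The divergence of the normal field is close to [(n - 1) / |x|], so the calibration is good only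
    near the unit sphere. This forces the detour through the isoperimetric inequality, whose crude
    bound [|E + F| = O(a)] serves only to localise [E + F]. The constant [n - 1] then cancels
    because [|E| = |F|]. Constants are chosen in the order [eps], width of the shell, [a], [eta]. *)

Section borel_rV.
Context {R : realType} {n : nat}.
Implicit Types (x y : 'rV[R]_n).

Lemma rV_norm_ltP x (e : R) : 0 < e ->
  reflect (forall i, `|x 0 i| < e) (`|x| < e).
Proof.
move=> e0; apply: (iffP idP) => [xe i|H].
  apply: le_lt_trans xe; rewrite [leRHS]mx_normrE.
  exact: (le_bigmax _ (fun i => `|x i.1 i.2|) (0, i)).
by rewrite [ltLHS]mx_normrE bigmax_lt// => -[i j] _ /=; rewrite ord1.
Qed.

Lemma rV_norm_leP x (e : R) : 0 <= e ->
  reflect (forall i, `|x 0 i| <= e) (`|x| <= e).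
Proof.
move=> e0; apply: (iffP idP) => [xe i|H].
  apply: le_trans xe; rewrite [leRHS]mx_normrE.
  exact: (le_bigmax _ (fun i => `|x i.1 i.2|) (0, i)).
by rewrite [leLHS]mx_normrE bigmax_le// => -[i j] _ /=; rewrite ord1.
Qed.

Lemma rV_coord_le_norm x i : `|x 0 i| <= `|x|.
Proof. by have /rV_norm_leP := lexx `|x|; apply. Qed.

Lemma measurable_coord_ltr i (a r : R) :
  measurable [set x : 'rV[R]_n | `|x 0 i - a| < r].
Proof.
have := @measurable_rV_coord R n i measurableT
  [set t : measurableTypeR R | `|t - a| < r].
rewrite setTI; apply.
apply: (@open_measurable R); rewrite (_ : [set t | _] = ball (a : R) r).
  exact: ball_open.
by apply/seteqP; split => t /=; rewrite /ball /= distrC.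
Qed.

Lemma measurable_rV_box x (r : R) : 0 < r ->
  measurable [set y : 'rV[R]_n | `|y - x| < r].
Proof.
move=> r0.
have -> : [set y : 'rV[R]_n | `|y - x| < r] =
    \bigcap_(i in [set: 'I_n]) [set y : 'rV[R]_n | `|y 0 i - x 0 i| < r].
  apply/seteqP; split => y /=.
    by move=> /rV_norm_ltP H i _ /=; have := H r0 i; rewrite !mxE.
  by move=> H; apply/rV_norm_ltP => // i; rewrite !mxE; exact: H.
by apply: fin_bigcap_measurable => // i _; exact: measurable_coord_ltr.
Qed.

(** The sigma-algebra is generated by the coordinates, so an open set is exhausted by the countably
    many open cubes with rational centre and radius [1 / (m + 1)] that it contains. A radius below
    [e / 2] keeps a cube that contains [x] inside the ball of radius [e] around [x]. *)
Lemma open_measurable_rV (U : set 'rV[R]_n) : open U -> measurable U.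
Proof.
move=> oU.
pose bx (p : 'rV[rat]_n * nat) : set 'rV[R]_n :=
  [set y | `|y - map_mx ratr p.1| < p.2.+1%:R^-1].
have -> : U = \bigcup_p (if `[< bx p `<=` U >] then bx p else set0).
  apply/seteqP; split; last first.
    by move=> x [p _]; case: asboolP => // H /H.
  move=> x Ux.
  have := oU; rewrite openE => /(_ x Ux) /nbhs_ballP[e /= e0 eU].
  have [k ke] : exists k, (k.+1%:R^-1 : R) < e / 2.
    have /ltr_add_invr[k] : (0 : R) < e / 2 by rewrite divr_gt0.
    by rewrite add0r; exists k.
  have k0 : (0 : R) < k.+1%:R^-1 by rewrite invr_gt0.
  have /choice[q qP] : forall i, exists q : rat, `|x 0 i - ratr q| < k.+1%:R^-1.
    move=> i; have : x 0 i - k.+1%:R^-1 < x 0 i + k.+1%:R^-1.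
      by rewrite ltrD2l (lt_trans _ k0)// oppr_lt0.
    by move=> /rat_in_itvoo[q]; rewrite in_itv/= => qx; exists q; rewrite distrC ltr_distl.
  exists (\row_i q i, k) => //; rewrite asboolT.
    by apply/rV_norm_ltP => // i; rewrite !mxE; exact: qP.
  move=> y /rV_norm_ltP H; apply: eU; rewrite mx_norm_ball /ball_ /=.
  apply/rV_norm_ltP => // i.
  rewrite !mxE; have := H k0 i; rewrite !mxE/= => H1.
  rewrite (_ : x 0 i - y 0 i = (x 0 i - ratr (q i)) - (y 0 i - ratr (q i)));
    last by ring.
  rewrite (le_lt_trans (ler_normB _ _))// [e](splitr e) ltrD//.
    by rewrite (lt_trans (qP i)).
  by rewrite (lt_trans H1).
apply: countable_bigcupT_measurable; first exact: countableP.
move=> p; case: asboolP => // _; exact: measurable_rV_box.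
Qed.

Lemma continuous_measurable_rV (f : 'rV[R]_n -> R) :
  continuous f -> measurable_fun [set: 'rV[R]_n] (f : _ -> measurableTypeR R).
Proof.
move=> cf; apply: (measurability _ (@RGenOpens.measurableE R)) => _ [_ [a [b ->] <-]].
rewrite setTI; apply: open_measurable_rV.
by move/continuousP: cf; apply; exact: interval_open.
Qed.

Lemma open_continuous_measurable_rV (U : set 'rV[R]_n) (f : 'rV[R]_n -> R) :
  open U -> {in U, continuous f} ->
  measurable_fun U (f : _ -> measurableTypeR R).
Proof.
move=> oU cf.
apply: (measurability _ (@RGenOpens.measurableE R)) => _ [_ [a [b ->] <-]].
apply: open_measurable_rV; rewrite openE => x [Ux fx].
apply: filterI; first by move: oU; rewrite openE; exact.
apply: (cf x (mem_set Ux)); exact: (interval_open _ _ fx).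
Qed.

End borel_rV.

(** * From the completed Lebesgue measure to the Borel product measure *)

Section lebesgue_borel.
Context {R : realType} {n : nat}.
Notation mu := (borel_lebesgue R n).

Lemma measurable_lebesgue_type (A : set 'rV[R]_n) :
  measurable A -> measurable (A : set (lebesgue_type R n)).
Proof. by move=> mA; apply: sub_caratheodory; exact: sub_sigma_algebra. Qed.

Lemma volE (A : set 'rV[R]_n) : measurable A -> vol A = mu A.
Proof. by move=> mA; rewrite /vol /lebesgue; exact: measurable_mu_extE. Qed.

Lemma measurable_fun_lebesgue_id :
  measurable_fun setT (id : lebesgue_type R n -> 'rV[R]_n).
Proof. by move=> _ A mA; rewrite setTI; exact: measurable_lebesgue_type. Qed.

Lemma measurable_fun_lebesgue_type d (T : measurableType d) (f : 'rV[R]_n -> T)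
    (D : set 'rV[R]_n) :
  measurable D -> measurable_fun D f -> measurable_fun (D : set (lebesgue_type R n)) f.
Proof.
by move=> mD mf _ A mA; apply: measurable_lebesgue_type; exact: mf.
Qed.

Lemma pushforward_lebesgueE (A : set 'rV[R]_n) : measurable A ->
  pushforward (@lebesgue R n) (id : lebesgue_type R n -> 'rV[R]_n) A = mu A.
Proof. by move=> mA; rewrite /pushforward preimage_id; exact: volE. Qed.

Local Open Scope ereal_scope.

(** The identity pushes the completed measure forward to the product measure. Perimeters are defined
    with the former, whereas slicing and affine changes of variables are carried out with the
    latter. *)
Lemma ge0_integral_lebesgueE (f : 'rV[R]_n -> \bar R) :
  measurable_fun [set: 'rV[R]_n] f -> (forall x, 0 <= f x) ->
  \int[@lebesgue R n]_x f x = \int[mu]_x f x.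
Proof.
move=> mf f0.
pose P : {measure set 'rV[R]_n -> \bar R} :=
  measure_function_pushforward__canonical__measure_function_Measure
    (@lebesgue R n) measurable_fun_lebesgue_id.
transitivity (\int[P]_x f x); last first.
  by apply: (@eq_measure_integral _ _ R setT mu P f) => A mA _;
    exact: pushforward_lebesgueE.
have := @ge0_integral_pushforward _ _ _ _ R _ measurable_fun_lebesgue_id
  (@lebesgue R n) setT f measurableT mf (fun x _ => f0 x).
by rewrite preimage_id => ->.
Qed.

Lemma integral_lebesgueE (f : 'rV[R]_n -> \bar R) :
  measurable_fun [set: 'rV[R]_n] f ->
  \int[@lebesgue R n]_x f x = \int[mu]_x f x.
Proof.
move=> mf; rewrite integralE [RHS]integralE !ge0_integral_lebesgueE//.
  exact: measurable_funeneg.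
exact: measurable_funepos.
Qed.

End lebesgue_borel.

(** The common class of integrands: it is stable under sums, products with locally bounded factors,
    slicing and marginals, and its members are integrable as soon as the sublevels of [N] have
    finite measure. One constant [M] bounds both the values and the support. *)
Definition bounded_bsupp {R : realType} d (T : measurableType d) (N : T -> R)
    (f : T -> R) :=
  measurable_fun [set: T] (f : T -> measurableTypeR R) /\
  exists2 M : R, 0 <= M & forall x, `|f x| <= M /\ (M < N x -> f x = 0).

Section bounded_bsupp.
Context {R : realType} d (T : measurableType d) (N : T -> R).
Notation bbs := (@bounded_bsupp R d T N).
Implicit Types f g : T -> R.

Lemma bbsP f (M K : R) :
  measurable_fun [set: T] (f : T -> measurableTypeR R) ->
  (forall x, `|f x| <= M) -> (forall x, K < N x -> f x = 0) -> bbs f.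
Proof.
move=> mf fM fK; split => //; exists (Num.max 0 (Num.max M K)).
  by rewrite le_max lexx.
move=> x; split; first by rewrite !le_max fM orbT.
by rewrite !gt_max => /andP[_ /andP[_ ]]; exact: fK.
Qed.

Lemma bbsW f g : measurable_fun [set: T] (f : T -> measurableTypeR R) ->
  bbs g -> (forall x, `|f x| <= `|g x|) -> bbs f.
Proof.
move=> mf [mg [M M0 gM]] fg; split => //; exists M => // x; split.
  by rewrite (le_trans (fg x))//; have [] := gM x.
move=> Mx; have [_ /(_ Mx) g0] := gM x; have := fg x.
by rewrite g0 normr0 normr_le0 => /eqP.
Qed.

Lemma bbs0 : bbs (fun=> 0).
Proof. by apply: (@bbsP _ 0 0) => // x; rewrite normr0. Qed.

Lemma bbsD f g : bbs f -> bbs g -> bbs (fun x => f x + g x).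
Proof.
move=> [mf [M M0 fM]] [mg [K K0 gK]].
apply: (@bbsP _ (M + K) (Num.max M K)).
- exact: measurable_funD.
- move=> x; rewrite (le_trans (ler_normD _ _))// lerD//.
    by have [] := fM x.
  by have [] := gK x.
- move=> x; rewrite gt_max => /andP[Mx Kx].
  by have [_ ->//] := fM x; have [_ ->//] := gK x; rewrite addr0.
Qed.

Lemma bbsMl (h : T -> R) f : bbs f ->
  measurable_fun [set: T] (h : T -> measurableTypeR R) ->
  (exists M, forall x, f x != 0 -> `|h x| <= M) -> bbs (fun x => h x * f x).
Proof.
move=> [mf [M M0 fM]] mh [K hK]; apply: (@bbsP _ (Num.max 0 K * M) M).
- exact: measurable_funM.
- move=> x; have [->|fx0] := eqVneq (f x) 0.
    by rewrite mulr0 normr0 mulr_ge0// le_max lexx.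
  rewrite normrM ler_pM//; first by rewrite le_max hK ?orbT.
  by have [] := fM x.
- by move=> x Mx; have [_ ->//] := fM x; rewrite mulr0.
Qed.

Lemma bbsZ (c : R) f : bbs f -> bbs (fun x => c * f x).
Proof.
by move=> bf; apply: bbsMl => //; exists `|c|.
Qed.

Lemma bbsN f : bbs f -> bbs (fun x => - f x).
Proof.
move=> /(bbsZ (-1)); congr bounded_bsupp; apply/funext => x.
by rewrite mulN1r.
Qed.

Lemma bbsB f g : bbs f -> bbs g -> bbs (fun x => f x - g x).
Proof. by move=> bf /bbsN; exact: bbsD. Qed.

Lemma bbs_sum (I : Type) (r : seq I) (F : I -> T -> R) :
  (forall i, bbs (F i)) -> bbs (fun x => \sum_(i <- r) F i x).
Proof.
move=> H; elim: r => [|i r IH].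
  by move: bbs0; congr bounded_bsupp; apply/funext => x; rewrite big_nil.
have := bbsD (H i) IH; congr bounded_bsupp; apply/funext => x.
by rewrite big_cons.
Qed.

Lemma bbs_norm f : bbs f -> bbs (fun x => `|f x|).
Proof.
move=> bf; apply: (bbsW _ bf) => [|x]; last by rewrite normr_id.
by apply: measurableT_comp => //; case: bf.
Qed.

Lemma bbs_indic (A : set T) (K : R) : measurable A ->
  (forall x, A x -> N x <= K) -> bbs \1_A.
Proof.
move=> mA AK; apply: (@bbsP _ 1 K).
- exact: measurable_indic.
- by move=> x; rewrite indicE; case: (_ \in _); rewrite ?normr1 ?normr0 ?ler01.
- move=> x Kx; rewrite indicE memNset// => /AK; apply/negP.
  by rewrite -ltNge.
Qed.

Variable mu : {measure set T -> \bar R}.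
Hypothesis mN : measurable_fun [set: T] (N : T -> measurableTypeR R).
Hypothesis muN : forall K : R, (mu [set x | (N x <= K)%R] < +oo)%E.

Lemma measurable_sublevel (K : R) : measurable [set x | N x <= K].
Proof.
have := @mN measurableT [set r : measurableTypeR R | r <= K].
rewrite setTI; apply.
rewrite (_ : [set r | _] = `]-oo, K]%classic); first exact: measurable_itv.
by apply/seteqP; split => x /=; rewrite in_itv.
Qed.

Lemma bbs_integrable f : bbs f -> mu.-integrable setT (EFin \o f).
Proof.
move=> [mf [M M0 fM]].
have mA := measurable_sublevel M.
apply: (@le_integrable _ _ _ mu setT measurableT _
    (fun x => (M * \1_[set x | N x <= M] x)%:E)).
- exact/measurable_EFinP.
- move=> x _ /=; rewrite lee_fin [leRHS]ger0_norm; last first.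
    by rewrite mulr_ge0.
  have [xM|Mx] := leP (N x) M.
    by rewrite indicE mem_set// mulr1; have [] := fM x.
  by have [_ ->//] := fM x; rewrite normr0 mulr_ge0.
- under eq_fun do rewrite EFinM.
  apply: integrableZl => //; apply/integrableP; split; first exact/measurable_EFinP.
  under eq_integral do rewrite gee0_abs ?lee_fin//.
  by rewrite integral_indic// setIT; exact: muN.
Qed.

End bounded_bsupp.

(** * Finite measure of cubes *)

Section borel_lebesgue_finite.
Context {R : realType}.

Lemma measurable_rV_norm (n : nat) :
  measurable_fun [set: 'rV[R]_n] ((fun x => `|x|) : 'rV[R]_n -> measurableTypeR R).
Proof. by apply: continuous_measurable_rV => x; exact: norm_continuous. Qed.

Lemma measurable_rV_cball (n : nat) (K : R) :
  measurable [set x : 'rV[R]_n | `|x| <= K].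
Proof. exact: (measurable_sublevel (@measurable_rV_norm n)). Qed.

Lemma rV_cons0 (n : nat) (p : measurableTypeR R * 'rV[R]_n) :
  rV_cons p 0 ord0 = p.1.
Proof.
rewrite /rV_cons (_ : ord0 = lshift n (0 : 'I_1)); last exact/val_inj.
by rewrite (@row_mxEl _ 1 1 n) mxE eqxx mulr1n.
Qed.

Lemma rV_consS (n : nat) (p : measurableTypeR R * 'rV[R]_n) i :
  rV_cons p 0 (lift ord0 i) = p.2 0 i.
Proof.
rewrite /rV_cons (_ : lift _ _ = rshift 1 i); last exact/val_inj.
by rewrite (@row_mxEr _ 1 1 n).
Qed.

Lemma rV_norm_cons (n : nat) (x : R) (y : 'rV[R]_n) (K : R) : 0 <= K ->
  (`|rV_cons (x, y)| <= K) = (`|x| <= K) && (`|y| <= K).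
Proof.
move=> K0; apply/idP/andP => [/rV_norm_leP H|[xK /rV_norm_leP yK]].
  split; first by have := H K0 ord0; rewrite rV_cons0.
  by apply/rV_norm_leP => // i; have := H K0 (lift ord0 i); rewrite rV_consS.
apply/rV_norm_leP => // i; case: (unliftP ord0 i) => [j|] ->.
  by rewrite rV_consS; exact: yK.
by rewrite rV_cons0.
Qed.

Lemma lebesgue_measure_cball (K : R) :
  (@lebesgue_measure R [set x | (`|x| <= K)%R] < +oo)%E.
Proof.
rewrite (_ : [set x | _] = `[- K, K]%classic); last first.
  by apply/seteqP; split => x /=; rewrite in_itv/= ler_norml.
by rewrite lebesgue_measure_itv/=; case: ifP => _; rewrite ltry.
Qed.

(** For the sup norm, a ball in dimension [n + 1] is the product of an interval and a ball in
    dimension [n], which gives the induction. *)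
Lemma borel_lebesgue_cball (n : nat) (K : R) :
  (borel_lebesgue R n [set x | (`|x| <= K)%R] < +oo)%E.
Proof.
have [K0|K0] := ltP K 0.
  rewrite (_ : [set x | _] = set0) ?measure0//.
  by apply/seteqP; split => // x /=; apply/negP; rewrite -ltNge (lt_le_trans K0).
elim: n => [|n IH] /=.
  by rewrite diracE ltry.
rewrite /cons_measure /pushforward.
rewrite (_ : _ @^-1` _ = [set x | `|x| <= K] `*` [set y | `|y| <= K]); last first.
  apply/seteqP; split => -[x y] /=; first by rewrite rV_norm_cons// => /andP.
  by move=> [? ?]; rewrite rV_norm_cons//; apply/andP.
rewrite product_measure1E//.
- rewrite lte_mul_pinfty// ?ge0_fin_numE//; exact: lebesgue_measure_cball.
- exact: (measurable_sublevel (@normr_measurable R setT)).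
- exact: measurable_rV_cball.
Qed.

End borel_lebesgue_finite.

Notation bbsR R := (@bounded_bsupp R _ (measurableTypeR R) (fun x => `|x|)).
Notation bbsV R n := (@bounded_bsupp R _ 'rV[R]_n (fun x => `|x|)).

Section fubini_rV.
Context {R : realType}.

Lemma bbsR_integrable (f : R -> R) : bbsR R f ->
  (@lebesgue_measure R).-integrable setT (EFin \o f).
Proof.
apply: bbs_integrable; first exact: normr_measurable.
exact: lebesgue_measure_cball.
Qed.

Lemma bbsV_integrable n (f : 'rV[R]_n -> R) : bbsV R n f ->
  (borel_lebesgue R n).-integrable setT (EFin \o f).
Proof.
apply: bbs_integrable; first exact: measurable_rV_norm.
exact: borel_lebesgue_cball.
Qed.

Variable n : nat.
Notation mu := (borel_lebesgue R n).
Notation mu1 := (borel_lebesgue R n.+1).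
Notation leb := (@lebesgue_measure R).

Lemma bbs_section (f : 'rV[R]_n.+1 -> R) (x : R) : bbsV R n.+1 f ->
  bbsV R n (fun y => f (rV_cons (x, y))).
Proof.
move=> [mf [M M0 fM]]; split.
  apply: measurableT_comp => //; apply: measurableT_comp => //.
  exact: measurable_rV_cons.
exists M => // y; split; first by have [] := fM (rV_cons (x, y)).
move=> My; have [_ ->//] := fM (rV_cons (x, y)).
by rewrite ltNge rV_norm_cons// negb_and -!ltNge My orbT.
Qed.

Let integrable_cons (f : 'rV[R]_n.+1 -> R) : bbsV R n.+1 f ->
  (leb \x mu)%E.-integrable setT (EFin \o f \o @rV_cons R n).
Proof.
move=> bf; have /integrableP[mf foo] := bbsV_integrable bf.
apply/integrableP; split.
  by apply: measurableT_comp => //; exact: measurable_rV_cons.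
move: foo; rewrite /= /cons_measure ge0_integral_pushforward//.
- exact: measurable_rV_cons.
- move/measurable_EFinP : mf => mf.
  by apply/measurable_EFinP; exact: measurableT_comp.
Qed.

(** Each slice is bounded by [M] and vanishes outside the cube of radius [M], so the marginal is
    bounded by [M] times the measure of that cube; it vanishes for [|x| > M] because the whole slice
    does. *)
Lemma bbs_marginal (f : 'rV[R]_n.+1 -> R) : bbsV R n.+1 f ->
  bbsR R (fun x => \int[mu]_y f (rV_cons (x, y))).
Proof.
move=> bf; have bfx x := bbsV_integrable (bbs_section x bf).
have FE x : (\int[mu]_y f (rV_cons (x, y)))%:E =
    (\int[mu]_y (f (rV_cons (x, y)))%:E)%E.
  by rewrite /Rintegral fineK//; exact: integrable_fin_num (bfx x).
have [mf [M M0 fM]] := bf.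
apply: (@bbsP _ _ _ _ _ (M * fine (mu [set y | `|y| <= M])) M).
- apply/measurable_EFinP; rewrite (_ : _ \o _ = fun x =>
    (\int[mu]_y (f (rV_cons (x, y)))%:E)%E).
    exact: (measurable_fubini_F (integrable_cons bf)).
  by apply/funext => x; rewrite /= FE.
- move=> x; rewrite (le_trans (le_normr_Rintegral _ _))//.
  have mB := @measurable_rV_cball R n M.
  rewrite -Rintegral_cst// [leRHS]Rintegral_mkcond.
  apply: le_Rintegral => //.
  + by apply: bbsV_integrable; apply: bbs_norm; exact: bbs_section.
  + apply: bbsV_integrable.
    rewrite (_ : _ \_ _ = fun y => M * \1_[set y | `|y| <= M] y).
      by apply: bbsZ; apply: (@bbs_indic _ _ _ _ _ M).
    apply/funext => y; rewrite patchE indicE; case: ifPn => //.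
      by rewrite mulr1.
    by rewrite mulr0.
  + move=> y _; rewrite patchE; case: ifPn => [_|].
      by have [] := fM (rV_cons (x, y)).
    rewrite notin_setE/= => /negP; rewrite -ltNge => yM.
    have [_ ->] := fM (rV_cons (x, y)); first by rewrite normr0.
    by rewrite ltNge rV_norm_cons// negb_and -!ltNge yM orbT.
- move=> x Mx; rewrite [LHS](_ : _ = \int[mu]_y (0 : R)).
    by rewrite Rintegral_cst// mul0r.
  apply: eq_Rintegral => y _; have [_ ->//] := fM (rV_cons (x, y)).
  by rewrite ltNge rV_norm_cons// negb_and -!ltNge Mx.
Qed.

Lemma Rintegral_rV_cons (f : 'rV[R]_n.+1 -> R) : bbsV R n.+1 f ->
  \int[mu1]_x f x = \int[leb]_x \int[mu]_y f (rV_cons (x, y)).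
Proof.
move=> bf; rewrite {1}/Rintegral.
have := bbsV_integrable bf => fi.
rewrite /= /cons_measure integral_pushforward//; last 3 first.
- exact: measurable_rV_cons.
- by case/integrableP : fi.
- by rewrite preimage_setT; exact: integrable_cons.
rewrite preimage_setT -integral12_prod_meas1; last exact: integrable_cons.
rewrite /Rintegral; congr fine; apply: eq_integral => x _.
rewrite fineK//; apply: integrable_fin_num => //.
exact: bbsV_integrable (bbs_section x bf).
Qed.

End fubini_rV.

(** * Translations and dilations *)

Section affine_lebesgue1.
Context {R : realType}.
Notation leb := (@lebesgue_measure R).

Lemma measurable_affine1 (a b : R) :
  measurable_fun [set: measurableTypeR R]
    ((fun x => a * x + b) : measurableTypeR R -> measurableTypeR R).
Proof. by apply: measurable_funD => //; exact: measurable_funM. Qed.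

(** By uniqueness of Lebesgue measure only half-open intervals have to be compared. A negative [a]
    moves the closed end to the other side, which does not change the length. *)
Lemma lebesgue_measure_affine (a b : R) (A : set R) : a != 0 -> measurable A ->
  (`|a|%:E * leb ((fun x => (a * x + b)%R) @^-1` A) = leb A)%E.
Proof.
move=> a0; have na0 : 0 <= `|a| by [].
pose P : {measure set (measurableTypeR R) -> \bar R} :=
  measure_function_pushforward__canonical__measure_function_Measure
    (@lebesgue_measure R) (measurable_affine1 a b).
move=> mA; apply/esym.
apply: (@lebesgue_measure_unique R (mscale (NngNum na0) P)) => //.
move=> _ [[u v]] _ <-.
change (leb `]u, v]%classic =
  (`|a|%:E * leb ((fun x => (a * x + b)%R) @^-1` `]u, v]%classic)))%E.
have [uv|vu] := leP v u.
  rewrite (_ : `]u, v]%classic = set0); last first.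
    by apply/seteqP; split => // x /=; rewrite in_itv/= => /andP[? ?]; lra.
  by rewrite preimage_set0 !measure0 mule0.
have [ap|an] := ltP 0 a.
  rewrite (_ : _ @^-1` _ = `](u - b) / a, (v - b) / a]%classic); last first.
    apply/seteqP; split => x /=; rewrite !in_itv/= ltr_pdivrMr// ler_pdivlMr//.
      by move=> /andP[? ?]; apply/andP; split; lra.
    by move=> /andP[? ?]; apply/andP; split; lra.
  rewrite !lebesgue_measure_itv/= !lte_fin vu ltr_pM2r ?invr_gt0// ltrD2r vu.
  by rewrite -!EFinB -EFinM; congr EFin; rewrite gtr0_norm//; field.
have {an} an : a < 0 by rewrite lt_neqAle a0.
rewrite (_ : _ @^-1` _ = `[(v - b) / a, (u - b) / a[%classic); last first.
  apply/seteqP; split => x /=; rewrite !in_itv/= ltr_ndivlMr// ler_ndivrMr//.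
    by move=> /andP[? ?]; apply/andP; split; lra.
  by move=> /andP[? ?]; apply/andP; split; lra.
rewrite !lebesgue_measure_itv/= !lte_fin vu ltr_nM2r ?invr_lt0// ltrD2r vu.
by rewrite -!EFinB -EFinM; congr EFin; rewrite ltr0_norm//; field.
Qed.

Local Open Scope ereal_scope.
Lemma ge0_integral_affine1 (a b : R) (f : R -> \bar R) : a != 0%R ->
  measurable_fun [set: measurableTypeR R] f -> (forall x, 0 <= f x) ->
  `|a|%:E * \int[leb]_x f (a * x + b)%R = \int[leb]_x f x.
Proof.
move=> a0 mf f0; have na0 : (0 <= `|a|)%R by [].
pose P : {measure set (measurableTypeR R) -> \bar R} :=
  measure_function_pushforward__canonical__measure_function_Measure
    (@lebesgue_measure R) (measurable_affine1 a b).
have H := @ge0_integral_pushforward _ _ _ _ R _ (measurable_affine1 a b)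
  (@lebesgue_measure R) setT f measurableT mf (fun x _ => f0 x).
rewrite preimage_setT in H.
rewrite -[X in _ * X]H -[LHS](@ge0_integral_mscale _ _ R P setT measurableT (NngNum na0) f)//.
apply: eq_measure_integral => A mA _.
by have := lebesgue_measure_affine b a0 mA.
Qed.

End affine_lebesgue1.

Section affine_lebesgue.
Context {R : realType}.

Lemma rV_cons_affine n (a : R) (x : R) (y : 'rV[R]_n) (b : 'rV[R]_n.+1) :
  a *: rV_cons (x, y) + b =
  rV_cons (a * x + b 0 ord0, a *: y + (rV_uncons b).2).
Proof.
apply/rowP => i; rewrite 2!mxE; case: (unliftP ord0 i) => [j|] ->.
  by rewrite !rV_consS/= !mxE.
by rewrite !rV_cons0.
Qed.

Lemma measurable_affine n (a : R) (b : 'rV[R]_n) :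
  measurable_fun [set: 'rV[R]_n] (fun x : 'rV[R]_n => a *: x + b).
Proof.
apply: measurable_fun_rV => i.
rewrite (_ : _ \o _ = fun x => a * (rV_coord i x) + b 0 i).
  apply: measurable_funD => //; apply: measurable_funM => //.
  exact: measurable_rV_coord.
by apply/funext => x; rewrite /rV_coord /= !mxE.
Qed.

Local Open Scope ereal_scope.
(** The section at [x] of the preimage is the preimage, under the map in the remaining coordinates,
    of the section at [a x + b_0]. The slices contribute [|a| ^ n] by induction and the outer
    integral the last factor. *)
Lemma borel_lebesgue_affine n (a : R) (b : 'rV[R]_n) (A : set 'rV[R]_n) :
  a != 0%R -> measurable A ->
  (`|a| ^+ n)%:E * borel_lebesgue R n ((fun x => (a *: x + b)%R) @^-1` A)
    = borel_lebesgue R n A.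
Proof.
move=> a0; elim: n => [|n IH] in b A * => mA.
  rewrite expr0 mul1e /=; congr (dirac _ _).
  apply/seteqP; split => x /=; first by rewrite !thinmx0.
  by rewrite (_ : (a *: x + b)%R = x)// !thinmx0.
have mC : measurable ((@rV_cons R n) @^-1` A).
  by rewrite -[X in measurable X]setTI; exact: measurable_rV_cons.
rewrite /= /cons_measure /pushforward /product_measure1.
have Hx x : (`|a| ^+ n)%:E * (borel_lebesgue R n \o xsection
      (@rV_cons R n @^-1` ((fun x => (a *: x + b)%R) @^-1` A))) x =
    (borel_lebesgue R n \o xsection (@rV_cons R n @^-1` A)) (a * x + b 0%R ord0)%R.
  rewrite /=.
  have := IH (rV_uncons b).2 (xsection (@rV_cons R n @^-1` A) (a * x + b 0%R ord0)%R)
     (measurable_xsection _ mC).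
  move=> <-; congr (_ * borel_lebesgue R n _).
  apply/seteqP; split => y; rewrite /xsection/= !inE/=;
    by rewrite rV_cons_affine.
rewrite exprS EFinM -muleA -ge0_integralZl//=; last first.
- apply: measurable_fun_xsection.
  rewrite -[X in measurable X]setTI; apply: measurable_rV_cons => //.
  by rewrite -[X in measurable X]setTI; exact: measurable_affine.
rewrite (_ : \int[_]_x _ = \int[lebesgue_measure]_x
  (borel_lebesgue R n \o xsection (@rV_cons R n @^-1` A)) (a * x + b 0%R ord0)%R).
  2: by apply: eq_integral => x _; rewrite -Hx.
apply: (@ge0_integral_affine1 R a (b 0%R ord0)
  (borel_lebesgue R n \o xsection (@rV_cons R n @^-1` A))) => //.
exact: measurable_fun_xsection.
Qed.

Lemma Rintegral_affine n (a : R) (b : 'rV[R]_n) (f : 'rV[R]_n -> R) :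
  a != 0%R -> bbsV R n f ->
  (`|a| ^+ n * \int[borel_lebesgue R n]_x f (a *: x + b))%R
  = (\int[borel_lebesgue R n]_x f x)%R.
Proof.
move=> a0 bf; have an : (0 <= `|a| ^+ n)%R by rewrite exprn_ge0.
pose P : {measure set 'rV[R]_n -> \bar R} :=
  measure_function_pushforward__canonical__measure_function_Measure
    (borel_lebesgue R n) (measurable_affine a b).
have [mf _] := bf.
have H0 (g : 'rV[R]_n -> \bar R) : measurable_fun setT g -> (forall x, 0 <= g x) ->
    (`|a| ^+ n)%:E * \int[borel_lebesgue R n]_x g (a *: x + b)%R =
    \int[borel_lebesgue R n]_x g x.
  move=> mg g0.
  have H := @ge0_integral_pushforward _ _ _ _ R _ (measurable_affine a b)
    (borel_lebesgue R n) setT g measurableT mg (fun x _ => g0 x).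
  rewrite preimage_setT in H.
  rewrite -[X in _ * X]H -[LHS](@ge0_integral_mscale _ _ R P setT measurableT (NngNum an) g)//.
  apply: eq_measure_integral => A mA _.
  by have := borel_lebesgue_affine b a0 mA.
rewrite /Rintegral -[X in (X * _)%R]/(fine (`|a| ^+ n)%:E).
have mF : measurable_fun setT (EFin \o f) by exact/measurable_EFinP.
have /integrableP[_ foo] := bbsV_integrable bf.
(* Finiteness of both parts is what lets [fine] pass through the difference of the two integrals. *)
have fp : \int[borel_lebesgue R n]_x (EFin \o f)^\+ x < +oo.
  exact: integral_funepos_lt_pinfty (bbsV_integrable bf).
have fn : \int[borel_lebesgue R n]_x (EFin \o f)^\- x < +oo.
  exact: integral_funeneg_lt_pinfty (bbsV_integrable bf).
have pa : (0 < `|a| ^+ n)%R by rewrite exprn_gt0// normr_gt0.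
have Hp := H0 _ (measurable_funepos mF) (fun x => funepos_ge0 _ x).
have Hn := H0 _ (measurable_funeneg mF) (fun x => funeneg_ge0 _ x).
rewrite -Hp in fp; rewrite -Hn in fn.
rewrite integralE [in RHS]integralE.
rewrite -Hp -Hn.
have fin1 (y : \bar R) : 0 <= y -> (`|a| ^+ n)%:E * y < +oo -> y \is a fin_num.
  move=> y0; case: y y0 => // _; rewrite gt0_muley//.
have fp' := fin1 _ (integral_ge0 _ (fun x _ => funepos_ge0 _ _)) fp.
have fn' := fin1 _ (integral_ge0 _ (fun x _ => funeneg_ge0 _ _)) fn.
rewrite -muleBr//; last by rewrite fin_num_adde_defr.
rewrite fineM//; last by rewrite fin_numB fp' fn'.
congr (_ * fine (_ - _))%R; apply: eq_integral => x _.
  exact: (congr1 (@^~ x) (funepos_comp (EFin \o f) (fun x => a *: x + b)%R)).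
exact: (congr1 (@^~ x) (funeneg_comp (EFin \o f) (fun x => a *: x + b)%R)).
Qed.

End affine_lebesgue.

(** * Differential calculus *)

Section dot_enorm.
Context {R : realType} {n : nat}.
Implicit Types (x y z : 'rV[R]_n).

Lemma dotE x y : dot x y = \sum_i x 0 i * y 0 i.
Proof. by rewrite /dot mxE; apply: eq_bigr => i _; rewrite mxE. Qed.

Lemma dotC x y : dot x y = dot y x.
Proof. by rewrite !dotE; apply: eq_bigr => i _; rewrite mulrC. Qed.

Lemma dotDl x y z : dot (x + y) z = dot x z + dot y z.
Proof. by rewrite /dot mulmxDl mxE. Qed.

Lemma dotDr x y z : dot x (y + z) = dot x y + dot x z.
Proof. by rewrite dotC dotDl !(dotC x). Qed.

Lemma dotZl (a : R) x y : dot (a *: x) y = a * dot x y.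
Proof. by rewrite /dot -scalemxAl mxE. Qed.

Lemma dotZr (a : R) x y : dot x (a *: y) = a * dot x y.
Proof. by rewrite dotC dotZl dotC. Qed.

Lemma dotNl x y : dot (- x) y = - dot x y.
Proof. by rewrite -scaleN1r dotZl mulN1r. Qed.

Lemma dotNr x y : dot x (- y) = - dot x y.
Proof. by rewrite dotC dotNl dotC. Qed.

Lemma dot0r x : dot x 0 = 0.
Proof. by rewrite dotE big1// => i _; rewrite mxE mulr0. Qed.

Lemma dotBl x y z : dot (x - y) z = dot x z - dot y z.
Proof. by rewrite dotDl dotNl. Qed.

Lemma dotBr x y z : dot x (y - z) = dot x y - dot x z.
Proof. by rewrite dotDr dotNr. Qed.

Lemma dot_deltal x i : dot (delta_mx 0 i) x = x 0 i.
Proof.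
rewrite dotE (bigD1 i)//= mxE !eqxx mul1r big1 ?addr0// => j ji.
by rewrite mxE (negbTE ji) andbF mul0r.
Qed.

Lemma dot_ge0 x : 0 <= dot x x.
Proof. by rewrite dotE sumr_ge0// => i _; rewrite -expr2 sqr_ge0. Qed.

Lemma dot_eq0 x : (dot x x == 0) = (x == 0).
Proof.
apply/eqP/eqP => [|->]; last by rewrite dot0r.
rewrite dotE => /psumr_eq0P H; apply/rowP => i; rewrite mxE.
have /eqP := H (fun j _ => sqr_ge0 (x 0 j)) i isT.
by rewrite -expr2 sqrf_eq0 => /eqP.
Qed.

Lemma dot_gt0 x : (0 < dot x x) = (x != 0).
Proof. by rewrite lt0r dot_eq0 dot_ge0 andbT. Qed.

Lemma enormE x : enorm x = Num.sqrt (dot x x).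
Proof.
by rewrite /enorm big_ord1 dotE.
Qed.

Lemma enorm_ge0 x : 0 <= enorm x. Proof. by rewrite enormE sqrtr_ge0. Qed.

Lemma enorm_sqr x : enorm x ^+ 2 = dot x x.
Proof. by rewrite enormE sqr_sqrtr// dot_ge0. Qed.

Lemma enorm_eq0 x : (enorm x == 0) = (x == 0).
Proof. by rewrite -sqrf_eq0 enorm_sqr dot_eq0. Qed.

Lemma enorm_gt0 x : (0 < enorm x) = (x != 0).
Proof. by rewrite lt0r enorm_eq0 enorm_ge0 andbT. Qed.

Lemma enormZ (a : R) x : enorm (a *: x) = `|a| * enorm x.
Proof.
by rewrite !enormE dotZl dotZr mulrA -expr2 sqrtrM ?sqr_ge0// sqrtr_sqr.
Qed.

Lemma enorm0 : enorm (0 : 'rV[R]_n) = 0.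
Proof. by apply/eqP; rewrite enorm_eq0. Qed.

Lemma enormN x : enorm (- x) = enorm x.
Proof. by rewrite -scaleN1r enormZ normrN1 mul1r. Qed.

Lemma cauchy_schwarz_dot x y : dot x y <= enorm x * enorm y.
Proof.
have [->|y0] := eqVneq y 0; first by rewrite dot0r enorm0 mulr0.
have ny : 0 < enorm y by rewrite enorm_gt0.
have := dot_ge0 (enorm y ^+ 2 *: x - dot x y *: y).
rewrite dotBl !dotBr !dotZl !dotZr (dotC y x) -!enorm_sqr.
move=> H; have {H} : 0 <= enorm y ^+ 2 * ((enorm x * enorm y) ^+ 2 - dot x y ^+ 2).
  by apply: le_trans H _; rewrite le_eqVlt; apply/orP; left; apply/eqP; ring.
rewrite pmulr_rge0 ?exprn_gt0// subr_ge0 => H.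
rewrite (le_trans (ler_norm _))// -ler_sqr ?nnegrE ?mulr_ge0 ?enorm_ge0//.
by rewrite -normrX ger0_norm// sqr_ge0.
Qed.

Lemma normr_dot x y : `|dot x y| <= enorm x * enorm y.
Proof.
rewrite ler_norml cauchy_schwarz_dot andbT lerNl -dotNl.
by rewrite (le_trans (cauchy_schwarz_dot _ _))// enormN.
Qed.

Lemma enorm_triangle x y : enorm (x + y) <= enorm x + enorm y.
Proof.
rewrite -ler_sqr ?nnegrE ?addr_ge0 ?enorm_ge0// sqrrD !enorm_sqr.
rewrite dotDl !dotDr (dotC y x); have := cauchy_schwarz_dot x y; lra.
Qed.

Lemma enorm_coord x i : `|x 0 i| <= enorm x.
Proof.
rewrite -ler_sqr ?nnegrE ?enorm_ge0// enorm_sqr real_normK ?num_real//.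
rewrite dotE (bigD1 i)//= -expr2 lerDl sumr_ge0// => j _.
by rewrite -expr2 sqr_ge0.
Qed.

Lemma norm_le_enorm x : `|x| <= enorm x.
Proof. by apply/rV_norm_leP => [|i]; [exact: enorm_ge0|exact: enorm_coord]. Qed.

Lemma enorm_le_norm x : enorm x <= n%:R * `|x|.
Proof.
rewrite -ler_sqr ?nnegrE ?enorm_ge0 ?mulr_ge0// enorm_sqr dotE.
have -> : (n%:R * `|x|) ^+ 2 = \sum_(i < n) n%:R * (`|x| ^+ 2) :> R.
  by rewrite sumr_const card_ord -mulr_natl; ring.
apply: ler_sum => i _.
have xi : x 0 i * x 0 i <= `|x| ^+ 2.
  rewrite -expr2 -real_normK ?num_real// ler_sqr ?nnegrE//.
  exact: rV_coord_le_norm.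
rewrite (le_trans xi)// ler_peMl ?sqr_ge0//.
by rewrite ler1n (leq_ltn_trans _ (ltn_ord i)).
Qed.

End dot_enorm.

Section C1g.
Context {R : realType} {n : nat}.
Implicit Types (f g : 'rV[R]_n -> R) (df dg : 'rV[R]_n -> 'rV[R]_n).
Implicit Types (U V : set 'rV[R]_n) (x y v : 'rV[R]_n).

(** The gradient is carried along as an explicit function, so that it can be computed by rules. Only
    partial derivatives and continuity of [df] are demanded; differentiability, and hence the chain
    rule, is derived from them. *)
Definition C1g U f df := forall x, U x ->
  (forall i, is_derive x (delta_mx 0 i) f (df x 0 i)) /\ {for x, continuous df}.

Lemma line_derive f y v (t d : R) : is_derive (y + t *: v) v f d ->
  is_derive t 1 (fun s : R => f (y + s *: v)) d.
Proof.
have E : (fun h : R => h^-1 *: ((f \o shift (y + t *: v)) (h *: v) - f (y + t *: v)))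
    = (fun h => h^-1 *: (((fun s : R => f (y + s *: v)) \o shift t) (h *: 1)
         - f (y + t *: v))).
  apply/funext => h /=; congr (_ *: (f _ - _)).
  by rewrite [h *: 1]mulr1 scalerDl addrCA addrC -!addrA [h *: v + _]addrC.
move=> [H1 H2]; split; first by move: H1; rewrite /derivable E.
by rewrite -H2 /derive E.
Qed.

Lemma coord_cvg df x i : {for x, continuous df} ->
  {for x, continuous (fun y => df y 0 i)}.
Proof.
move=> cdf; apply: (@continuous_comp _ _ _ df (fun M : 'rV[R]_n => M 0 i) x) => //.
exact: coord_continuous.
Qed.

Let trunc (k : nat) (h : 'rV[R]_n) : 'rV[R]_n :=
  \row_i (if (i < k)%N then h 0 i else 0).

Let trunc0 h : trunc 0 h = 0. Proof. by apply/rowP => i; rewrite !mxE. Qed.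

Let truncn h : trunc n h = h.
Proof. by apply/rowP => i; rewrite !mxE ltn_ord. Qed.

Let truncS (k : 'I_n) h : trunc k.+1 h = trunc k h + h 0 k *: delta_mx 0 k.
Proof.
apply/rowP => i; rewrite !mxE ltnS leq_eqVlt eqxx/= -val_eqE/=.
case: ltngtP => // [ik|ki|ik] /=; rewrite ?mulr0 ?addr0// mulr1 add0r.
by congr (h 0 _); exact: val_inj.
Qed.

(** Continuous partial derivatives give differentiability: [x] is joined to [x + h] by changing one
    coordinate at a time through [trunc], and the mean value theorem on each edge leaves an error of
    at most [|h| e / (n + 1)]. Dividing by [n + 1] instead of [n] also covers [n = 0]. *)
Lemma C1g_increment U f df x (e : R) : open U -> C1g U f df -> U x -> 0 < e ->
  \forall h \near (0 : 'rV[R]_n),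
    `|f (h + x) - f x - dot h (df x)| <= e * `|h|.
Proof.
move=> oU fU Ux e0.
have n1 : 0 < (n.+1%:R : R) by rewrite ltr0n.
have e'0 : 0 < e / n.+1%:R by rewrite divr_gt0.
have : \forall y \near x, U y /\ `|df x - df y| < e / n.+1%:R.
  apply: filterI; first by move: oU; rewrite openE => /(_ x Ux).
  by have [_ /cvgrPdist_lt] := fU x Ux; exact.
move=> /nbhs_ballP[d /= d0 xd].
have dP z : `|z - x| < d -> U z /\ `|df x - df z| < e / n.+1%:R.
  by move=> zd; apply: xd; rewrite mx_norm_ball /ball_ /= distrC.
apply/nbhs_ballP; exists d => //= h; rewrite mx_norm_ball /ball_ /= sub0r normrN => hd.
have step (k : 'I_n) : `|f (x + trunc k.+1 h) - f (x + trunc k h) - h 0 k * df x 0 k|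
     <= `|h| * (e / n.+1%:R).
  have near_seg (c : R) : `|c| <= `|h 0 k| ->
      U (x + trunc k h + c *: delta_mx 0 k) /\
      `|df x - df (x + trunc k h + c *: delta_mx 0 k)| < e / n.+1%:R.
    move=> ch; apply: dP; rewrite -[x + _ + _]addrA [X in `|X| < _]addrC addKr.
    apply: le_lt_trans hd; apply/rV_norm_leP => // i; rewrite !mxE eqxx/=.
    have [->|ik] := eqVneq i k.
      rewrite ltnn add0r mulr1 (le_trans ch)//; exact: rV_coord_le_norm.
    rewrite mulr0 addr0; case: ifP => _; first exact: rV_coord_le_norm.
    by rewrite normr0.
  pose g (t : R) := f (x + trunc k h + t *: delta_mx 0 k).
  have gd (t : R) : `|t| <= `|h 0 k| ->
      is_derive t 1 g (df (x + trunc k h + t *: delta_mx 0 k) 0 k).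
    move=> th; apply: line_derive; have [/fU[+ _] _] := near_seg t th; exact.
  (* The mean value theorem wants ordered endpoints, hence the two cases on the sign of the
     coordinate. *)
  have [c ch gE] : exists2 c, `|c| <= `|h 0 k| &
      g (h 0 k) - g 0 = df (x + trunc k h + c *: delta_mx 0 k) 0 k * h 0 k.
    have [h0|h0] := leP 0 (h 0 k).
      have gd' (t : R) : t \in `[0, h 0 k] ->
          is_derive t 1 g (df (x + trunc k h + t *: delta_mx 0 k) 0 k).
        by rewrite in_itv/= => /andP[? ?]; apply: gd; rewrite !ger0_norm.
      have [c] := @MVT_segment R g _ 0 (h 0 k) h0
        (fun t ht => gd' t (subset_itv_oo_cc ht))
        (derivable_within_continuous (fun t ht => @ex_derive _ _ _ _ _ _ _ (gd' t ht))).
      rewrite in_itv/= subr0 => /andP[? ?]; exists c => //.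
      by rewrite !ger0_norm.
    have gd' (t : R) : t \in `[h 0 k, 0] ->
        is_derive t 1 g (df (x + trunc k h + t *: delta_mx 0 k) 0 k).
      by rewrite in_itv/= => /andP[? ?]; apply: gd; rewrite !ler0_norm ?lerN2// ltW.
    have [c] := @MVT_segment R g _ (h 0 k) 0 (ltW h0)
      (fun t ht => gd' t (subset_itv_oo_cc ht))
      (derivable_within_continuous (fun t ht => @ex_derive _ _ _ _ _ _ _ (gd' t ht))).
    rewrite in_itv/= => /andP[? ?] E; exists c.
      by rewrite !ler0_norm ?lerN2// ltW.
    by rewrite -opprB E; ring.
  have [_ dfc] := near_seg c ch.
  rewrite truncS addrA -/(g (h 0 k)).
  have -> : f (x + trunc k h) = g 0 by rewrite /g scale0r addr0.
  rewrite gE mulrC -mulrBr normrM ler_pM//; first exact: rV_coord_le_norm.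
  rewrite distrC; have := rV_coord_le_norm (df x - df (x + trunc k h + c *: delta_mx 0 k)) k.
  by rewrite !mxE => /le_trans; apply; exact: ltW.
have -> : f (h + x) - f x - dot h (df x) =
    \sum_(k < n) (f (x + trunc k.+1 h) - f (x + trunc k h) - h 0 k * df x 0 k).
  rewrite big_split/= sumrN -dotE; congr (_ - _).
  rewrite -(big_mkord xpredT (fun k => f (x + trunc k.+1 h) - f (x + trunc k h))).
  by rewrite [h + x]addrC (telescope_sumr (fun i => f (x + trunc i h)))// truncn trunc0 addr0.
rewrite (le_trans (ler_norm_sum _ _ _))//.
rewrite (le_trans (ler_sum _ (fun k _ => step k)))//.
rewrite sumr_const card_ord -[leLHS]mulr_natl.
have E : n%:R * (`|h| * (e / n.+1%:R)) = n%:R / n.+1%:R * (e * `|h|).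
  by move: (n.+1%:R^-1 : R) => c; ring.
have H : n%:R * (`|h| * (e / n.+1%:R)) <= e * `|h|.
  by rewrite E ler_piMl ?mulr_ge0 ?(ltW e0)// ler_pdivrMr// mul1r ler_nat.
exact: H.
Qed.

Lemma dot_linear (w : 'rV[R]_n) : linear (fun v : 'rV[R]_n => dot v w : R^o).
Proof. by move=> a u v; rewrite dotDl dotZl. Qed.

Lemma dot_continuousl (w : 'rV[R]_n) : continuous (fun v : 'rV[R]_n => dot v w).
Proof.
have -> : (fun v : 'rV[R]_n => dot v w) = \sum_i (fun v : 'rV[R]_n => v 0 i * w 0 i).
  by apply/funext => v; rewrite dotE fct_sumE.
elim/big_ind : _ => [|f g cf cg|i _] x.
- exact: (@cst_continuous _ _ (0 : R)).
- by apply: continuousD; [exact: cf|exact: cg].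
- by apply: continuousM; [exact: coord_continuous|exact: cst_continuous].
Qed.

Lemma C1g_differentiable U f df x : open U -> C1g U f df -> U x ->
  differentiable f x /\ forall v, 'd f x v = dot v (df x).
Proof.
move=> oU fU Ux.
pose L : {linear 'rV[R]_n -> R^o} := HB.pack (fun v : 'rV[R]_n => dot v (df x) : R^o)
  (GRing.isLinear.Build R 'rV[R]_n R^o *:%R _ (dot_linear (df x))).
have E : f \o shift x = cst (f x) + L +o_ (0 : 'rV[R]_n) id.
  apply/eqaddoP => e e0; have := C1g_increment oU fU Ux e0.
  apply: filterS => h H.
  by rewrite -[X in `|X|]/(f (h + x) - (f x + dot h (df x))) opprD addrA.
have cL : continuous L by exact: dot_continuousl.
have dE := diff_unique cL E.
split; last by move=> v; rewrite dE.
by apply/diff_locallyP; split; rewrite dE.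
Qed.

Lemma C1g_is_derive U f df x v : open U -> C1g U f df -> U x ->
  is_derive x v f (dot v (df x)).
Proof.
move=> oU fU Ux; have [dfx E] := C1g_differentiable oU fU Ux.
by apply: DeriveDef; [exact: diff_derivable|rewrite deriveE].
Qed.

Lemma C1g_continuous U f df x : open U -> C1g U f df -> U x ->
  {for x, continuous f}.
Proof.
move=> oU fU Ux; have [dfx _] := C1g_differentiable oU fU Ux.
exact: differentiable_continuous.
Qed.

Lemma C1g_partial U f df x i : C1g U f df -> U x -> partial i f x = df x 0 i.
Proof. by move=> fU /fU[/(_ i)[_ <-]]. Qed.

Lemma C1g_grad U f df x : C1g U f df -> U x -> grad f x = df x.
Proof. by move=> fU Ux; apply/rowP => i; rewrite mxE (C1g_partial i fU Ux). Qed.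

Lemma C1gP U f df : open U -> C1g U f df -> C1_on U f.
Proof.
move=> oU fU i x Ux; have [fx cx] := fU x Ux; split.
  by have [] := fx i.
have cxi := coord_cvg (i := i) cx.
rewrite /prop_for /continuous_at (C1g_partial i fU Ux).
have E : {near x, (fun y => df y 0 i) =1 partial i f}.
  move: oU; rewrite openE => /(_ x Ux); apply: filterS => y Uy.
  by rewrite (C1g_partial i fU Uy).
exact: cvg_trans (near_eq_cvg E) cxi.
Qed.

Lemma continuous_rV df x : (forall i, {for x, continuous (fun y => df y 0 i)}) ->
  {for x, continuous df}.
Proof.
move=> H; apply/(@cvgrPdist_lt _ _ _ (nbhs x) (nbhs_filter x)) => e e0.
have H' i : \forall y \near x, `|df x 0 i - df y 0 i| < e.
  by have /cvgrPdist_lt := H i; exact.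
have := @filter_forall _ _ _ (nbhs x) (nbhs_filter x) H'; apply: filterS => y Hy.
by apply/rV_norm_ltP => // i; rewrite !mxE.
Qed.

Lemma C1_on_C1g U f : C1_on U f -> C1g U f (grad f).
Proof.
move=> fU x Ux; split.
  by move=> i; have [+ _] := fU i x Ux => /derivableP; rewrite mxE.
apply: continuous_rV => i; have [_] := fU i x Ux.
by rewrite (_ : (fun y => grad f y 0 i) = partial i f)//; apply/funext => y; rewrite mxE.
Qed.

Lemma C1gS U V f df : V `<=` U -> C1g U f df -> C1g V f df.
Proof. by move=> VU fU x /VU /fU. Qed.

Lemma C1g_eq U f df g dg : open U -> {in U, f =1 g} -> {in U, df =1 dg} ->
  C1g U f df -> C1g U g dg.
Proof.
move=> oU fg dfg fU x Ux; have [fx cx] := fU x Ux.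
have nU : \forall y \near x, y \in U.
  move: oU; rewrite openE => /(_ x Ux); apply: filterS => y.
  exact: mem_set.
split=> [i|].
  apply: (near_eq_is_derive (f := f)); last by rewrite -dfg ?inE//; exact: fx.
  by apply: filterS nU => y /fg.
rewrite /prop_for /continuous_at -dfg ?inE//.
have E : {near x, df =1 dg} by move: nU; apply: filterS => y /dfg.
exact: cvg_trans (near_eq_cvg E) cx.
Qed.

Lemma C1g_cst U (c : R) : C1g U (fun=> c) (fun=> 0).
Proof.
move=> x Ux; split=> [i|]; last exact: cst_continuous.
by rewrite mxE; exact: is_derive_cst.
Qed.

Lemma C1gD U f df g dg : C1g U f df -> C1g U g dg ->
  C1g U (fun x => f x + g x) (fun x => df x + dg x).
Proof.
move=> fU gU x Ux; have [fx cfx] := fU x Ux; have [gx cgx] := gU x Ux.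
split=> [i|]; last exact: continuousD.
by rewrite mxE; exact: is_deriveD.
Qed.

Lemma C1gM U f df g dg : open U -> C1g U f df -> C1g U g dg ->
  C1g U (fun x => f x * g x) (fun x => f x *: dg x + g x *: df x).
Proof.
move=> oU fU gU x Ux; have [fx cfx] := fU x Ux; have [gx cgx] := gU x Ux.
split=> [i|]; first by rewrite !mxE; exact: is_deriveM.
have cf := C1g_continuous oU fU Ux; have cg := C1g_continuous oU gU Ux.
exact: (continuousD (continuousZ cf cgx) (continuousZ cg cfx)).
Qed.

Lemma C1gZ U (c : R) f df : open U -> C1g U f df ->
  C1g U (fun x => c * f x) (fun x => c *: df x).
Proof.
move=> oU fU; apply: C1g_eq (C1gM oU (@C1g_cst U c) fU) => // x _.
by rewrite scaler0 addr0.
Qed.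

Lemma C1gN U f df : open U -> C1g U f df ->
  C1g U (fun x => - f x) (fun x => - df x).
Proof.
move=> oU fU; apply: C1g_eq (C1gZ (-1) oU fU) => // x _.
  by rewrite mulN1r.
by rewrite scaleN1r.
Qed.

Lemma C1gB U f df g dg : open U -> C1g U f df -> C1g U g dg ->
  C1g U (fun x => f x - g x) (fun x => df x - dg x).
Proof. by move=> oU fU gU; exact: (C1gD fU (C1gN oU gU)). Qed.

Lemma C1g_comp U f df (phi dphi : R -> R) : open U -> C1g U f df ->
  (forall x, U x -> is_derive (f x) 1 phi (dphi (f x)) /\
    {for f x, continuous dphi}) ->
  C1g U (fun x => phi (f x)) (fun x => dphi (f x) *: df x).
Proof.
move=> oU fU Hphi x Ux; have [fx cfx] := fU x Ux; have [px cp] := Hphi x Ux.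
have cf := C1g_continuous oU fU Ux.
split=> [i|]; last first.
  by apply: continuousZ => //; exact: (@continuous_comp _ _ _ f dphi x cf cp).
have [dfx dfE] := C1g_differentiable oU fU Ux.
have dpx : differentiable phi (f x).
  by apply/derivable1_diffP; have [] := px.
have dc : differentiable (phi \o f) x by exact: differentiable_comp.
apply: DeriveDef; first exact: diff_derivable.
rewrite deriveE// diff_comp//= dfE dot_deltal mxE.
rewrite -[df x 0 i in LHS]mulr1 [LHS]linearZ -deriveE// mulrC; congr (_ * _).
by have [_ ->] := px.
Qed.

Lemma C1gV U f df : open U -> (forall x, U x -> f x != 0) -> C1g U f df ->
  C1g U (fun x => (f x)^-1) (fun x => (- (f x) ^- 2) *: df x).
Proof.
move=> oU f0 fU.
suff H x : U x -> is_derive (f x) 1 (fun y : R => y^-1) (- (f x) ^- 2) /\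
    {for f x, continuous (fun y : R => - y ^- 2)}.
  exact: (@C1g_comp U f df (fun y : R => y^-1) (fun y : R => - y ^- 2) oU fU H).
move=> Ux.
have fx0 := f0 x Ux; split.
  apply: DeriveDef; first exact: (derivableV fx0 (@derivable_id _ _ _ _)).
  by rewrite (deriveV fx0 (@derivable_id _ _ _ _)) derive_id [LHS]mulr1.
apply: continuousN; apply: continuousV => //; first by rewrite expf_neq0.
exact: exprn_continuous.
Qed.

Lemma C1g_coord U i : C1g U (fun x => x 0 i) (fun=> delta_mx 0 i).
Proof.
move=> x Ux; split=> [j|]; last exact: cst_continuous.
have E : (fun h : R => h^-1 *: (((fun y : 'rV[R]_n => y 0 i) \o shift x)
    (h *: delta_mx 0 j) - x 0 i)) @ 0^' --> (delta_mx 0 i : 'rV[R]_n) 0 j.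
  apply: cvg_near_cst; near=> h.
  rewrite /= !mxE addrK /= -[h^-1 *: _]/(h^-1 * _) mulrA mulVf ?mul1r.
    by rewrite (eq_sym i j).
  by near: h; exact: nbhs_dnbhs_neq.
split; first by apply/cvg_ex; eexists; exact: E.
exact: (cvg_lim _ E).
Unshelve. all: by end_near. Qed.

Lemma C1g_sum U (I : Type) (r : seq I) (f : I -> 'rV[R]_n -> R)
    (df : I -> 'rV[R]_n -> 'rV[R]_n) : (forall i, C1g U (f i) (df i)) ->
  C1g U (fun x => \sum_(i <- r) f i x) (fun x => \sum_(i <- r) df i x).
Proof.
move=> H; elim: r => [|i r IH].
  rewrite (_ : (fun x => \sum_(i <- [::]) f i x) = fun=> 0).
    rewrite (_ : (fun x => \sum_(i <- [::]) df i x) = fun=> 0).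
      exact: C1g_cst.
    by apply/funext => x; rewrite big_nil.
  by apply/funext => x; rewrite big_nil.
rewrite (_ : (fun x => \sum_(i <- _) f i x) = fun x => f i x + \sum_(i <- r) f i x).
  rewrite (_ : (fun x => \sum_(i <- _) df i x) = fun x => df i x + \sum_(i <- r) df i x).
    exact: C1gD.
  by apply/funext => x; rewrite big_cons.
by apply/funext => x; rewrite big_cons.
Qed.

Lemma C1g_dotxx U : open U -> C1g U (fun x => dot x x) (fun x => 2 *: x).
Proof.
move=> oU.
apply: C1g_eq (C1g_sum (index_enum _) (fun i => C1gM oU (@C1g_coord U i) (@C1g_coord U i))) => //.
  by move=> x _; rewrite dotE.
move=> x _; rewrite (_ : \sum_i _ = \sum_(i < n) 2 *: (x 0 i *: delta_mx 0 i)).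
  by rewrite -scaler_sumr -row_sum_delta.
by apply: eq_bigr => i _; rewrite scaler_nat mulr2n.
Qed.

End C1g.

(** * Integration by parts *)

Section integration_by_parts.
Context {R : realType} {n : nat}.
Implicit Types (f g : 'rV[R]_n -> R) (K : R).
Notation mu := (borel_lebesgue R n).

Lemma Rintegral_dominated d (T : measurableType d) (m : {measure set T -> \bar R})
    (f_ : nat -> T -> R) (f g : T -> R) :
  (forall k, measurable_fun [set: T] (f_ k : T -> measurableTypeR R)) ->
  measurable_fun [set: T] (f : T -> measurableTypeR R) ->
  (forall x, f_ ^~ x @ \oo --> f x) ->
  m.-integrable setT (EFin \o g) -> (forall k x, `|f_ k x| <= g x) ->
  (fun k => \int[m]_x f_ k x) @ \oo --> \int[m]_x f x.
Proof.
move=> mf_ mf cf ig fg.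
have [|||||i1 _ H] := @dominated_convergence _ T R m setT measurableT
  (fun k => EFin \o f_ k) (EFin \o f) (EFin \o g).
- by move=> k; apply/measurable_EFinP; exact: mf_.
- by apply/measurable_EFinP; exact: mf.
- by apply: aeW => x _; apply: cvg_EFin; [exact: nearW|exact: cf].
- exact: ig.
- by apply: aeW => x k _; rewrite lee_fin.
have fin : (\int[m]_x (f x)%:E)%E \is a fin_num.
  exact: integrable_fin_num i1.
by apply: fine_cvg; rewrite fineK.
Qed.

Lemma continuous_bbs f K : continuous f -> (forall x, K < `|x| -> f x = 0) ->
  bbsV R n f.
Proof.
move=> cf fK.
have cB : compact [set x : 'rV[R]_n | `|x| <= K].
  apply: bounded_closed_compact.
    exists K; split; first exact: num_real.
    by move=> M KM x /= xK; rewrite (le_trans xK)// ltW.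
  have -> : [set x : 'rV[R]_n | `|x| <= K] = (fun x => `|x|) @^-1` [set t | t <= K].
    by [].
  by apply: closed_comp => [x _|]; [exact: norm_continuous|exact: closed_le].
have [M [Mr HM]] : bounded_set (f @` [set x : 'rV[R]_n | `|x| <= K]).
  by apply: compact_bounded; apply: continuous_compact => //;
    exact: continuous_subspaceT.
apply: (@bbsP _ _ _ _ _ (Num.max 0 (M + 1)) K) => //.
  exact: continuous_measurable_rV.
move=> x; rewrite le_max; have [xK|Kx] := leP `|x| K.
  by apply/orP; right; apply: (HM (M + 1)); [rewrite ltrDl|exists x].
by rewrite fK// normr0 lexx.
Qed.

Lemma C1g_bbs f df K : C1g setT f df -> (forall x, K < `|x| -> f x = 0) ->
  bbsV R n f.
Proof.
by move=> fT; apply: continuous_bbs => x; exact: (C1g_continuous openT fT).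
Qed.

Lemma open_norm_gt K : open [set x : 'rV[R]_n | K < `|x|].
Proof.
have -> : [set x : 'rV[R]_n | K < `|x|] = (fun x => `|x|) @^-1` [set t | K < t] by [].
by apply: open_comp => [x _|]; [exact: norm_continuous|exact: open_gt].
Qed.

Lemma C1g_zero_out f df K : C1g setT f df -> (forall x, K < `|x| -> f x = 0) ->
  forall x, K < `|x| -> df x = 0.
Proof.
move=> fT fK x Kx; apply/rowP => i; rewrite mxE.
have /(C1g_partial i fT) <- : [set: 'rV[R]_n] x by [].
rewrite /partial (near_eq_derive (g := cst 0)); first by rewrite derive_cst.
have := @open_norm_gt K; rewrite openE => /(_ x Kx); apply: filterS => y.
exact: fK.
Qed.

Lemma C1g_grad_bbs f df K i : C1g setT f df -> (forall x, K < `|x| -> f x = 0) ->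
  bbsV R n (fun x => df x 0 i).
Proof.
move=> fT fK; apply: (@continuous_bbs _ K).
  by move=> x; have [_ /coord_cvg] := fT x I; apply.
by move=> x Kx; rewrite (C1g_zero_out fT fK)// mxE.
Qed.

Lemma C1g_MVT U f df (x y : 'rV[R]_n) : open U -> C1g U f df ->
  (forall t, 0 <= t <= 1 -> U (x + t *: (y - x))) ->
  exists2 t, 0 <= t <= 1 & f y - f x = dot (y - x) (df (x + t *: (y - x))).
Proof.
move=> oU fU Hseg.
have H (t : R) : t \in `[0, 1] -> is_derive t 1 (fun s => f (x + s *: (y - x)))
    (dot (y - x) (df (x + t *: (y - x)))).
  rewrite in_itv/= => /Hseg Ut; apply: line_derive.
  exact: C1g_is_derive oU fU Ut.
have [t] := @MVT_segment R (fun s => f (x + s *: (y - x))) _ 0 1 ler01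
  (fun t ht => H t (subset_itv_oo_cc ht))
  (derivable_within_continuous (fun t ht => @ex_derive _ _ _ _ _ _ _ (H t ht))).
rewrite in_itv/= => t01; rewrite scale1r scale0r addr0 subr0 mulr1 [x + _]addrC subrK => E.
by exists t.
Qed.

(** The difference quotients with step [1 / (k + 1)] have zero integral by translation invariance.
    They converge to the partial derivative and, by the mean value theorem, are dominated by a
    constant on the cube of radius [K + |e|]. *)
Lemma Rintegral_partial f df K i : C1g setT f df ->
  (forall x, K < `|x| -> f x = 0) -> \int[mu]_x df x 0 i = 0.
Proof.
move=> fT fK.
have bf := C1g_bbs fT fK.
have [mg [M M0 gM]] := C1g_grad_bbs i fT fK.
pose e : 'rV[R]_n := delta_mx 0 i.
pose q k x := k.+1%:R * (f (x + k.+1%:R^-1 *: e) - f x).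
have shift_norm k (x : 'rV[R]_n) : `|x| - `|k.+1%:R^-1 *: e| <= `|x + k.+1%:R^-1 *: e|.
  by rewrite lerBlDr (le_trans _ (ler_normB _ _))// addrK.
have bt k : bbsV R n (fun x => f (x + k.+1%:R^-1 *: e)).
  apply: (@continuous_bbs _ (K + `|e|)).
    move=> x; apply: (@continuous_comp 'rV[R]_n 'rV[R]_n R (fun x => x + k.+1%:R^-1 *: e) f x).
      by apply: continuousD; [exact: cvg_id|exact: cst_continuous].
    exact: (C1g_continuous openT fT).
  move=> x Kx; apply: fK; rewrite -ltrBrDr in Kx; apply: lt_le_trans Kx _.
  apply: le_trans (shift_norm k x); rewrite lerB//.
  by rewrite normrZ ler_piMl// ger0_norm// invf_le1// ler1n.
have bq k : bbsV R n (q k) by apply: bbsZ; apply: bbsB.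
have q0 k : \int[mu]_x q k x = 0.
  rewrite /q RintegralZl//; last by apply: bbsV_integrable; exact: bbsB.
  rewrite RintegralB//; [|exact: bbsV_integrable..].
  have := Rintegral_affine (k.+1%:R^-1 *: e) (oner_neq0 R) bf.
  rewrite normr1 expr1n mul1r => <-.
  rewrite [X in X - _](_ : _ = \int[mu]_x f (1 *: x + k.+1%:R^-1 *: e)).
    by rewrite subrr mulr0.
  by apply: eq_Rintegral => x _; rewrite scale1r.
have /cvg_lim <- // : (fun k => \int[mu]_x q k x) @ \oo --> \int[mu]_x df x 0 i.
  apply: (@Rintegral_dominated _ _ mu q _
    (fun x => M * \1_[set x : 'rV[R]_n | `|x| <= K + `|e|] x)).
  - by move=> k; case: (bq k).
  - exact: mg.
  - move=> x; have [dx _] := fT x I; have [+ dE] := dx i.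
    rewrite -dE /derivable => dv.
    have dv' : (fun h => h^-1 *: ((f \o shift x) (h *: delta_mx 0 i) - f x)) @ 0^'
        --> 'D_(delta_mx 0 i) f x by exact: dv.
    have /cvgr_dnbhsP/(_ (fun k => k.+1%:R^-1)) := dv'.
    rewrite (_ : (fun k => k.+1%:R^-1^-1 *: _) = q ^~ x); last first.
      by apply/funext => k; rewrite /q /= invrK [_ *: _ + x]addrC.
    by apply; split => [k|]; [rewrite invr_neq0|exact: cvg_harmonic].
  - apply: bbsV_integrable; apply: bbsZ; apply: bbs_indic.
      exact: measurable_rV_cball.
    by move=> x; exact.
  - move=> k x; have [xK|Kx] := leP `|x| (K + `|e|); last first.
      rewrite /q fK; last first.
        rewrite -ltrBrDr in Kx; apply: lt_le_trans Kx _.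
        apply: le_trans (shift_norm k x); rewrite lerB//.
        by rewrite normrZ ler_piMl// ger0_norm// invf_le1// ler1n.
      rewrite fK ?subrr ?mulr0 ?normr0 ?mulr_ge0//.
      by apply: le_lt_trans Kx; rewrite lerDl.
    rewrite indicE mem_set// mulr1 /q.
    have [t _] := @C1g_MVT setT f df x (x + k.+1%:R^-1 *: e) openT fT (fun _ _ => I).
    rewrite [x + _]addrC addrK dotZl dot_deltal => ->.
    rewrite mulrA divff// mul1r; case: (gM (x + t *: (k.+1%:R^-1 *: e))) => H _.
    exact: H.
under eq_fun do rewrite q0.
exact: lim_cst.
Qed.

Lemma Rintegral_by_parts f df g dg K i : C1g setT f df -> C1g setT g dg ->
  (forall x, K < `|x| -> f x = 0) ->
  \int[mu]_x (f x * dg x 0 i) = - \int[mu]_x (df x 0 i * g x).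
Proof.
move=> fT gT fK.
have fgT := C1gM openT fT gT.
have fgK x : K < `|x| -> f x * g x = 0 by move=> /fK ->; rewrite mul0r.
have := Rintegral_partial i fgT fgK.
have cg : continuous g by move=> x; exact: (C1g_continuous openT gT).
have cf : continuous f by move=> x; exact: (C1g_continuous openT fT).
have b1 : bbsV R n (fun x => f x * dg x 0 i).
  apply: (@continuous_bbs _ K) => [x|x /fK ->]; last by rewrite mul0r.
  by apply: continuousM; [exact: cf|have [_ /coord_cvg] := gT x I; apply].
have b2 : bbsV R n (fun x => df x 0 i * g x).
  apply: (@continuous_bbs _ K) => [x|x /(C1g_zero_out fT fK) ->].
    by apply: continuousM; [have [_ /coord_cvg] := fT x I; apply|exact: cg].
  by rewrite mxE mul0r.
under eq_Rintegral do rewrite !mxE [X in _ + X]mulrC.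
rewrite RintegralD//; [|exact: bbsV_integrable..].
by move/eqP; rewrite addr_eq0 => /eqP.
Qed.

Lemma Rintegral_bbs_sum (I : Type) (r : seq I) (F : I -> 'rV[R]_n -> R) :
  (forall i, bbsV R n (F i)) ->
  \int[mu]_x (\sum_(i <- r) F i x) = \sum_(i <- r) \int[mu]_x F i x.
Proof.
move=> bF; elim: r => [|i r IH].
  rewrite big_nil; under eq_Rintegral do rewrite big_nil.
  by rewrite Rintegral_cst// mul0r.
rewrite big_cons -IH; under eq_Rintegral do rewrite big_cons.
by rewrite RintegralD//; apply: bbsV_integrable => //; exact: bbs_sum.
Qed.

Lemma bbs_RintegralD f g : bbsV R n f -> bbsV R n g ->
  \int[mu]_x (f x + g x) = \int[mu]_x f x + \int[mu]_x g x.
Proof.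
move=> bf bg.
exact: (RintegralD measurableT (bbsV_integrable bf) (bbsV_integrable bg)).
Qed.

Lemma bbs_RintegralB f g : bbsV R n f -> bbsV R n g ->
  \int[mu]_x (f x - g x) = \int[mu]_x f x - \int[mu]_x g x.
Proof.
move=> bf bg.
exact: (RintegralB measurableT (bbsV_integrable bf) (bbsV_integrable bg)).
Qed.

Lemma bbs_RintegralZ (c : R) f : bbsV R n f ->
  \int[mu]_x (c * f x) = c * \int[mu]_x f x.
Proof. by move=> bf; exact: (RintegralZl c measurableT (bbsV_integrable bf)). Qed.

Lemma bbs_le_Rintegral f g : bbsV R n f -> bbsV R n g ->
  (forall x, f x <= g x) -> \int[mu]_x f x <= \int[mu]_x g x.
Proof.
move=> bf bg fg.
exact: (le_Rintegral measurableT (bbsV_integrable bf) (bbsV_integrable bg) (fun x _ => fg x)).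
Qed.

(** No bound and no support condition: upper bounds for the perimeter are obtained from fields, such
    as multiples of the identity, that are not test fields. *)
Definition C1_field (T : 'rV[R]_n -> 'rV[R]_n) :=
  forall i, C1_on setT (fun x => T x 0 i).

Lemma C1_field_continuous T : C1_field T -> continuous T.
Proof.
move=> cT x; apply: continuous_rV => i.
exact: (C1g_continuous openT (C1_on_C1g (cT i))).
Qed.

Lemma continuous_div T : C1_field T -> continuous (div T).
Proof.
move=> cT; rewrite /div => x.
have -> : (fun x => \sum_i partial i (fun y => T y 0 i) x)
   = \sum_i (partial i (fun y => T y 0 i)).
  by apply/funext => y; rewrite fct_sumE.
elim/big_ind : _ => [|f g cf cg|i _].
- exact: (@cst_continuous _ _ (0 : R)).
- exact: continuousD.
- by have [_] := cT i i x I.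
Qed.

Lemma Rintegral_div f df K T : C1g setT f df -> C1_field T ->
  (forall x, K < `|x| -> f x = 0) ->
  \int[mu]_x (f x * div T x) = - \int[mu]_x dot (df x) (T x).
Proof.
move=> fT cT fK.
have cf : continuous f by move=> x; exact: (C1g_continuous openT fT).
have b1 i : bbsV R n (fun x => f x * partial i (fun y => T y 0 i) x).
  apply: (@continuous_bbs _ K) => [x|x /fK ->]; last by rewrite mul0r.
  by apply: continuousM; [exact: cf|have [_] := cT i i x I].
have b2 i : bbsV R n (fun x => df x 0 i * T x 0 i).
  apply: (@continuous_bbs _ K) => [x|x /(C1g_zero_out fT fK) ->].
    apply: continuousM; first by have [_ /coord_cvg] := fT x I; apply.
    by apply: coord_cvg; exact: C1_field_continuous.
  by rewrite mxE mul0r.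
under eq_Rintegral do rewrite /div mulr_sumr.
under [in RHS]eq_Rintegral do rewrite dotE.
rewrite !Rintegral_bbs_sum// -sumrN; apply: eq_bigr => i _.
rewrite -(Rintegral_by_parts _ fT (C1_on_C1g (cT i)) fK).
by apply: eq_Rintegral => x _; rewrite mxE.
Qed.

End integration_by_parts.

(** * The Prekopa-Leindler inequality *)

Section layer_cake.
Context {R : realType}.
Notation leb := (@lebesgue_measure R).
Local Open Scope ereal_scope.

(** The condition [0 <= t] empties the set for negative heights, so that the layer-cake integral may
    run over the whole line. *)
Definition superlevel (f : R -> R) (t : R) : set R :=
  [set x | (0 <= t) /\ (t < f x)]%R.

Let hypograph (f : R -> R) : set (measurableTypeR R * measurableTypeR R) :=
  [set z | (0 <= z.2) /\ (z.2 < f z.1)]%R.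

Let measurable_hypograph f :
  measurable_fun [set: measurableTypeR R] (f : _ -> measurableTypeR R) ->
  measurable (hypograph f).
Proof.
move=> mf.
have -> : hypograph f = [set z | (0 <= z.2)%R] `&` [set z | (0 < f z.1 - z.2)%R].
  by apply/seteqP; split => z /=; rewrite subr_gt0.
have m2 : measurable_fun [set: measurableTypeR R * measurableTypeR R]
    ((fun z => z.2) : _ -> measurableTypeR R) by exact: measurable_snd.
have m1 : measurable_fun [set: measurableTypeR R * measurableTypeR R]
    ((fun z => f z.1) : _ -> measurableTypeR R).
  by apply: measurableT_comp => //; exact: measurable_fst.
apply: measurableI.
  have := m2 measurableT `[0%R, +oo[%classic (measurable_itv _).
  rewrite setTI; congr measurable.
  by apply/seteqP; split => z /=; rewrite in_itv/= andbT.
have := measurable_funB m1 m2 measurableT (measurable_itv `]0%R, +oo[).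
rewrite setTI; congr measurable.
by apply/seteqP; split => z /=; rewrite in_itv/= andbT.
Qed.

Lemma measurable_superlevel f t :
  measurable_fun [set: measurableTypeR R] (f : _ -> measurableTypeR R) ->
  measurable (superlevel f t).
Proof.
move=> mf; have [t0|t0] := leP 0%R t; last first.
  rewrite (_ : superlevel f t = set0)//.
  by apply/seteqP; split => // x [/=]; rewrite leNgt t0.
have := mf measurableT _ (measurable_itv `]t, +oo[).
rewrite setTI; congr measurable.
by apply/seteqP; split => z /=; rewrite in_itv/= andbT; [|case].
Qed.

(** Tonelli applied to the indicator of the hypograph, whose sections are [[0, f x[] in one
    direction and the superlevel sets in the other. *)
Lemma layer_cake (f : R -> R) :
  measurable_fun [set: measurableTypeR R] (f : _ -> measurableTypeR R) ->
  (forall x, 0 <= f x)%R ->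
  measurable_fun [set: measurableTypeR R] (fun t => leb (superlevel f t)) /\
  \int[leb]_x (f x)%:E = \int[leb]_t leb (superlevel f t).
Proof.
move=> mf f0.
have mH := measurable_hypograph mf.
have mI : measurable_fun setT (fun z => (\1_(hypograph f) z)%:E : \bar R).
  exact/measurable_EFinP.
have I0 z : 0 <= (\1_(hypograph f) z)%:E :> \bar R by rewrite lee_fin.
have E2 t : \int[leb]_x (\1_(hypograph f) (x, t))%:E = leb (superlevel f t).
  rewrite -[in RHS](setIT (superlevel f t)) -integral_indic//; last first.
    exact: measurable_superlevel.
have E1 x : \int[leb]_t (\1_(hypograph f) (x, t))%:E = (f x)%:E.
  transitivity (\int[leb]_t (\1_(`[0%R, f x[%classic) t)%:E).
    apply: eq_integral => t _; rewrite !indicE; congr ((nat_of_bool _)%:R%:E).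
    apply: (sameP idP); apply: (iffP idP); rewrite !inE/= in_itv/=.
      by move=> /andP.
    by move=> [? ?]; apply/andP.
  rewrite integral_indic//= setIT lebesgue_measure_itv/= lte_fin.
  case: ltP => // fx0; first by rewrite sube0.
  by congr EFin; apply/eqP; rewrite eq_le f0.
have := fubini_tonelli (m1 := leb) (m2 := leb) _ mI I0.
under eq_integral do rewrite E1.
under [in RHS]eq_integral do rewrite E2.
move=> ->; split => //.
have := measurable_fun_fubini_tonelli_G (m1 := leb) _ mI I0.
by rewrite /fubini_G; under eq_fun do rewrite E2.
Qed.

End layer_cake.

(** * Brunn-Minkowski on the line *)

Section brunn_minkowski1.
Context {R : realType}.
Notation leb := (@lebesgue_measure R).
Local Open Scope ereal_scope.

Let lebD (b : R) (A : set R) : measurable A -> leb [set (x + b)%R | x in A] = leb A.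
Proof.
move=> mA; have := lebesgue_measure_affine (- b) (oner_neq0 R) mA.
rewrite normr1 mul1e => <-; congr (leb _).
apply/seteqP; split => x /=.
  by move=> [y Ay <-]; rewrite mul1r addrK.
by rewrite mul1r => Ax; exists (x - b)%R => //; rewrite subrK.
Qed.

Let measurable_shift1 (b : R) (A : set R) : measurable A ->
  measurable [set (x + b)%R | x in A].
Proof.
move=> mA; have := measurable_affine1 1 (- b) measurableT mA.
rewrite setTI; congr measurable.
apply/seteqP; split => x /=; last first.
  by move=> [y Ay <-]; rewrite mul1r addrK.
by rewrite mul1r => Ax; exists (x - b)%R => //; rewrite subrK.
Qed.

(** With [a] in [A] almost maximal and [b] in [B] almost minimal, [C] contains both [A + b] and
    [a + B]. The first lies below [sup A + b] and the second above [a + inf B], so they overlap only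
    in an interval [I] of length at most [e]. *)
Lemma brunn_minkowski1 (A B C : set R) :
  measurable A -> measurable B -> measurable C ->
  A !=set0 -> B !=set0 -> has_ubound A -> has_lbound B ->
  (forall a b, A a -> B b -> C (a + b)%R) -> leb A + leb B <= leb C.
Proof.
move=> mA mB mC A0 B0 uA lB ABC; apply/lee_addgt0Pr => e e0.
have [a Aa ae] : exists2 a, A a & (sup A - e / 2 < a)%R.
  by apply: sup_adherent; [rewrite divr_gt0|split].
have [b Bb be] : exists2 b, B b & (b < inf B + e / 2)%R.
  by apply: inf_adherent; [rewrite divr_gt0|split].
pose I := `[(a + inf B)%R, (sup A + b)%R]%classic.
pose X := [set (x + b)%R | x in A]; pose Y := [set (x + a)%R | x in B].
have mX : measurable X by exact: measurable_shift1.
have mY : measurable Y by exact: measurable_shift1.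
have mI : measurable I by exact: measurable_itv.
have XYC : X `|` (Y `\` I) `<=` C.
  move=> _ [[x Ax <-]|[[y By <-] _]]; first exact: ABC.
  by rewrite addrC; exact: ABC.
have dXY : X `&` (Y `\` I) = set0.
  apply/seteqP; split => // _ [[x Ax <-] [[y By xy] +]]; apply.
  rewrite /I/= in_itv/= -{1}xy addrC lerD2r lerD2r.
  apply/andP; split; last exact: ub_le_sup.
  by apply: ge_inf.
have IE : leb I <= e%:E.
  rewrite lebesgue_measure_itv/= lte_fin; case: ifP => _.
    by rewrite -EFinB lee_fin; lra.
  by rewrite lee_fin ltW.
have -> : leb A = leb X by rewrite lebD.
have -> : leb B = leb Y by rewrite lebD.
have YE : leb Y <= leb (Y `\` I) + e%:E.
  rewrite (le_trans _ (leeD2l _ IE))//.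
  rewrite (le_trans _ (measureU2 _ _ _))//; last exact: measurableD.
    apply: le_measure; rewrite ?inE//.
      by apply: measurableU => //; exact: measurableD.
    by move=> y Yy; have [Iy|Iy] := pselect (I y); [right|left].
rewrite (le_trans (leeD2l _ YE))// addeA leeD2r//.
rewrite -measureU//; last exact: measurableD.
apply: le_measure; rewrite ?inE//.
by apply: measurableU => //; exact: measurableD.
Qed.

End brunn_minkowski1.

(** * Prekopa-Leindler by induction on the dimension *)

Section prekopa_leindler.
Context {R : realType}.
Notation leb := (@lebesgue_measure R).

(** Young's inequality with the conjugate exponents [1 / (1 - s)] and [1 / s]. *)
Lemma weighted_AM_GM (s a b : R) : 0 < s < 1 -> 0 <= a -> 0 <= b ->
  a `^ (1 - s) * b `^ s <= (1 - s) * a + s * b.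
Proof.
move=> /andP[s0 s1] a0 b0.
have s1' : 0 < 1 - s by rewrite subr_gt0.
have := @conjugate_powR R (a `^ (1 - s)) (b `^ s) (1 - s)^-1 s^-1
  (powR_ge0 _ _) (powR_ge0 _ _).
rewrite !invr_gt0 !invrK -!powRrM !divff ?gt_eqF// !powRr1// => H.
by rewrite ![_ * a]mulrC ![_ * b]mulrC; apply: H => //; rewrite subrK.
Qed.

Lemma powR_inv (a r : R) : 0 < a -> a^-1 `^ r = (a `^ r)^-1.
Proof.
move=> a0; have ar0 : a `^ r != 0 by rewrite gt_eqF// powR_gt0.
apply: (mulIf ar0); rewrite mulVf// -powRM ?invr_ge0 ?(ltW a0)//.
by rewrite mulVf ?gt_eqF// powR1.
Qed.

Let measurableZ1 (c : R) (A : set R) : c != 0 -> measurable A ->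
  measurable [set c * x | x in A].
Proof.
move=> c0 mA; have := measurable_affine1 c^-1 0 measurableT mA.
rewrite setTI; congr measurable.
apply/seteqP; split => x /=; last first.
  by move=> [y Ay <-]; rewrite addr0 mulrA mulVf// mul1r.
by rewrite addr0 => Ax; exists (c^-1 * x) => //; rewrite mulrA divff// mul1r.
Qed.

Let lebZ1 (c : R) (A : set R) : 0 < c -> measurable A ->
  (leb [set (c * x)%R | x in A] = c%:E * leb A)%E.
Proof.
move=> c0 mA; have cn0 : c != 0 by rewrite gt_eqF.
have := lebesgue_measure_affine 0 cn0 (measurableZ1 cn0 mA).
rewrite gtr0_norm// => <-; congr (_ * leb _)%E.
apply/seteqP; split => x /=.
  by rewrite addr0 => -[y Ay /(mulfI cn0) <-].
by move=> Ax; rewrite addr0; exists x.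
Qed.

(* Both functions are normalised to have supremum 1, so that the superlevel
   sets at a given height are simultaneously nonempty. *)
Let prekopa_leindler1_norm (s : R) (f g h : R -> R) : 0 < s < 1 ->
  bbsR R f -> bbsR R g -> bbsR R h ->
  (forall x, 0 <= f x <= 1) -> (forall x, 0 <= g x <= 1) -> (forall x, 0 <= h x) ->
  (forall t, t < 1 -> exists x, t < f x) -> (forall t, t < 1 -> exists x, t < g x) ->
  (forall x y, f x `^ (1 - s) * g y `^ s <= h ((1 - s) * x + s * y)) ->
  (1 - s) * \int[leb]_x f x + s * \int[leb]_x g x <= \int[leb]_x h x.
Proof.
move=> s01 bf bg bh f01 g01 h0 f1 g1 fgh.
have /andP[s0 s1] := s01; have s1' : 0 < 1 - s by rewrite subr_gt0.
have f0 x : 0 <= f x by case/andP: (f01 x).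
have g0 x : 0 <= g x by case/andP: (g01 x).
have [mf _] := bf; have [mg _] := bg; have [mh _] := bh.
have [mF fE] := layer_cake mf f0.
have [mG gE] := layer_cake mg g0.
have [mH hE] := layer_cake mh h0.
have finE (k : R -> R) : bbsR R k -> ((\int[leb]_x k x)%:E = \int[leb]_x (k x)%:E)%E.
  by move=> /bbsR_integrable ik; rewrite /Rintegral fineK//; exact: integrable_fin_num.
rewrite -lee_fin EFinD !EFinM !finE// fE gE hE.
rewrite -ge0_integralZl//; last by rewrite lee_fin ltW.
rewrite -ge0_integralZl//; last by rewrite lee_fin ltW.
rewrite -ge0_integralD//; last 4 first.
- by move=> t _; rewrite mule_ge0// lee_fin ltW.
- exact: measurable_funeM.
- by move=> t _; rewrite mule_ge0// lee_fin ltW.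
- exact: measurable_funeM.
apply: ge0_le_integral => //.
- by move=> t _; rewrite adde_ge0// mule_ge0// lee_fin ltW.
- by apply: emeasurable_funD; exact: measurable_funeM.
move=> t _.
have bdd (k : R -> R) : bbsR R k -> has_ubound (superlevel k t) /\ has_lbound (superlevel k t).
  move=> [_ [M M0 kM]].
  have kx x : superlevel k t x -> - M <= x <= M.
    move=> [t0 tk]; rewrite -ler_norml leNgt; apply/negP => Mx.
    by have [_ /(_ Mx) kx0] := kM x; move: tk; rewrite kx0 ltNge t0.
  by split; [exists M|exists (- M)] => x /kx/andP[].
have empty (k : R -> R) : (t < 0 \/ 1 <= t) -> (forall x, k x <= 1) -> superlevel k t = set0.
  move=> tt k1; apply/seteqP; split => // x [t0 tk].
  case: tt; first by rewrite ltNge t0.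
  by rewrite leNgt (lt_le_trans tk).
have f1' x : f x <= 1 by case/andP: (f01 x).
have g1' x : g x <= 1 by case/andP: (g01 x).
have [t0|t0] := ltP t 0.
  have -> : superlevel f t = set0 by apply: empty => //; left.
  have -> : superlevel g t = set0 by apply: empty => //; left.
  by rewrite measure0 !mule0 adde0.
have [t1|t1] := leP 1 t.
  have -> : superlevel f t = set0 by apply: empty => //; right.
  have -> : superlevel g t = set0 by apply: empty => //; right.
  by rewrite measure0 !mule0 adde0.
have mSf := measurable_superlevel t mf.
have mSg := measurable_superlevel t mg.
have mSh := measurable_superlevel t mh.
rewrite -!lebZ1//.
have [[uf lf] [ug lg]] := (bdd f bf, bdd g bg).
apply: brunn_minkowski1 => //.
- by apply: measurableZ1; rewrite ?gt_eqF.
- by apply: measurableZ1; rewrite ?gt_eqF.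
- by have [x tx] := f1 t t1; exists ((1 - s) * x); exists x.
- by have [x tx] := g1 t t1; exists (s * x); exists x.
- case: uf => M fM; exists ((1 - s) * M) => _ [x fx <-].
  by rewrite ler_pM2l//; exact: fM.
- case: lg => M gM; exists (s * M) => _ [x gx <-].
  by rewrite ler_pM2l//; exact: gM.
- move=> _ _ [x [_ tx] <-] [y [_ ty] <-]; split => //.
  apply: lt_le_trans (fgh x y).
  (* Splitting [t] into the two powers shows that heights above [t] for [f] and for [g] force a
     height above [t] for [h]. *)
  have -> : t = t `^ (1 - s) * t `^ s.
    rewrite -powRD ?subrK ?powRr1//.
    by rewrite oner_eq0.
  have H1 : t `^ (1 - s) < f x `^ (1 - s) by rewrite gt0_ltr_powR ?nnegrE.
  have H2 : t `^ s < g y `^ s by rewrite gt0_ltr_powR ?nnegrE.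
  by rewrite ltr_pM ?powR_ge0.
Qed.

(** Dividing [f], [g] by their suprema [M], [K], and [h] by [M ^ (1 - s) K ^ s], reduces to the
    normalised case. That case bounds an arithmetic mean, which the weighted AM-GM inequality turns
    into the geometric one. A vanishing supremum makes the left-hand side zero. *)
Lemma prekopa_leindler1 (s : R) (f g h : R -> R) : 0 < s < 1 ->
  bbsR R f -> bbsR R g -> bbsR R h ->
  (forall x, 0 <= f x) -> (forall x, 0 <= g x) -> (forall x, 0 <= h x) ->
  (forall x y, f x `^ (1 - s) * g y `^ s <= h ((1 - s) * x + s * y)) ->
  (\int[leb]_x f x) `^ (1 - s) * (\int[leb]_x g x) `^ s <= \int[leb]_x h x.
Proof.
move=> s01 bf bg bh f0 g0 h0 fgh.
have /andP[s0 s1] := s01; have s1' : 0 < 1 - s by rewrite subr_gt0.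
have ih0 : 0 <= \int[leb]_x h x by exact: Rintegral_ge0.
have sup_prop (k : R -> R) : bbsR R k -> (forall x, 0 <= k x) ->
    (\int[leb]_x k x = 0) \/ exists2 M : R, 0 < M & (forall x, k x <= M) /\
      (forall t, t < M -> exists x, t < k x).
  move=> [mk [K K0 kK]] k0.
  have hs : has_sup (range k).
    split; first by exists (k 0); exists 0.
    by exists K => _ [x _ <-]; rewrite (le_trans (ler_norm _))//; case: (kK x).
  have [M0|M0] := leP (sup (range k)) 0; [left|right].
    rewrite (_ : \int[leb]_x k x = \int[leb]_x (0 : R)).
      by rewrite Rintegral_cst// mul0r.
    apply: eq_Rintegral => x _; apply/eqP; rewrite eq_le k0 andbT.
    by apply: le_trans M0; apply: ub_le_sup; [case: hs|exists x].
  exists (sup (range k)) => //; split.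
    by move=> x; apply: ub_le_sup; [case: hs|exists x].
  move=> t tM; have [_ [x _ <-] tx] := sup_gt hs.1 tM.
  by exists x.
have [->|[M M0 [fM Mf]]] := sup_prop f bf f0.
  by rewrite powR0 ?gt_eqF// mul0r.
have [->|[K K0 [gK Kg]]] := sup_prop g bg g0.
  by rewrite powR0 ?gt_eqF// mulr0.
pose L := M `^ (1 - s) * K `^ s.
have L0 : 0 < L by rewrite mulr_gt0 ?powR_gt0.
have Mi : 0 <= M^-1 by rewrite invr_ge0 ltW.
have Ki : 0 <= K^-1 by rewrite invr_ge0 ltW.
have H := @prekopa_leindler1_norm s (fun x => M^-1 * f x) (fun x => K^-1 * g x)
  (fun x => L^-1 * h x) s01 (bbsZ M^-1 bf) (bbsZ K^-1 bg) (bbsZ L^-1 bh).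
have {H} : (1 - s) * (M^-1 * \int[leb]_x f x) + s * (K^-1 * \int[leb]_x g x)
    <= L^-1 * \int[leb]_x h x.
  rewrite -(RintegralZl M^-1 measurableT (bbsR_integrable bf)).
  rewrite -(RintegralZl K^-1 measurableT (bbsR_integrable bg)).
  rewrite -(RintegralZl L^-1 measurableT (bbsR_integrable bh)).
  apply: H => //.
  - by move=> x; rewrite ler_pdivrMl// mulr1 fM andbT mulr_ge0// invr_ge0 ltW.
  - by move=> x; rewrite ler_pdivrMl// mulr1 gK andbT mulr_ge0// invr_ge0 ltW.
  - by move=> x; rewrite mulr_ge0// invr_ge0 ltW.
  - move=> t t1; have [|x tx] := Mf (t * M); first by rewrite gtr_pMl.
    by exists x; rewrite mulrC ltr_pdivlMr.
  - move=> t t1; have [|x tx] := Kg (t * K); first by rewrite gtr_pMl.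
    by exists x; rewrite mulrC ltr_pdivlMr.
  - move=> x y; rewrite (powRM _ Mi (f0 x)) (powRM _ Ki (g0 y)) mulrACA.
    have -> : M^-1 `^ (1 - s) * K^-1 `^ s = L^-1.
      by rewrite /L invfM !powR_inv.
    by rewrite ler_pM2l ?invr_gt0.
have if0 : 0 <= \int[leb]_x f x by exact: Rintegral_ge0.
have ig0 : 0 <= \int[leb]_x g x by exact: Rintegral_ge0.
have := @weighted_AM_GM s (M^-1 * \int[leb]_x f x) (K^-1 * \int[leb]_x g x) s01.
move=> /(_ _ _)/le_trans H /H.
rewrite (mulr_ge0 Mi if0) (mulr_ge0 Ki ig0) => /(_ isT isT).
rewrite (powRM _ Mi if0) (powRM _ Ki ig0) mulrACA.
have -> : M^-1 `^ (1 - s) * K^-1 `^ s = L^-1.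
  by rewrite /L invfM !powR_inv.
by rewrite ler_pM2l ?invr_gt0.
Qed.

(** The slices at [x], [x'] and [(1 - s) x + s x'] satisfy the hypothesis one dimension lower, so
    the induction hypothesis is exactly the one-dimensional hypothesis for the marginals. In
    dimension 0 integration is evaluation at the only point. *)
Theorem prekopa_leindler n (s : R) (f g h : 'rV[R]_n -> R) : 0 < s < 1 ->
  bbsV R n f -> bbsV R n g -> bbsV R n h ->
  (forall x, 0 <= f x) -> (forall x, 0 <= g x) -> (forall x, 0 <= h x) ->
  (forall x y, f x `^ (1 - s) * g y `^ s <= h ((1 - s) *: x + s *: y)) ->
  (\int[borel_lebesgue R n]_x f x) `^ (1 - s) * (\int[borel_lebesgue R n]_x g x) `^ s
    <= \int[borel_lebesgue R n]_x h x.
Proof.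
move=> s01; elim: n => [|n IH] in f g h * => bf bg bh f0 g0 h0 fgh.
  have E (k : 'rV[R]_0 -> R) : bbsV R 0 k -> \int[borel_lebesgue R 0]_x k x = k 0.
    move=> [mk _]; rewrite /Rintegral /= integral_dirac//; last exact/measurable_EFinP.
    by rewrite diracT mul1e.
  rewrite !E//; have := fgh 0 0; rewrite !scaler0 addr0; exact.
rewrite !Rintegral_rV_cons//.
apply: prekopa_leindler1 => //; try exact: bbs_marginal.
- by move=> x; exact: Rintegral_ge0.
- by move=> x; exact: Rintegral_ge0.
- by move=> x; exact: Rintegral_ge0.
move=> x x'; apply: IH => //; try exact: bbs_section.
move=> y y'; apply: le_trans (fgh _ _) _.
rewrite (_ : _ + _ = rV_cons ((1 - s) * x + s * x', (1 - s) *: y + s *: y'))//.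
rewrite rV_cons_affine; congr (rV_cons (_ + _, _ + _)).
  by rewrite mxE rV_cons0.
by apply/rowP => i; rewrite /= 2!mxE rV_consS mxE.
Qed.

End prekopa_leindler.

(** * Perimeter and the isoperimetric inequality *)

Section perimeter_borel.
Context {R : realType} {n : nat}.
Notation mu := (borel_lebesgue R n).
Implicit Types (E : set 'rV[R]_n) (T : 'rV[R]_n -> 'rV[R]_n).

Lemma bbs_indic_div E T : measurable E -> C1_field T ->
  (exists K, forall x, K < `|x| -> \1_E x * div T x = 0) ->
  bbsV R n (fun x => \1_E x * div T x).
Proof.
move=> mE cT [K TK].
have mT : measurable_fun [set: 'rV[R]_n] (div T : _ -> measurableTypeR R).
  by apply: continuous_measurable_rV; exact: continuous_div.
have [M M0 divM] : exists2 M, 0 <= M & forall x, `|x| <= K -> `|div T x| <= M.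
  have cB : compact [set x : 'rV[R]_n | `|x| <= K].
    apply: bounded_closed_compact.
      exists K; split; first exact: num_real.
      by move=> M KM x /= xK; rewrite (le_trans xK)// ltW.
    have -> : [set x : 'rV[R]_n | `|x| <= K] = (fun x => `|x|) @^-1` [set t | t <= K].
      by [].
    by apply: closed_comp => [x _|]; [exact: norm_continuous|exact: closed_le].
  have [M [Mr HM]] : bounded_set (div T @` [set x : 'rV[R]_n | `|x| <= K]).
    apply: compact_bounded; apply: continuous_compact => //.
    by apply: continuous_subspaceT; exact: continuous_div.
  exists (Num.max 0 (M + 1)); first by rewrite le_max lexx.
  move=> x xK; rewrite le_max; apply/orP; right.
  by apply: (HM (M + 1)); [rewrite ltrDl|exists x].
apply: (@bbsP _ _ _ _ _ M K) => //.
  by apply: measurable_funM => //; exact: measurable_indic.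
move=> x; have [xK|Kx] := leP `|x| K; last by rewrite TK// normr0.
rewrite normrM; apply: le_trans (divM x xK); rewrite ler_piMl//.
by rewrite indicE; case: (_ \in _); rewrite ?normr1 ?normr0.
Qed.

Lemma integral_div_indic E T : measurable E -> C1_field T ->
  (exists K, forall x, K < `|x| -> \1_E x * div T x = 0) ->
  (\int[@lebesgue R n]_(x in E) (div T x)%:E)%E =
  (\int[mu]_x (\1_E x * div T x))%:E.
Proof.
move=> mE cT TK; have bT := bbs_indic_div mE cT TK.
have fin := integrable_fin_num measurableT (bbsV_integrable bT).
rewrite integral_mkcond /Rintegral fineK//.
rewrite -integral_lebesgueE; last by apply/measurable_EFinP; case: bT.
apply: eq_integral => x _.
rewrite patchE indicE; case: (x \in E); first by rewrite mul1r.
by rewrite mul0r.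
Qed.

Lemma supp_zero (V : zmodType) (g : 'rV[R]_n -> V) x : ~ supp g x ->
  \forall y \near x, g y = 0.
Proof.
move=> nx; have : open (~` supp g) by apply: closed_openC; exact: closed_closure.
rewrite openE => /(_ x nx); apply: filterS => y ny.
by apply/eqP; apply: contra_notT ny => gy; exact: subset_closure.
Qed.

Lemma compact_supp_bound (V : zmodType) (g : 'rV[R]_n -> V) : compact (supp g) ->
  exists K, forall x, K < `|x| -> g x = 0.
Proof.
move=> /compact_bounded[M [_ HM]]; exists (M + 1) => x Mx.
apply/eqP; apply: contraTT Mx => gx; rewrite -leNgt.
by apply: (HM (M + 1)); [rewrite ltrDl|exact: subset_closure].
Qed.

Lemma bound_compact_supp (V : zmodType) (g : 'rV[R]_n -> V) K :
  (forall x, K < `|x| -> g x = 0) -> compact (supp g).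
Proof.
move=> gK; apply: bounded_closed_compact; last exact: closed_closure.
exists K; split; first exact: num_real.
move=> M KM x sx /=; rewrite leNgt; apply/negP => Mx.
have [y [/eqP gy]] : [set x | g x != 0] `&` [set y | K < `|y|] !=set0.
  apply: sx; have := @open_norm_gt R n K; rewrite openE => /(_ x); apply.
  exact: lt_trans Mx.
by move=> /gK.
Qed.

Lemma test_field_C1 T : test_field T -> C1_field T.
Proof. by case. Qed.

Lemma test_field_div0 T : test_field T -> exists K, forall x, K < `|x| -> div T x = 0.
Proof.
move=> [cT /compact_supp_bound[K TK] _]; exists K => x Kx.
rewrite /div big1// => i _.
have T0 : forall x, K < `|x| -> T x 0 i = 0 by move=> y /TK ->; rewrite mxE.
have := C1g_zero_out (C1_on_C1g (cT i)) T0 Kx => /rowP/(_ i).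
by rewrite !mxE.
Qed.

Lemma perimeter_ge E T : measurable E -> test_field T ->
  ((\int[mu]_x (\1_E x * div T x))%:E <= perimeter E)%E.
Proof.
move=> mE tT; apply: ereal_sup_ubound; exists T => //.
apply: integral_div_indic => //; first exact: test_field_C1.
by have [K TK] := test_field_div0 tT; exists K => x /TK ->; rewrite mulr0.
Qed.

Lemma perimeter_le E (c : R) : measurable E ->
  (forall T, test_field T -> \int[mu]_x (\1_E x * div T x) <= c) ->
  (perimeter E <= c%:E)%E.
Proof.
move=> mE H; apply: ge_ereal_sup => _ [T tT <-].
rewrite integral_div_indic ?lee_fin//; [exact: H|exact: test_field_C1|].
by have [K TK] := test_field_div0 tT; exists K => x /TK ->; rewrite mulr0.
Qed.

(** The pointwise convergence does not involve [k]; it is repeated for every index and read off at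
    index 0. *)
Definition C1_approx E (f_ : nat -> 'rV[R]_n -> R) (df_ : nat -> 'rV[R]_n -> 'rV[R]_n)
    (K : R) := forall k,
  [/\ C1g setT (f_ k) (df_ k), forall x, 0 <= f_ k x <= \1_E x,
      forall x, K < `|x| -> f_ k x = 0 & forall x, f_ ^~ x @ \oo --> (\1_E x : R)].

Variables (E : set 'rV[R]_n) (f_ : nat -> 'rV[R]_n -> R).
Variables (df_ : nat -> 'rV[R]_n -> 'rV[R]_n) (K : R).
Hypothesis mE : measurable E.
Hypothesis EK : forall x, E x -> `|x| <= K.
Hypothesis fE : C1_approx E f_ df_ K.

Let f01 k x : 0 <= f_ k x <= 1.
Proof.
by have [_ /(_ x)/andP[-> H] _ _] := fE k; rewrite (le_trans H).
Qed.

Let bf k : bbsV R n (f_ k).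
Proof. by have [c _ fK _] := fE k; exact: C1g_bbs c fK. Qed.

Lemma bbs_field_dot df T : (exists2 f, C1g setT f df & forall x, K < `|x| -> f x = 0) ->
  C1_field T -> bbsV R n (fun x => dot (df x) (T x)).
Proof.
move=> [f fT fK] cT; rewrite (_ : (fun x => dot (df x) (T x)) = fun x => \sum_i df x 0 i * T x 0 i).
  apply: bbs_sum => i; apply: (@continuous_bbs _ _ _ K) => [x|x Kx].
    apply: continuousM; first by have [_ /coord_cvg] := fT x I; apply.
    by apply: coord_cvg; exact: C1_field_continuous.
  by rewrite (C1g_zero_out fT fK)// mxE mul0r.
by apply/funext => x; rewrite dotE.
Qed.

Lemma cvg_approx_div T : C1_field T ->
  (fun k => \int[mu]_x (f_ k x * div T x)) @ \oo --> \int[mu]_x (\1_E x * div T x).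
Proof.
move=> cT.
have mT : measurable_fun [set: 'rV[R]_n] (div T : _ -> measurableTypeR R).
  by apply: continuous_measurable_rV; exact: continuous_div.
have mI : measurable_fun [set: 'rV[R]_n] (\1_E : _ -> measurableTypeR R).
  exact: measurable_indic.
apply: (@Rintegral_dominated R _ _ mu (fun k x => f_ k x * div T x) _ (fun x => `|\1_E x * div T x|)).
- by move=> k; apply: measurable_funM => //; case: (bf k).
- exact: measurable_funM.
- by move=> x; apply: cvgM; [have [_ _ _] := fE 0%N; exact|exact: cvg_cst].
- apply: bbsV_integrable; apply: bbs_norm; apply: bbs_indic_div => //.
  exists K => x Kx; rewrite indicE memNset ?mul0r// => /EK.
  by rewrite leNgt Kx.
- move=> k x; rewrite !normrM ler_wpM2r//.
  have [_ /(_ x)/andP[f0 fI] _ _] := fE k.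
  by rewrite !ger0_norm.
Qed.

(** Calibration from above. The hypothesis says that [Y] has component at least 1 along the outward
    direction [- df_]. For any test field the integral of [f_ k * div T] is at most the total
    variation of [f_ k], which is at most the integral of [f_ k * div Y]; then [k] tends to
    infinity. *)
Lemma perimeter_le_div Y : C1_field Y ->
  (forall k x, enorm (df_ k x) <= - dot (df_ k x) (Y x)) ->
  (perimeter E <= (\int[mu]_x (\1_E x * div Y x))%:E)%E.
Proof.
move=> cY HY; apply: (perimeter_le mE) => T tT; have [cT sT T1] := tT.
apply: (ler_cvg_to (cvg_approx_div cT) (cvg_approx_div cY)).
apply: nearW => k; have [fT _ fK _] := fE k.
rewrite (Rintegral_div fT cT fK) (Rintegral_div fT cY fK) lerN2.
have ex : exists2 f, C1g setT f (df_ k) & forall x, K < `|x| -> f x = 0 by exists (f_ k).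
apply: le_Rintegral => //; [exact/bbsV_integrable/bbs_field_dot|
  exact/bbsV_integrable/bbs_field_dot|].
move=> x _; rewrite -[leRHS]opprK lerNr; apply: le_trans (HY k x).
rewrite -dotNr (le_trans (cauchy_schwarz_dot _ _))// enormN.
by rewrite ler_piMr// enorm_ge0.
Qed.

(** If one fixed test field is the outward unit normal on all transition layers, it attains the
    total variation of every [f_ k], so a lower bound on these passes to the perimeter in the
    limit. *)
Lemma perimeter_ge_TV T (L : R) : test_field T ->
  (forall k x, - dot (df_ k x) (T x) = enorm (df_ k x)) ->
  (exists2 L_ : nat -> R, L_ @ \oo --> L & forall k, L_ k <= \int[mu]_x enorm (df_ k x)) ->
  (L%:E <= perimeter E)%E.
Proof.
move=> tT HT [L_ cL HL]; apply: le_trans (perimeter_ge mE tT); rewrite lee_fin.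
have cT := test_field_C1 tT.
apply: (ler_cvg_to cL (cvg_approx_div cT)).
apply: nearW => k; have [fT _ fK _] := fE k.
rewrite (Rintegral_div fT cT fK) (le_trans (HL k))//.
have ex : exists2 f, C1g setT f (df_ k) & forall x, K < `|x| -> f x = 0 by exists (f_ k).
rewrite -[leRHS]mulN1r -RintegralZl//; last by apply/bbsV_integrable/bbs_field_dot.
rewrite le_eqVlt; apply/orP; left; apply/eqP; apply: eq_Rintegral => x _.
by rewrite -HT mulN1r.
Qed.

End perimeter_borel.

(** * A functional isoperimetric inequality *)

Section total_variation.
Context {R : realType} {n : nat}.
Notation mu := (borel_lebesgue R n).

(** Only [x] is confined to the compact cube, [y] may leave it; hence the covering form of
    compactness, with the radius [d] as the parameter tending to 0 from the right. *)
Lemma uniform_continuity_vanishing (df : 'rV[R]_n -> 'rV[R]_n) (K e : R) :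
  continuous df -> 0 < e ->
  exists2 d, 0 < d & forall x y, `|x| <= K -> `|y - x| <= d -> `|df y - df x| < e.
Proof.
move=> cdf e0.
have cB : compact [set x : 'rV[R]_n | `|x| <= K].
  apply: bounded_closed_compact.
    exists K; split; first exact: num_real.
    by move=> M KM x /= xK; rewrite (le_trans xK)// ltW.
  have -> : [set x : 'rV[R]_n | `|x| <= K] = (fun x => `|x|) @^-1` [set t | t <= K].
    by [].
  by apply: closed_comp => [x _|]; [exact: norm_continuous|exact: closed_le].
move/compact_near_coveringP : cB.
move=> /(_ R (0 : R)^'+ (fun d x => forall y, `|y - x| <= d -> `|df y - df x| < e) _).
move=> /(_ _)[].
  move=> x _; have e2 : 0 < e / 2 by rewrite divr_gt0.
  have /cvgrPdist_lt/(_ _ e2)/nbhs_ballP[d /= d0 xd] := cdf x.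
  have dP z : `|z - x| < d -> `|df x - df z| < e / 2.
    by move=> zd; apply: xd; rewrite mx_norm_ball /ball_ /= distrC.
  exists (ball x (d / 2), [set t | t < d / 2]).
    split; first by apply: nbhsx_ballx; rewrite divr_gt0.
    by apply: nbhs_right_lt; rewrite divr_gt0.
  move=> [z t] /= [zx td] y yz.
  rewrite mx_norm_ball /ball_/= distrC in zx.
  have H1 : `|df x - df z| < e / 2 by apply: dP; rewrite (lt_trans zx)//; lra.
  have H2 : `|df x - df y| < e / 2.
    apply: dP; rewrite (_ : y - x = (y - z) + (z - x)); last by rewrite addrA subrK.
    rewrite (le_lt_trans (ler_normD _ _))//; lra.
  rewrite (_ : df y - df z = (df x - df z) - (df x - df y)); last first.
    by rewrite opprB [RHS]addrC addrA subrK.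
  rewrite (le_lt_trans (ler_normB _ _))//; lra.
move=> d /= d0 H; exists (d / 2); first by rewrite divr_gt0.
move=> x y xK yx; apply: (H (d / 2) _ _ x xK y yx).
  by rewrite /ball_/= sub0r normrN gtr0_norm; lra.
lra.
Qed.

Definition eball (r : R) : set 'rV[R]_n := [set x | enorm x < r].

(** Write [t ^ (1 + q)] as [t * exp (q ln t)] and use [exp y >= 1 + y] together with
    [ln t >= 1 - 1 / t]. *)
Lemma powR_lower (t q : R) : 0 <= t <= 1 -> 0 <= q -> t - q * (1 - t) <= t `^ (1 + q).
Proof.
move=> /andP[t0 t1] q0; have [->|tn] := eqVneq t 0.
  by rewrite (le_trans _ (powR_ge0 _ _))// sub0r subr0 mulr1 oppr_le0.
have tp : 0 < t by rewrite lt_neqAle eq_sym tn.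
rewrite powRD ?tn ?implybT// powRr1//.
have -> : t - q * (1 - t) = t * (1 + q * (1 - t^-1)) by field.
rewrite ler_pM2l// /powR (negbTE tn).
apply: le_trans (expR_ge1Dx _); rewrite lerD2l ler_wpM2l//.
have ti : 0 < t^-1 by rewrite invr_gt0.
have := @le_ln1Dx R (t^-1 - 1); rewrite addrCA subrr addr0 lnV ?posrE//.
by move=> H; rewrite -[ln t]opprK lerNr opprB; apply: H; lra.
Qed.

(** The Jacobian of the dilation by [1 - s], raised to the Prekopa-Leindler exponent, to first order
    in [s]. This is the origin of the dimension in the isoperimetric constant. *)
Lemma cn_lower (s : R) : 0 < s < 1 -> 1 + n%:R * s * (1 - s) <= (((1 - s) ^- n) `^ (1 - s)).
Proof.
move=> /andP[s0 s1].
have p : 0 < 1 - s by rewrite subr_gt0.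
have pn : 0 < (1 - s) ^- n by rewrite invr_gt0 exprn_gt0.
rewrite /powR gt_eqF//; apply: le_trans (expR_ge1Dx _); rewrite lerD2l.
rewrite (_ : n%:R * s * (1 - s) = (1 - s) * (n%:R * s)); last by ring.
rewrite ler_pM2l// lnV ?posrE ?exprn_gt0// lnXn// -mulNrn -[leRHS]mulr_natl.
rewrite ler_wpM2l//; have := @le_ln1Dx R (- s); rewrite lerNr; apply.
by lra.
Qed.

Lemma continuous_enorm : continuous (@enorm R 1 n).
Proof.
have -> : @enorm R 1 n = Num.sqrt \o (fun x => dot x x).
  by apply/funext => x; rewrite enormE.
move=> x; apply: continuous_comp; last exact: sqrt_continuous.
by apply: (C1g_continuous openT (C1g_dotxx openT)).
Qed.

Lemma eball_open (r : R) : open (eball r).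
Proof.
have -> : eball r = @enorm R 1 n @^-1` [set t | t < r] by [].
by apply: open_comp => [x _|]; [exact: continuous_enorm|exact: open_lt].
Qed.

Lemma measurable_eball (r : R) : measurable (eball r).
Proof. by apply: open_measurable_rV; exact: eball_open. Qed.

Lemma Rintegral_indic_rV (E : set 'rV[R]_n) : measurable E ->
  \int[mu]_x (\1_E x : R) = fine (mu E).
Proof. by move=> mE; rewrite /Rintegral integral_indic// setIT. Qed.

Lemma isoperimetric_arith1 (m V s q : R) : 0 <= q -> q <= 2 * s -> 0 <= m ->
  m <= V -> s * (4 * (V + 1)) <= m -> 0 < m -> 0 < m - q * (V - m).
Proof.
move=> q0 q2 m0 mV sm mp.
have : q * (V - m) <= 2 * s * (V + 1) by apply: ler_pM => //; lra.
lra.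
Qed.

Lemma isoperimetric_arith2 (m V q : R) : 0 <= q -> m <= V -> m - q * (V - m) <= V.
Proof.
move=> q0 mV; have : 0 <= q * (V - m) by rewrite mulr_ge0// subr_ge0.
lra.
Qed.

(** Here [N] is the dimension, [m] the integral of [f], [V] the volume and [I0] the total variation.
    The terms free of [s] cancel, those of order [s] give the claim after division by [s]; the
    remainder of order [s ^ 2] takes one half of [e] and the modulus of continuity [e1] the
    other. *)
Lemma isoperimetric_arith3 (N s m V q e1 c e I0 : R) :
  0 <= N -> 0 < s -> m <= V -> 0 <= m -> q * (1 - s) = s -> q <= 2 * s ->
  e1 * c <= e / 2 -> s * (N * m + 2 * V + N * V + 1) <= e / 2 ->
  (1 + N * s * (1 - s)) * (m - q * (V - m)) <= m + s * I0 + s * e1 * c ->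
  N * m - (V - m) <= I0 + e.
Proof.
move=> N0 s0 mV m0 qs q2 e1c sC PL.
have d0' : 0 <= V - m by lra.
have E1 : (1 + N * s * (1 - s)) * (m - q * (V - m)) =
    m - q * (V - m) + N * s * (1 - s) * m - N * s * (q * (1 - s)) * (V - m).
  by ring.
rewrite E1 qs in PL.
have qE : q = s + s * q by rewrite -[X in X + _]qs; ring.
have E2 : q * (V - m) <= s * (V - m) + 2 * s * s * (V - m).
  rewrite [X in X * _ <= _]qE mulrDl lerD2l ler_wpM2r//.
  by rewrite [2 * s]mulrC -mulrA ler_pM2l.
have NV : N * (V - m) <= N * V by rewrite ler_wpM2l//; lra.
have E3 : s * s * (N * m + 2 * (V - m) + N * (V - m)) <=
    s * (s * (N * m + 2 * V + N * V + 1)).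
  by rewrite mulrA ler_wpM2l ?mulr_ge0 ?(ltW s0)//; lra.
have E4 : s * (s * (N * m + 2 * V + N * V + 1)) <= s * (e / 2) by rewrite ler_pM2l.
have E5 : s * (e1 * c) <= s * (e / 2) by rewrite ler_pM2l.
rewrite -(ler_pM2l s0); lra.
Qed.

Lemma isoperimetric_arith4 (a b s d e : R) : a - b <= s * (d + e) ->
  a <= b + s * d + s * e.
Proof. by rewrite mulrDr lerBlDl addrA. Qed.

(** The exponents are tuned so that the left-hand side is [f w] with [w = (1 - s) x]. Since
    [|w - z| <= s] for [z = w + s y], the mean value theorem bounds [f w] by the value at [z] plus
    [s] times the gradient up to [e1]. If [|z| > K + 1] then [w] is outside the support. *)
Lemma isoperimetric_key (f : 'rV[R]_n -> R) df (K s d e1 q : R) : 0 <= K ->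
  C1g setT f df -> (forall x, 0 <= f x) -> (forall x, K < `|x| -> f x = 0) ->
  0 < s -> s <= 2^-1 -> s <= d -> (1 + q) * (1 - s) = 1 -> 0 <= e1 ->
  (forall x y, `|x| <= K + 1 -> `|y - x| <= d -> enorm (df y - df x) <= e1) ->
  forall x y, (f ((1 - s) *: x) `^ (1 + q)) `^ (1 - s) * \1_(eball 1) y `^ s <=
    f ((1 - s) *: x + s *: y) + s * enorm (df ((1 - s) *: x + s *: y)) +
    s * e1 * \1_[set x : 'rV[R]_n | `|x| <= K + 1] ((1 - s) *: x + s *: y).
Proof.
move=> K0 fT f0 fK s0 s2 sd q1 e10 Hd x y.
set w := (1 - s) *: x; set z := w + s *: y.
have h0 : 0 <= f z + s * enorm (df z) + s * e1 * \1_[set x : 'rV[R]_n | `|x| <= K + 1] z.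
  apply: addr_ge0; last first.
    by apply: mulr_ge0; [apply: mulr_ge0 => //; exact: ltW|rewrite indicE].
  by apply: addr_ge0; [exact: f0|apply: mulr_ge0; [exact: ltW|exact: enorm_ge0]].
rewrite [\1_(eball 1) y]indicE; case: (boolP (y \in eball 1)) => [|_]; last first.
  by rewrite powR0 ?mulr0// gt_eqF.
rewrite inE /eball/= => y1; rewrite powR1/= mulr1 -powRrM q1 powRr1//.
have wz : w - z = - (s *: y) by rewrite /z opprD addrA subrr add0r.
have nwz : enorm (w - z) <= s.
  by rewrite wz enormN enormZ gtr0_norm// ler_piMr ?ltW.
have nwz' : `|w - z| <= s by exact: le_trans (norm_le_enorm _) nwz.
have [zK|Kz] := leP `|z| (K + 1); last first.
  rewrite fK ?h0//.
  have H3 : `|z| <= `|w| + `|w - z|.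
    by rewrite distrC -[z in X in X <= _](subrK w) addrC ler_normD.
  lra.
have [t /andP[t0 t1]] := @C1g_MVT R n setT f df z w openT fT (fun _ _ => I).
set z' := z + t *: (w - z) => fwE.
have zz : `|z' - z| <= d.
  rewrite /z' addrC addKr normrZ ger0_norm//.
  rewrite (le_trans _ sd)// (le_trans _ nwz')// ler_piMl//.
have dfz := Hd z z' zK zz.
have dfz' : enorm (df z') <= enorm (df z) + e1.
  rewrite -[df z'](subrK (df z)) addrC (le_trans (enorm_triangle _ _))//.
  by rewrite lerD2l.
have : f w - f z <= s * (enorm (df z) + e1).
  rewrite fwE (le_trans (cauchy_schwarz_dot _ _))//.
  by apply: ler_pM => //; exact: enorm_ge0.
by rewrite indicE mem_set// mulr1 => fwz; apply: isoperimetric_arith4.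
Qed.

(* Prekopa-Leindler for the dilate of [f ^ (1 / (1 - s))] and the indicator
   function of the unit ball, to first order as [s] tends to [0]. *)
Lemma isoperimetric_TV (f : 'rV[R]_n -> R) df (E : set 'rV[R]_n) (K : R) :
  0 <= K -> C1g setT f df -> (forall x, 0 <= f x <= \1_E x) ->
  (forall x, K < `|x| -> f x = 0) -> measurable E -> (forall x, E x -> `|x| <= K) ->
  mu E = mu (eball 1) -> (0 < n)%N ->
  n%:R * \int[mu]_x f x - (fine (mu E) - \int[mu]_x f x) <= \int[mu]_x enorm (df x).
Proof.
move=> K0 fT fE fK mE EK EB n0.
have f0 x : 0 <= f x by case/andP: (fE x).
have f1 x : f x <= 1 by case/andP: (fE x) => _ /le_trans; apply.
have bf := C1g_bbs fT fK.
have bE : bbsV R n \1_E by exact: bbs_indic EK.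
have bdf : bbsV R n (fun x => enorm (df x)).
  apply: (@continuous_bbs _ _ _ K) => [x|x Kx].
    apply: (@continuous_comp _ _ _ df (@enorm R 1 n)); last exact: continuous_enorm.
    by have [_] := fT x I.
  by rewrite (C1g_zero_out fT fK)// enorm0.
set m := \int[mu]_x f x; set V := fine (mu E); set I0 := \int[mu]_x enorm (df x).
have m0 : 0 <= m by exact: Rintegral_ge0.
have mV : m <= V.
  rewrite /V -(Rintegral_indic_rV mE); apply: (bbs_le_Rintegral bf bE) => x.
  by case/andP: (fE x).
have I00 : 0 <= I0 by apply: Rintegral_ge0 => x _; exact: enorm_ge0.
have nR : 0 < (n%:R : R) by rewrite ltr0n.
have [mp|mp] := ltP 0 m; last first.
  have -> : m = 0 by apply/eqP; rewrite eq_le mp.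
  by rewrite mulr0; lra.
pose Bx := [set x : 'rV[R]_n | `|x| <= K + 1].
have mBx : measurable Bx by exact: measurable_rV_cball.
have bBx : bbsV R n \1_Bx by apply: (@bbs_indic _ _ _ _ _ (K + 1)).
set c := \int[mu]_x (\1_Bx x : R).
have c0 : 0 <= c by exact: Rintegral_ge0.
apply/ler_addgt0Pr => e e0.
pose e1 := e / (2 * (c + 1)).
have e10 : 0 < e1 by rewrite divr_gt0// mulr_gt0//; lra.
have e1c : e1 * c <= e / 2.
  rewrite /e1 mulrAC ler_pdivrMr; last by rewrite mulr_gt0//; lra.
  by rewrite (_ : e / 2 * _ = e * (c + 1)); [rewrite ler_pM2l//; lra|field].
have cdf : continuous df by move=> x; have [_] := fT x I.
have [|d d0 Hd'] := @uniform_continuity_vanishing df (K + 1) (e1 / n%:R) cdf.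
  by rewrite divr_gt0.
have Hd (x y : 'rV[R]_n) : `|x| <= K + 1 -> `|y - x| <= d -> enorm (df y - df x) <= e1.
  move=> xK yx; apply: le_trans (enorm_le_norm _) _.
  by have := Hd' x y xK yx; rewrite ltr_pdivlMr// mulrC => /ltW.
pose C := n%:R * m + 2 * V + n%:R * V + 1.
have C0 : 0 < C by rewrite /C ltr_wpDl// !addr_ge0 ?mulr_ge0//; lra.
(* The first three bounds are the hypotheses of [isoperimetric_key], the fourth absorbs the
   second-order remainder, the last keeps [m - q (V - m)] positive. *)
have [s [s0 s2 sd sC sm]] : exists s : R, [/\ 0 < s, s <= 2^-1, s <= d,
    s * C <= e / 2 & s * (4 * (V + 1)) <= m].
  exists (Num.min (Num.min 2^-1 d) (Num.min (e / 2 / C) (m / (4 * (V + 1))))).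
  split.
  - by rewrite !lt_min invr_gt0 d0 !divr_gt0//=; lra.
  - by rewrite !ge_min lexx.
  - by rewrite !ge_min lexx orbT.
  - by rewrite -ler_pdivlMr// !ge_min lexx !orbT.
  - by rewrite -ler_pdivlMr ?ge_min ?lexx ?orbT//; lra.
have s1 : s < 1 by lra.
have s1p : 0 < 1 - s by lra.
have s01 : 0 < s < 1 by rewrite s0.
pose q := s / (1 - s).
have q0 : 0 <= q by rewrite divr_ge0// ltW.
have pE : (1 - s)^-1 = 1 + q by rewrite /q; field; lra.
have qs : q * (1 - s) = s by rewrite /q; field; lra.
have q1' : (1 + q) * (1 - s) = 1 by rewrite mulrDl qs mul1r subrK.
have q2 : q <= 2 * s by rewrite /q ler_pdivrMr//; nra.
(* Since [1 + q = 1 / (1 - s)], the power [1 - s] taken by Prekopa-Leindler restores [f]. *)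
pose fp x := f x `^ (1 + q).
have q1 : 1 + q != 0 by lra.
have mfp : measurable_fun [set: 'rV[R]_n] (fp : _ -> measurableTypeR R).
  by have [mf _] := bf; exact: (measurableT_comp (measurable_powR (1 + q)) mf).
have bfp : bbsV R n fp.
  apply: (@bbsP _ _ _ _ _ 1 K) => // [x|x /fK fx0].
    have H : fp x <= 1 `^ (1 + q) by rewrite /fp ge0_ler_powR ?nnegrE ?f1//; lra.
    by rewrite powR1 in H; rewrite ger0_norm ?powR_ge0.
  by rewrite /fp fx0 powR0.
pose fs x := fp ((1 - s) *: x).
have bfs : bbsV R n fs.
  have [_ [M M0 fpM]] := bfp.
  apply: (@bbsP _ _ _ _ _ M (2 * M)).
  - apply: measurableT_comp => //.
    rewrite (_ : *:%R (1 - s) = fun x : 'rV[R]_n => (1 - s) *: x + 0).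
      exact: measurable_affine.
    by apply/funext => x; rewrite addr0.
  - by move=> x; case: (fpM ((1 - s) *: x)).
  - move=> x Mx; have [_] := fpM ((1 - s) *: x); apply.
    rewrite normrZ gtr0_norm//.
    have xp := normr_ge0 x; nra.
have fsE : \int[mu]_x fs x = \int[mu]_x fp ((1 - s) *: x + 0).
  by apply: eq_Rintegral => x _; rewrite addr0.
have sn0 : 1 - s != 0 by rewrite gt_eqF.
have ifs : (1 - s) ^+ n * \int[mu]_x fs x = \int[mu]_x fp x.
  by have := Rintegral_affine (0 : 'rV[R]_n) sn0 bfp; rewrite (gtr0_norm s1p) -fsE.
set F := \int[mu]_x fp x in ifs.
(* By [powR_lower] the power [1 + q] costs at most [q (1 - f)] on [E], and nothing outside [E],
   where [f] vanishes. *)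
pose F' := m - q * (V - m).
have F'F : F' <= F.
  have bd : bbsV R n (fun x => \1_E x - f x) by exact: bbsB.
  have bqd := bbsZ q bd.
  have -> : F' = \int[mu]_x (f x - q * (\1_E x - f x)).
    rewrite (bbs_RintegralB bf bqd) (bbs_RintegralZ q bd) (bbs_RintegralB bE bf).
    by rewrite (Rintegral_indic_rV mE).
  apply: (bbs_le_Rintegral (bbsB bf bqd) bfp) => x.
  have := fE x; rewrite indicE; case: (x \in E) => /= fx.
    exact: powR_lower.
  have -> : f x = 0 by apply/eqP; rewrite eq_le andbC.
  by rewrite subrr mulr0 subrr powR_ge0.
have F'0 : 0 < F'.
  exact: (isoperimetric_arith1 q0 q2 m0 mV sm mp).
have F'V : F' <= V by exact: (isoperimetric_arith2 q0 mV).
pose h x := f x + s * enorm (df x) + s * e1 * \1_Bx x.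
have bh : bbsV R n h := bbsD (bbsD bf (bbsZ s bdf)) (bbsZ (s * e1) bBx).
have h0 x : 0 <= h x.
  rewrite /h; apply: addr_ge0; last first.
    by apply: mulr_ge0; [apply: mulr_ge0; exact: ltW|rewrite indicE].
  by apply: addr_ge0; [exact: f0|apply: mulr_ge0; [exact: ltW|exact: enorm_ge0]].
have bB : bbsV R n \1_(eball 1).
  apply: (@bbs_indic _ _ _ _ _ 1); first exact: measurable_eball.
  by move=> x x1; exact: (le_trans (norm_le_enorm x) (ltW x1)).
have key := isoperimetric_key K0 fT f0 fK s0 s2 sd q1' (ltW e10) Hd.
have fs0 x : 0 <= fs x by exact: powR_ge0.
have iB0 x : 0 <= \1_(eball 1) x :> R by rewrite indicE.
have := prekopa_leindler s01 bfs bB bh fs0 iB0 h0 key.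
rewrite (Rintegral_indic_rV (measurable_eball 1)) -EB -/V.
have -> : \int[mu]_x h x = m + s * I0 + s * e1 * c.
  rewrite /h (bbs_RintegralD (bbsD bf (bbsZ s bdf)) (bbsZ (s * e1) bBx)).
  by rewrite (bbs_RintegralD bf (bbsZ s bdf)) (bbs_RintegralZ s bdf) (bbs_RintegralZ _ bBx).
have -> : \int[mu]_x fs x = (1 - s) ^- n * F.
  exact: (canRL (mulKf (expf_neq0 n sn0)) ifs).
have F'E : F' = m - q * (V - m) by [].
clear ifs fsE; clearbody m V I0 c F F'.
have cn := cn_lower s01.
rewrite powRM; last 2 first.
- by rewrite invr_ge0 exprn_ge0// ltW.
- exact: le_trans (ltW F'0) F'F.
(* [F'] lies below both factors, so it lies below their weighted geometric mean; this removes the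
   real powers. *)
have P1 : F' <= F `^ (1 - s) * V `^ s.
  have {1}-> : F' = F' `^ (1 - s) * F' `^ s.
    by rewrite -powRD ?subrK ?powRr1 ?(ltW F'0)// oner_eq0.
  apply: ler_pM; rewrite ?powR_ge0//; apply: ge0_ler_powR;
    rewrite ?nnegrE ?(ltW s1p) ?(ltW s0) ?(ltW F'0)//.
    exact: le_trans (ltW F'0) F'F.
  exact: le_trans (ltW F'0) F'V.
move=> PL.
have {}PL : (1 + n%:R * s * (1 - s)) * F' <= m + s * I0 + s * e1 * c.
  apply: le_trans PL; rewrite -[leRHS]mulrA.
  apply: ler_pM; [|exact: ltW|exact: cn|exact: P1].
  apply: addr_ge0 => //; apply: mulr_ge0; last exact: ltW.
  by apply: mulr_ge0 => //; exact: ltW.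
rewrite F'E in PL.
exact: (isoperimetric_arith3 (ler0n R n) s0 mV m0 qs q2 e1c sC PL).
Qed.

End total_variation.

(** * Level sets and their normal field *)

Section smooth_step.
Context {R : realType}.

Definition pos_part (t : R) : R := Num.max 0 t.

Lemma pos_part_ge0 t : 0 <= pos_part t. Proof. by rewrite le_max lexx. Qed.

Lemma pos_part_le0 t : t <= 0 -> pos_part t = 0.
Proof. by move=> t0; apply/max_idPl. Qed.

Lemma pos_part_gt0 t : 0 < t -> pos_part t = t.
Proof. by move=> t0; apply/max_idPr; exact: ltW. Qed.

Lemma continuous_pos_part : continuous pos_part.
Proof.
have -> : pos_part = (fun t => 2^-1 * (t + `|t|)).
  apply/funext => t; have [t0|t0] := leP t 0.
    by rewrite pos_part_le0// ler0_norm// subrr mulr0.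
  by rewrite pos_part_gt0// gtr0_norm//; lra.
move=> t; apply: cvgM; first exact: cvg_cst.
by apply: cvgD; [exact: cvg_id|exact: norm_continuous].
Qed.

Lemma is_derive_pos_part_sqr (t : R) :
  is_derive t 1 (fun s => pos_part s ^+ 2) (2 * pos_part t).
Proof.
have [t0|t0|->] := ltgtP t 0.
- rewrite pos_part_le0 ?(ltW t0)// mulr0.
  apply: (near_eq_is_derive (f := cst 0)) => //.
  near=> s; rewrite pos_part_le0 ?expr0n//.
  by apply: ltW; near: s; exact: lt_nbhsl.
- rewrite pos_part_gt0//.
  apply: (near_eq_is_derive (f := fun s : R => s * s)).
    near=> s; rewrite pos_part_gt0 ?expr2//.
    by near: s; exact: lt_nbhsr.
  have := @is_deriveM _ _ id id t 1 1 1 (is_derive_id _ _) (is_derive_id _ _).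
  by rewrite /= [_ *: _]mulr1 mulrDl mul1r.
- rewrite pos_part_le0// mulr0.
  have H : (fun h => h^-1 *: (((fun s => pos_part s ^+ 2) \o shift 0) (h *: 1)
      - pos_part 0 ^+ 2)) @ 0^' --> (0 : R).
    apply/cvgrPdist_le => e e0; near=> h.
    rewrite /= addr0 [h *: 1]mulr1 (@pos_part_le0 0)// expr0n/= subr0 sub0r normrN.
    have h0 : h != 0 by near: h; exact: nbhs_dnbhs_neq.
    have he : `|h| <= e by near: h; apply: dnbhs0_le.
    rewrite -[h^-1 *: _]/(h^-1 * _) normrM normfV ler_pdivrMl ?normr_gt0//.
    apply: le_trans (_ : `|h| * `|h| <= _); last by rewrite ler_wpM2l.
    rewrite normrX expr2 ger0_norm ?pos_part_ge0//.
    have ph : pos_part h <= `|h| by rewrite ge_max normr_ge0 ler_norm.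
    by apply: ler_pM => //; exact: pos_part_ge0.
  split; first by apply/cvg_ex; eexists; exact: H.
  exact: (cvg_lim _ H).
Unshelve. all: by end_near. Qed.

Let A t := pos_part t ^+ 2.
Let B t := pos_part (1 - t) ^+ 2.

Let AB t : 0 < A t + B t.
Proof.
have [t0|t0] := leP t 0.
  by rewrite ltr_wpDl ?sqr_ge0// exprn_gt0// pos_part_gt0; lra.
by rewrite ltr_pwDl ?sqr_ge0// exprn_gt0// pos_part_gt0.
Qed.

(** Squares of positive parts are [C^1] and those of [t] and [1 - t] never vanish together, so the
    quotient is a [C^1] step from 0 to 1 with a derivative in closed form. *)
Definition sstep t : R := A t / (A t + B t).

Definition dsstep t : R :=
  (2 * pos_part t * B t + A t * (2 * pos_part (1 - t))) / (A t + B t) ^+ 2.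

Lemma is_derive_sstep (t : R) : is_derive t 1 sstep (dsstep t).
Proof.
have dA := is_derive_pos_part_sqr t.
have dB : is_derive t 1 (fun s => pos_part (1 - s) ^+ 2) (- (2 * pos_part (1 - t))).
  have := @is_derive1_comp R (fun s => pos_part s ^+ 2) (fun s => 1 - s) t
     (2 * pos_part (1 - t)) (-1) (is_derive_pos_part_sqr (1 - t)).
  rewrite mulrN1; apply.
  have := is_deriveB (is_derive_cst (1 : R) t (1 : R)) (is_derive_id t (1 : R)).
  by rewrite sub0r.
have dS := is_deriveD dA dB.
have n0 : A t + B t != 0 by rewrite gt_eqF.
have dV : is_derive t 1 (fun s => (A s + B s)^-1) (- (A t + B t) ^- 2 *: (2 * pos_part t + - (2 * pos_part (1 - t)))).
  exact: (@is_deriveV R (A + B) _ _ _ n0 dS).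
apply: (is_derive_eq (is_deriveM dA dV)).
rewrite /dsstep -[X in X + _]/(A t * (- (A t + B t) ^- 2 * (2 * pos_part t + - (2 * pos_part (1 - t))))).
rewrite -[X in _ + X]/((A t + B t)^-1 * (2 * pos_part t)).
by field.
Qed.

Lemma continuous_dsstep : continuous dsstep.
Proof.
have c1 : continuous (fun t : R => pos_part (1 - t)).
  move=> t; apply: (@continuous_comp _ _ _ (fun s : R => 1 - s) pos_part).
    by apply: cvgB; [exact: cvg_cst|exact: cvg_id].
  exact: continuous_pos_part.
have cA : continuous A.
  by move=> t; apply: cvgM; exact: continuous_pos_part.
have cB : continuous B by move=> t; apply: cvgM; exact: c1.
have cAB : continuous (fun t => A t + B t).
  by move=> t; apply: cvgD; [exact: cA|exact: cB].
move=> t; apply: cvgM.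
  apply: cvgD; apply: cvgM; [|exact: cB|exact: cA|].
    by apply: cvgM; [exact: cvg_cst|exact: continuous_pos_part].
  by apply: cvgM; [exact: cvg_cst|exact: c1].
apply: cvgV; first by rewrite expf_neq0// gt_eqF.
by apply: cvgM; exact: cAB.
Qed.

Lemma sstep_C1 (t : R) : is_derive t 1 sstep (dsstep t) /\ {for t, continuous dsstep}.
Proof. by split; [exact: is_derive_sstep|exact: continuous_dsstep]. Qed.

Lemma sstep0 t : t <= 0 -> sstep t = 0.
Proof. by move=> t0; rewrite /sstep /A pos_part_le0// expr0n mul0r. Qed.

Lemma sstep1 t : 1 <= t -> sstep t = 1.
Proof.
move=> t1; rewrite /sstep; have := AB t; rewrite /B (@pos_part_le0 (1 - t)) ?expr0n/= ?addr0.
  by move=> A0; rewrite divff// gt_eqF.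
by lra.
Qed.

Lemma sstep_ge0 t : 0 <= sstep t.
Proof. by rewrite divr_ge0 ?sqr_ge0// ltW. Qed.

Lemma sstep_le1 t : sstep t <= 1.
Proof. by rewrite ler_pdivrMr// mul1r lerDl sqr_ge0. Qed.

Lemma dsstep_ge0 t : 0 <= dsstep t.
Proof.
rewrite divr_ge0 ?sqr_ge0// addr_ge0// mulr_ge0// ?sqr_ge0// mulr_ge0//;
  exact: pos_part_ge0.
Qed.

Lemma dsstep0 t : dsstep t != 0 -> 0 < t < 1.
Proof.
apply: contraNT; rewrite negb_and -!leNgt /dsstep /A /B => /orP[t0|t1].
  by rewrite (pos_part_le0 t0) expr0n/= !mulr0 !mul0r addr0 mul0r.
rewrite (@pos_part_le0 (1 - t)) ?expr0n/= ?mulr0 ?mulr0 ?addr0 ?mul0r//.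
lra.
Qed.

End smooth_step.

(** * Calculus of twice differentiable functions *)

Section C2g.
Context {R : realType} {n : nat}.
Implicit Types (f g : 'rV[R]_n -> R) (df dg : 'rV[R]_n -> 'rV[R]_n).
Implicit Types (U : set 'rV[R]_n).

(** The gradient is explicit but the second derivatives are only asserted to exist: this suffices
    where the normal field must be [C^1] and its divergence is not computed. *)
Definition C2g U f df := C1g U f df /\ forall i, exists d2, C1g U (fun x => df x 0 i) d2.

Lemma C2_on_C2g U f : C2_on U f -> C2g U f (grad f).
Proof.
move=> [fU f2]; split; first exact: C1_on_C1g.
move=> i; exists (grad (partial i f)).
rewrite (_ : (fun x => grad f x 0 i) = partial i f); first exact: C1_on_C1g.
by apply/funext => x; rewrite mxE.
Qed.

Lemma C2g_eq U f df g dg : open U -> {in U, f =1 g} -> {in U, df =1 dg} ->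
  C2g U f df -> C2g U g dg.
Proof.
move=> oU fg dfg [f1 f2]; split; first exact: C1g_eq f1.
move=> i; have [d2 Hd2] := f2 i; exists d2.
by apply: C1g_eq Hd2 => // x xU; rewrite dfg.
Qed.

Lemma C2gD U f df g dg : C2g U f df -> C2g U g dg ->
  C2g U (fun x => f x + g x) (fun x => df x + dg x).
Proof.
move=> [f1 f2] [g1 g2]; split; first exact: C1gD.
move=> i; have [d2 Hd] := f2 i; have [e2 He] := g2 i.
exists (fun x => d2 x + e2 x).
rewrite (_ : (fun x => _) = fun x => df x 0 i + dg x 0 i); first exact: C1gD.
by apply/funext => x; rewrite mxE.
Qed.

Lemma C2gM U f df g dg : open U -> C2g U f df -> C2g U g dg ->
  C2g U (fun x => f x * g x) (fun x => f x *: dg x + g x *: df x).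
Proof.
move=> oU [f1 f2] [g1 g2]; split; first exact: C1gM.
move=> i; have [d2 Hd] := f2 i; have [e2 He] := g2 i.
exists (fun x => (f x *: e2 x + dg x 0 i *: df x) + (g x *: d2 x + df x 0 i *: dg x)).
rewrite (_ : (fun x => _) = fun x => f x * dg x 0 i + g x * df x 0 i).
  exact: (C1gD (C1gM oU f1 He) (C1gM oU g1 Hd)).
by apply/funext => x; rewrite !mxE.
Qed.

Lemma C2gV U f df : open U -> (forall x, U x -> f x != 0) -> C2g U f df ->
  C2g U (fun x => (f x)^-1) (fun x => (- (f x) ^- 2) *: df x).
Proof.
move=> oU f0 fU.
have [f1 f2] := fU; split; first exact: C1gV.
move=> i; have [d2 Hd2] := f2 i.
have Vi := C1gV oU f0 f1.
have H := C1gM oU (C1gM oU Vi Vi) Hd2.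
eexists; apply: C1g_eq (C1gN oU H) => // x _ /=.
by rewrite mxE -mulNr -invfM -expr2.
Qed.

Lemma C2g_dotxx U : open U -> C2g U (fun x => dot x x) (fun x => 2 *: x).
Proof.
move=> oU; split; first exact: C1g_dotxx.
move=> i; exists (fun x => 2 *: delta_mx 0 i).
rewrite (_ : (fun x : 'rV[R]_n => (2 *: x) 0 i) = fun x => 2 * x 0 i); last first.
  by apply/funext => x; rewrite mxE.
by apply: C1gZ => //; exact: C1g_coord.
Qed.

Lemma is_derive_sqrt (t : R) : 0 < t ->
  is_derive t 1 (@Num.sqrt R) (2 * Num.sqrt t)^-1.
Proof. by move=> t0; exact: is_derive1_sqrt. Qed.

Lemma C1g_sqrt U f df : open U -> (forall x, U x -> 0 < f x) -> C1g U f df ->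
  C1g U (fun x => Num.sqrt (f x)) (fun x => (2 * Num.sqrt (f x))^-1 *: df x).
Proof.
move=> oU f0 fU.
apply: (@C1g_comp R n U f df (@Num.sqrt R) (fun t => (2 * Num.sqrt t)^-1) oU fU).
move=> x Ux; have fx := f0 x Ux; split; first exact: is_derive_sqrt.
apply: continuousV; first by rewrite mulf_neq0// gt_eqF// sqrtr_gt0.
by apply: continuousM; [exact: cst_continuous|exact: sqrt_continuous].
Qed.

Lemma C2g_sqrt U f df : open U -> (forall x, U x -> 0 < f x) -> C2g U f df ->
  C2g U (fun x => Num.sqrt (f x)) (fun x => (2 * Num.sqrt (f x))^-1 *: df x).
Proof.
move=> oU f0 [f1 f2]; split; first exact: C1g_sqrt.
move=> i; have [d2 Hd2] := f2 i.
have s0 x : U x -> 2 * Num.sqrt (f x) != 0.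
  by move=> Ux; rewrite mulf_neq0// gt_eqF// sqrtr_gt0 f0.
have Vi := C1gV oU s0 (C1gZ 2 oU (C1g_sqrt oU f0 f1)).
eexists; apply: C1g_eq (C1gM oU Vi Hd2) => // x _ /=.
by rewrite mxE.
Qed.

Lemma C1g_normal U f df i : open U -> C2g U f df -> (forall x, U x -> df x != 0) ->
  exists d, C1g U (fun x => (enorm (df x))^-1 * df x 0 i) d.
Proof.
move=> oU [f1 f2] df0.
have [d2 Hd2] := choice f2.
have Hs := C1g_sum (index_enum _) (fun j => C1gM oU (Hd2 j) (Hd2 j)).
have p x : U x -> 0 < \sum_j df x 0 j * df x 0 j by move=> Ux; rewrite -dotE dot_gt0 df0.
have Hq := C1g_sqrt oU p Hs.
have q0 x : U x -> Num.sqrt (\sum_j df x 0 j * df x 0 j) != 0.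
  by move=> Ux; rewrite gt_eqF// sqrtr_gt0 p.
eexists; apply: C1g_eq (C1gM oU (C1gV oU q0 Hq) (Hd2 i)) => // x _ /=.
by rewrite enormE dotE.
Qed.

End C2g.

(** * The truncated unit normal field *)

Section cutoff.
Context {R : realType} {n : nat}.

Definition punctured : set 'rV[R]_n := [set x | x != 0].

Lemma open_punctured : open punctured.
Proof.
have -> : punctured = @enorm R 1 n @^-1` [set t | 0 < t].
  by apply/seteqP; split => x; rewrite /punctured/= enorm_gt0.
by apply: open_comp => [x _|]; [exact: continuous_enorm|exact: open_gt].
Qed.

(** Gradients are singular at the origin and normal fields do not decay; the cutoff repairs both and
    equals 1 on the shell [1/32 <= |x|^2 <= 16], which contains all the layers where the normal is
    used. *)
Definition shell_cutoff (x : 'rV[R]_n) : R :=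
  sstep (64 * dot x x - 1) * sstep (17 - dot x x).

Lemma shell_cutoff_ge0 x : 0 <= shell_cutoff x.
Proof. by rewrite mulr_ge0// sstep_ge0. Qed.

Lemma shell_cutoff_le1 x : shell_cutoff x <= 1.
Proof. by rewrite -[leRHS]mulr1 ler_pM ?sstep_ge0 ?sstep_le1. Qed.

Lemma shell_cutoff1 x : 1 / 32 <= dot x x <= 16 -> shell_cutoff x = 1.
Proof.
move=> /andP[x1 x2]; rewrite /shell_cutoff !sstep1 ?mulr1//.
  lra.
lra.
Qed.

Lemma shell_cutoff0 x : dot x x <= 1 / 64 \/ 17 <= dot x x -> shell_cutoff x = 0.
Proof.
move=> [x1|x2]; rewrite /shell_cutoff.
  by rewrite [sstep (64 * _ - 1)]sstep0 ?mul0r//; lra.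
by rewrite [sstep (17 - _)]sstep0 ?mulr0//; lra.
Qed.

Lemma C1g_shell_cutoff : exists d, C1g setT shell_cutoff d.
Proof.
have H1 := C1gB openT (C1gZ 64 openT (C1g_dotxx (@openT 'rV[R]_n))) (@C1g_cst R n setT 1).
have H2 := C1gB openT (@C1g_cst R n setT 17) (C1g_dotxx (@openT 'rV[R]_n)).
have S1 := @C1g_comp R n _ _ _ sstep dsstep openT H1
  (fun x _ => sstep_C1 _).
have S2 := @C1g_comp R n _ _ _ sstep dsstep openT H2
  (fun x _ => sstep_C1 _).
by eexists; exact: (C1gM openT S1 S2).
Qed.

Definition normal_field (df : 'rV[R]_n -> 'rV[R]_n) x : 'rV[R]_n :=
  (shell_cutoff x * (enorm (df x))^-1) *: df x.

Lemma normal_fieldE df x : 1 / 32 <= dot x x <= 16 ->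
  normal_field df x = (enorm (df x))^-1 *: df x.
Proof. by move=> /shell_cutoff1 H; rewrite /normal_field H mul1r. Qed.

Lemma enorm_normal_field df x : enorm (normal_field df x) <= 1.
Proof.
rewrite /normal_field enormZ normrM ger0_norm ?shell_cutoff_ge0//.
rewrite ger0_norm ?invr_ge0 ?enorm_ge0// -mulrA.
have [->|d0] := eqVneq (enorm (df x)) 0; first by rewrite !mulr0.
by rewrite mulVf// mulr1 shell_cutoff_le1.
Qed.

(** Smoothness is checked on two open sets that cover the space: the complement of the origin, and a
    small ball [V] on which the cutoff vanishes. The support bound 5 works because the cutoff is
    zero from [|x|^2 = 17] on. *)
Lemma test_field_normal (f : 'rV[R]_n -> R) df : C2g punctured f df ->
  (forall x, x != 0 -> df x != 0) -> test_field (normal_field df).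
Proof.
move=> fU df0; split; last exact: enorm_normal_field.
- move=> i; have [d Hd] := C1g_normal i open_punctured fU df0.
  have [dc Hc] := C1g_shell_cutoff.
  have HU := C1gM open_punctured (C1gS (@subsetT _ punctured) Hc) Hd.
  pose V := [set x : 'rV[R]_n | dot x x < 1 / 64].
  have oV : open V.
    have -> : V = (fun x => dot x x) @^-1` [set t | t < 1 / 64] by [].
    apply: open_comp => [x _|]; last exact: open_lt.
    exact: (C1g_continuous openT (C1g_dotxx openT)).
  have HUV : C1_on punctured (fun x => normal_field df x 0 i) /\
             C1_on V (fun x => normal_field df x 0 i).
    split.
      apply: (C1gP open_punctured); apply: C1g_eq HU => [|x _|x _] //;
        [exact: open_punctured|by rewrite !mxE mulrA].
    apply: (C1gP oV); apply: C1g_eq (@C1g_cst R n V 0) => // x.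
    rewrite inE/= => xV; rewrite mxE shell_cutoff0 ?mul0r//.
    by left; exact: ltW.
  move=> j x _; have [x0|x0] := eqVneq x 0.
    by apply: HUV.2; rewrite x0 /V/= dot0r divr_gt0.
  exact: HUV.1.
- apply: (@bound_compact_supp _ _ _ _ 5) => x x5; rewrite /normal_field shell_cutoff0 ?mul0r ?scale0r//.
  right; rewrite -enorm_sqr; have := norm_le_enorm x => H.
  have H5 : 5 < enorm x by exact: lt_le_trans H.
  nra.
Qed.

End cutoff.

(** * Perimeter of sublevel sets *)

Section level_sets.
Context {R : realType} {n : nat}.
Variables (U V : set 'rV[R]_n) (G : 'rV[R]_n -> R) (dG : 'rV[R]_n -> 'rV[R]_n).
Variables (kappa c K : R).
Hypotheses (oU : open U) (oV : open V) (UV : forall x, U x \/ V x).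
Hypotheses (GU : C1g U G dG) (c0 : 0 < c) (GV : forall x, V x -> G x <= kappa - c^-1).
Local Notation E := [set x : 'rV[R]_n | G x < kappa].
Hypothesis EK : forall x, E x -> `|x| <= K.
Notation mu := (borel_lebesgue R n).

Lemma open_sublevel : open E.
Proof.
have -> : E = (U `&` E) `|` V.
  apply/seteqP; split => x.
    by move=> Ex; have [Ux|Vx] := UV x; [left|right].
  move=> [[]//|/GV Vx]; apply: le_lt_trans Vx _.
  by rewrite ltrBlDr ltrDl invr_gt0.
apply: openU => //; rewrite openE => x [Ux Ex]; apply: filterI.
  by move: oU; rewrite openE; exact.
have cG := C1g_continuous oU GU Ux.
by have /cvgr_lt := cG; exact.
Qed.

(** The step rises from 0 at [G = kappa] to 1 at depth [1 / (c (k + 1))], so every transition layer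
    lies in [kappa - 1 / c < G < kappa]. On [V], which hides the singular point of [G], the
    approximations are identically 1. *)
Let arg k x := (c * k.+1%:R) * (kappa - G x).
Let f_ k x := sstep (arg k x).
Let w k x := (c * k.+1%:R) * dsstep (arg k x).

Let wP k x : w k x != 0 -> U x /\ kappa - c^-1 < G x < kappa.
Proof.
rewrite mulf_eq0 negb_or => /andP[_ /dsstep0/andP[a0 a1]].
have ck : 0 < c * k.+1%:R by rewrite mulr_gt0.
have H : kappa - c^-1 < G x.
  rewrite ltrBlDr -ltrBlDl -(ltr_pM2l c0) divff ?gt_eqF//.
  move: a0 a1; rewrite /arg pmulr_rgt0// => a0; apply: le_lt_trans.
  by rewrite ler_pM2r// ler_peMr ?ler1n// ltW.
split; last by rewrite H /=; move: a0; rewrite /arg pmulr_rgt0// subr_gt0.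
by have [//|/GV] := UV x; rewrite leNgt H.
Qed.

Let approx : C1_approx E f_ (fun k x => - w k x *: dG x) K.
Proof.
move=> k; have ck : 0 < c * k.+1%:R by rewrite mulr_gt0.
have nE x : ~ E x -> f_ k x = 0.
  move=> /negP; rewrite -leNgt => kG; apply: sstep0.
  by rewrite /arg pmulr_rle0// subr_le0.
split.
- have HU : C1g U (f_ k) (fun x => - w k x *: dG x).
    have := @C1g_comp R n U _ _ sstep dsstep oU
      (C1gZ (c * k.+1%:R) oU (C1gB oU (@C1g_cst R n U kappa) GU))
      (fun x _ => sstep_C1 _).
    apply: C1g_eq => // x _.
    by rewrite /w /arg sub0r !scalerN scaleNr scalerA [dsstep _ * _]mulrC.
  have HV : C1g V (f_ k) (fun x => - w k x *: dG x).
    apply: C1g_eq (@C1g_cst R n V 1) => // x; rewrite inE => /GV Gx.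
      rewrite /f_ sstep1// /arg.
      have : c^-1 <= kappa - G x by lra.
      move=> H; apply: le_trans (_ : c * k.+1%:R * c^-1 <= _); last by rewrite ler_pM2l.
      by rewrite mulrAC divff ?gt_eqF// mul1r ler1n.
    have [->|/wP[_]] := eqVneq (w k x) 0; first by rewrite oppr0 scale0r.
    by rewrite ltNge Gx.
  by move=> x _; have [/HU|/HV] := UV x.
- move=> x; rewrite /f_ sstep_ge0/= indicE; case: (boolP (x \in E)) => [_|].
    exact: sstep_le1.
  by rewrite notin_setE => /nE; rewrite /f_ => ->.
- move=> x Kx; apply: nE => /EK; rewrite leNgt Kx//.
- move=> x; rewrite indicE; case: (boolP (x \in E)) => [|].
    rewrite inE/= => Gx; apply: cvg_near_cst.
    have d0 : 0 < c * (kappa - G x) by rewrite mulr_gt0// subr_gt0.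
    near=> m; apply: sstep1; rewrite /arg mulrAC -ler_pdivrMl// mulr1.
    apply: le_trans (_ : m%:R <= _); last by rewrite ler_nat.
    by near: m; exact: nbhs_infty_ger.
  rewrite notin_setE => nx; apply: cvg_near_cst; apply: nearW => m.
  apply: sstep0; rewrite /arg pmulr_rle0; last by rewrite mulr_gt0.
  by rewrite subr_le0 leNgt; apply/negP.
Unshelve. all: by end_near. Qed.

Let mE : measurable E. Proof. by apply: open_measurable_rV; exact: open_sublevel. Qed.

Lemma perimeter_sublevel_le Y : C1_field Y ->
  (forall x, U x -> kappa - c^-1 < G x < kappa -> enorm (dG x) <= dot (dG x) (Y x)) ->
  (perimeter E <= (\int[mu]_x (\1_E x * div Y x))%:E)%E.
Proof.
move=> cY HY; apply: (perimeter_le_div mE EK approx cY) => k x.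
have w0 : 0 <= w k x by rewrite mulr_ge0 ?dsstep_ge0// mulr_ge0// ltW.
rewrite dotZl mulNr opprK enormZ normrN ger0_norm//.
have [->|/wP[Ux Gx]] := eqVneq (w k x) 0; first by rewrite !mul0r.
by rewrite ler_wpM2l// HY.
Qed.

Lemma isoperimetric_sublevel T : 0 <= K -> (0 < n)%N -> test_field T ->
  (forall x, U x -> kappa - c^-1 < G x < kappa -> dot (dG x) (T x) = enorm (dG x)) ->
  mu E = mu (eball 1) ->
  ((n%:R * fine (mu E))%:E <= perimeter E)%E.
Proof.
move=> K0 n0 tT HT EB.
apply: (perimeter_ge_TV mE EK approx tT).
  move=> k x; rewrite dotZl mulNr opprK enormZ normrN ger0_norm; last first.
    by rewrite mulr_ge0 ?dsstep_ge0// mulr_ge0// ltW.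
  have [->|/wP[Ux Gx]] := eqVneq (w k x) 0; first by rewrite !mul0r.
  by rewrite HT.
(* The lower bound of [isoperimetric_TV]; both integrals converge to the volume, so its limit is [n]
   times the volume. *)
exists (fun k => n%:R * \int[mu]_x f_ k x - (fine (mu E) - \int[mu]_x f_ k x)); last first.
  move=> k; have [fT f01 fK _] := approx k.
  exact: isoperimetric_TV fT f01 fK mE EK EB n0.
have cm : (fun k => \int[mu]_x f_ k x) @ \oo --> fine (mu E).
  rewrite -(Rintegral_indic_rV mE).
  have bE : bbsV R n \1_E by exact: bbs_indic EK.
  apply: (@Rintegral_dominated R _ _ mu f_ _ \1_E).
  - by move=> k; have [fT _ fK _] := approx k; case: (C1g_bbs fT fK).
  - by case: bE.
  - by move=> x; have [_ _ _] := approx 0%N; exact.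
  - exact: bbsV_integrable.
  - by move=> k x; have [_ /(_ x)/andP[? ?] _ _] := approx k; rewrite ger0_norm.
rewrite -[X in _ --> X](_ : n%:R * fine (mu E) - (fine (mu E) - fine (mu E)) = _).
  by apply: cvgB; [apply: cvgM => //; exact: cvg_cst|apply: cvgB => //; exact: cvg_cst].
by rewrite subrr subr0.
Qed.

End level_sets.

(** * Graphs over the sphere *)

Section homogeneous.
Context {R : realType} {n : nat}.
Implicit Types (f : 'rV[R]_n -> R) (df : 'rV[R]_n -> 'rV[R]_n).

(** Euler's identity: the derivative at 0 of [s |-> f (x + s x) = (1 + s) ^ p f x] is computed in
    two ways. *)
Lemma C1g_homogeneous U f df x p : open U -> C1g U f df -> U x ->
  (forall t, 0 < t -> f (t *: x) = t ^+ p * f x) -> dot x (df x) = p%:R * f x.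
Proof.
move=> oU fU Ux fh.
have H0 : is_derive (x + (0 : R) *: x) x f (dot x (df x)).
  by rewrite scale0r addr0; exact: (C1g_is_derive x oU fU Ux).
have H1 := line_derive H0.
have H2 : is_derive (0 : R) 1 (fun s : R => f (x + s *: x)) (p%:R * f x).
  apply: (near_eq_is_derive (f := fun s : R => (1 + s) ^+ p * f x)).
    near=> s; rewrite -{2}[x]scale1r -scalerDl fh//.
    rewrite -ltrBlDl sub0r; near: s; apply: lt_nbhsr; rewrite ltrN10//.
  have Hs : is_derive (0 : R) 1 (fun s : R => 1 + s) 1.
    have := is_deriveD (is_derive_cst (1 : R) (0 : R) (1 : R)) (is_derive_id (0 : R) (1 : R)).
    by rewrite add0r.
  have Hp := @is_deriveX R R (fun s : R => 1 + s) p 0 1 1 Hs.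
  have Hm := is_deriveM Hp (is_derive_cst (f x) (0 : R) (1 : R)).
  have -> : (fun s : R => (1 + s) ^+ p * f x) = (fun s : R => 1 + s) ^+ p * cst (f x).
    by apply/funext => s; rewrite !fctE.
  apply: (is_derive_eq Hm); rewrite addr0 expr1n mulr1 scaler0 add0r.
  by rewrite [_ *: (_ *: _)]mulrC [_ *: _]mulr1.
by rewrite -(@derive_val _ _ _ _ _ _ _ H1) -(@derive_val _ _ _ _ _ _ _ H2).
Unshelve. all: by end_near. Qed.

Lemma C2g_cst U (c : R) : C2g U (fun=> c) (fun=> 0 : 'rV[R]_n).
Proof.
split; first exact: C1g_cst.
move=> i; exists (fun=> 0).
by rewrite (_ : (fun x : 'rV[R]_n => _) = fun=> 0); [exact: C1g_cst|apply/funext => x; rewrite mxE].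
Qed.

Lemma C2g_enorm : C2g punctured (@enorm R 1 n) (fun x => (enorm x)^-1 *: x).
Proof.
have H := C2g_sqrt (@open_punctured R n) _ (C2g_dotxx (@open_punctured R n)).
apply: C2g_eq (H _); [exact: open_punctured| | |] => x.
- by rewrite enormE.
- by rewrite /= -enormE scalerA invfM mulrAC mulVf ?mul1r// pnatr_eq0.
- by rewrite dot_gt0.
Qed.

End homogeneous.

(** * The gauge of a graph over the sphere *)

Section gauge.
Context {R : realType} {n : nat}.
Variable v : 'rV[R]_n -> R.
Hypothesis v2 : forall w, sphere w -> `|v w| <= 2^-1.

Lemma sphere_normalize (x : 'rV[R]_n) : x != 0 -> sphere ((enorm x)^-1 *: x).
Proof.
move=> x0; rewrite /sphere/= enormZ ger0_norm ?invr_ge0 ?enorm_ge0//.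
by rewrite mulVf// enorm_eq0.
Qed.

Lemma hextZ t x : 0 < t -> hext v (t *: x) = hext v x.
Proof.
move=> t0; rewrite /hext enormZ gtr0_norm// scalerA invfM mulrAC mulVf ?mul1r//.
by rewrite gt_eqF.
Qed.

Lemma hext_sphere w : sphere w -> hext v w = v w.
Proof. by rewrite /sphere /hext/= => ->; rewrite invr1 scale1r. Qed.

(** The Minkowski functional of the star-shaped set [ball_graph v]: it presents the graph as a
    sublevel set of a function that is homogeneous of degree one and, for [v] of class [C^2], is
    [C^2] off the origin. *)
Definition gauge x := enorm x * (1 + hext v x)^-1.

Lemma gaugeZ t x : 0 < t -> gauge (t *: x) = t * gauge x.
Proof. by move=> t0; rewrite /gauge hextZ// enormZ gtr0_norm// mulrA. Qed.

Lemma gauge0 : gauge 0 = 0. Proof. by rewrite /gauge enorm0 mul0r. Qed.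

Lemma hext_bound x : x != 0 -> `|hext v x| <= 2^-1.
Proof. by move=> /sphere_normalize /v2. Qed.

Lemma hext1_gt0 x : x != 0 -> 0 < 1 + hext v x.
Proof. by move=> /hext_bound; rewrite ler_norml => /andP[? _]; lra. Qed.

(** The factors come from [1/2 <= 1 + v <= 3/2]. *)
Lemma gauge_bound x : 2 / 3 * enorm x <= gauge x <= 2 * enorm x.
Proof.
have [->|x0] := eqVneq x 0; first by rewrite gauge0 enorm0 !mulr0 lexx.
have H := hext1_gt0 x0; have := hext_bound x0; rewrite ler_norml => /andP[h1 h2].
have e0 := enorm_ge0 x.
have i1 : 2 / 3 <= (1 + hext v x)^-1.
  by rewrite -(ler_pM2r H) mulVf ?gt_eqF//; lra.
have i2 : (1 + hext v x)^-1 <= 2.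
  by rewrite -(ler_pM2r H) mulVf ?gt_eqF//; lra.
by rewrite /gauge; move: i1 i2; set i := _^-1 => i1 i2; apply/andP; split; nra.
Qed.

Lemma gauge_gt0 x : x != 0 -> 0 < gauge x.
Proof. by move=> x0; rewrite mulr_gt0 ?enorm_gt0// invr_gt0 hext1_gt0. Qed.

Lemma ball_graphE : (0 < n)%N -> ball_graph v = [set x | gauge x < 1].
Proof.
move=> n0; apply/seteqP; split => x /=.
  move=> [w sw [t /andP[t0 t1] ->]].
  have w0 : w != 0 by rewrite -enorm_eq0 sw oner_eq0.
  have w1 : 0 < 1 + v w by rewrite -hext_sphere// hext1_gt0.
  rewrite le_eqVlt in t0; case/predU1P: t0 => [<-|t0].
    by rewrite mul0r scale0r gauge0.
  rewrite gaugeZ ?mulr_gt0// /gauge sw mul1r hext_sphere//.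
  by rewrite mulfK ?gt_eqF.
have [->|x0] := eqVneq x 0 => gx.
  (* The origin is reached with [t = 0], but some point of the sphere must be exhibited; this is
     where [0 < n] enters. *)
  pose w : 'rV[R]_n := delta_mx 0 (Ordinal n0).
  have sw : sphere w.
    by rewrite /sphere/= enormE /w dot_deltal mxE !eqxx sqrtr1.
  by exists w => //; exists 0; rewrite ?lexx ?ltr01// mul0r scale0r.
exists ((enorm x)^-1 *: x); first exact: sphere_normalize.
exists (gauge x); first by rewrite gx (ltW (gauge_gt0 x0)).
rewrite scalerA -/(hext v x) /gauge.
by rewrite divfK ?gt_eqF ?hext1_gt0// divff ?scale1r// enorm_eq0.
Qed.

Hypothesis C2v : C2_sphere v.

Lemma C2g_gauge : exists dg, C2g punctured gauge dg.
Proof.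
have H := C2gD (C2g_cst _ 1) (C2_on_C2g C2v).
have H0 x : punctured x -> 1 + hext v x != 0.
  by move=> x0; rewrite gt_eqF// hext1_gt0.
by eexists; exact: (C2gM (@open_punctured R n) C2g_enorm (C2gV (@open_punctured R n) H0 H)).
Qed.

Lemma gauge_cover (x : 'rV[R]_n) : punctured x \/ eball (1 / 4) x.
Proof.
have [->|x0] := eqVneq x 0; last by left.
by right; rewrite /eball/= enorm0 divr_gt0.
Qed.

Lemma gauge_near0 x : eball (1 / 4) x -> gauge x <= 1 - 2^-1.
Proof. by rewrite /eball/= => x4; have /andP[_ ?] := gauge_bound x; lra. Qed.

Lemma open_ball_graph : (0 < n)%N -> open (ball_graph v).
Proof.
move=> n0; rewrite ball_graphE//; have [dg [Hg _]] := C2g_gauge.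
have := (open_sublevel (@open_punctured R n) (@eball_open R n (1 / 4)) gauge_cover Hg _ gauge_near0).
by apply.
Qed.

Lemma ball_graph_bound x : (0 < n)%N -> ball_graph v x -> enorm x <= 3 / 2.
Proof.
by move=> n0; rewrite ball_graphE//= => gx; have /andP[? _] := gauge_bound x; lra.
Qed.

Lemma isoperimetric_ball_graph : (0 < n)%N ->
  borel_lebesgue R n (ball_graph v) = borel_lebesgue R n (eball 1) ->
  ((n%:R * fine (borel_lebesgue R n (ball_graph v)))%:E <= perimeter (ball_graph v))%E.
Proof.
move=> n0; have BK x : ball_graph v x -> `|x| <= 3 / 2.
  by move=> /(ball_graph_bound n0); exact/le_trans/norm_le_enorm.
move: BK; rewrite ball_graphE// => BK BE.
have [dg Hg] := C2g_gauge.
have dg0 x : x != 0 -> dg x != 0.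
  move=> x0; apply/eqP => dgx.
  have := @C1g_homogeneous R n _ _ _ x 1 (@open_punctured R n) Hg.1 x0.
  rewrite dgx dot0r mul1r => H; have := gauge_gt0 x0.
  by rewrite -H ?ltxx// => t t0; rewrite gaugeZ// expr1.
(* Level 1 with steepness 2: the layer [1/2 < gauge < 1] lies in [1/4 < |x| < 3/2], where the cutoff
   of the normal field is 1. Euler's identity has just excluded critical points. *)
apply: (@isoperimetric_sublevel R n punctured (eball (1/4)) gauge dg 1 2 (3 / 2)
   (@open_punctured R n) (@eball_open R n (1 / 4)) gauge_cover Hg.1 _ gauge_near0 BK
   (normal_field dg)) => //.
  exact: test_field_normal Hg dg0.
move=> x x0 /andP[g1 g2]; have /andP[b1 b2] := gauge_bound x.
rewrite normal_fieldE; last first.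
  by rewrite -enorm_sqr; apply/andP; split; have := enorm_ge0 x; nra.
rewrite dotZr -enorm_sqr expr2 mulrA mulVf ?mul1r// enorm_eq0; exact: dg0.
Qed.

End gauge.

(** * Translations *)

Section translation.
Context {R : realType} {n : nat}.
Notation mu := (borel_lebesgue R n).
Implicit Types (b : 'rV[R]_n) (A : set 'rV[R]_n).

Lemma translateE b A : translate b A = [set x | A (x - b)].
Proof.
apply/seteqP; split => x /=; first by move=> [y Ay <-]; rewrite addrC addKr.
by move=> Ax; exists (x - b) => //; rewrite addrCA subrr addr0.
Qed.

Lemma measurable_translate b A : measurable A -> measurable (translate b A).
Proof.
move=> mA; rewrite translateE; have := @measurable_affine R n 1 (- b) measurableT A mA.
rewrite setTI; congr (measurable _); apply/seteqP.
by split => x /=; rewrite scale1r.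
Qed.

Lemma measure_translate b A : measurable A -> mu (translate b A) = mu A.
Proof.
move=> mA; rewrite -[RHS](borel_lebesgue_affine (- b) (oner_neq0 R) mA).
rewrite normr1 expr1n mul1e translateE; congr (mu _).
by apply/seteqP; split => x /=; rewrite scale1r.
Qed.

Lemma is_derive_shift (f : 'rV[R]_n -> R) (x b w : 'rV[R]_n) d :
  is_derive (x + b) w f d -> is_derive x w (fun y => f (y + b)) d.
Proof.
have E : (fun h : R => h^-1 *: (((fun y => f (y + b)) \o shift x) (h *: w) - f (x + b))) =
         (fun h : R => h^-1 *: ((f \o shift (x + b)) (h *: w) - f (x + b))).
  by apply/funext => h; rewrite /= addrA.
by move=> [f1 f2]; split; rewrite /derivable /derive E.
Qed.

Lemma C1g_shift (f : 'rV[R]_n -> R) df b : C1g setT f df ->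
  C1g setT (fun x => f (x + b)) (fun x => df (x + b)).
Proof.
move=> fT x _; have [f1 f2] := fT (x + b) I; split.
  by move=> i; exact: is_derive_shift.
apply: (@continuous_comp _ _ _ (fun y : 'rV[R]_n => y + b) df); last exact: f2.
by apply: continuousD; [exact: cvg_id|exact: cst_continuous].
Qed.

Lemma test_field_shift (T : 'rV[R]_n -> 'rV[R]_n) b : test_field T ->
  test_field (fun x => T (x + b)) /\ forall x, div (fun x => T (x + b)) x = div T (x + b).
Proof.
move=> tT; have [T1 T2 T3] := tT.
have Hs i := C1g_shift b (C1_on_C1g (T1 i)).
split; last first.
  by move=> x; apply: eq_bigr => i _; rewrite (C1g_partial i (Hs i) I) mxE.
split => //; first by move=> i; exact: C1gP (openT) (Hs i).
have [K HK] := compact_supp_bound T2.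
apply: (@bound_compact_supp _ _ _ _ (K + `|b|)) => x Kx; apply: HK.
have := ler_normD (x + b) (- b); rewrite addrK normrN => H.
by rewrite -(ltrD2r `|b|); exact: lt_le_trans H.
Qed.

(** Shifting a test field for [A] along with [A] gives one for the translate with the same integral
    of the divergence. *)
Lemma perimeter_translate b A : measurable A ->
  (perimeter A <= perimeter (translate b A))%E.
Proof.
move=> mA; apply: ge_ereal_sup => _ [T tT <-].
have [K HK] := test_field_div0 tT.
have K0 : exists K, forall x, K < `|x| -> \1_A x * div T x = 0.
  by exists K => x /HK ->; rewrite mulr0.
rewrite integral_div_indic//; last exact: test_field_C1.
have [sT sdiv] := test_field_shift (- b) tT.
have := perimeter_ge (measurable_translate b mA) sT.
apply: le_trans; rewrite lee_fin le_eqVlt; apply/orP; left; apply/eqP.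
have := Rintegral_affine (- b) (oner_neq0 R) (bbs_indic_div mA (test_field_C1 tT) K0).
rewrite normr1 expr1n mul1r => <-.
apply: eq_Rintegral => x _; rewrite scale1r sdiv !indicE; congr ((nat_of_bool _)%:R * _).
have tx : translate b A x = A (x - b) by rewrite translateE.
by apply/idP/idP => /set_mem H; apply/mem_set; [rewrite tx|rewrite -tx].
Qed.

Lemma isoperimetric_translate v b : (0 < n)%N -> (forall w, sphere w -> `|v w| <= 2^-1) ->
  C2_sphere v -> vol (translate b (ball_graph v)) = vol (@unit_ball R n) ->
  ((n%:R * fine (mu (eball 1)))%:E <= perimeter (translate b (ball_graph v)))%E.
Proof.
move=> n0 v2 C2v.
have mB : measurable (ball_graph v) by apply: open_measurable_rV; exact: open_ball_graph.
rewrite !volE; [|exact: measurable_eball|exact: measurable_translate].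
rewrite measure_translate// => BE.
apply: le_trans (perimeter_translate b mB).
by rewrite -BE; exact: isoperimetric_ball_graph.
Qed.

End translation.

(** * Hessians and the divergence of the normal field *)

Section hessian_calculus.
Context {R : realType} {n : nat}.
Implicit Types (f g : 'rV[R]_n -> R) (df dg : 'rV[R]_n -> 'rV[R]_n).
Implicit Types (U : set 'rV[R]_n) (H : 'rV[R]_n -> 'M[R]_n) (A : 'M[R]_n).

(** Unlike in [C2g] the Hessian is explicit, row [i] being the gradient of the [i]-th partial
    derivative; it is needed for the divergence of the normal field. *)
Definition C2h U f df H :=
  C1g U f df /\ forall i, C1g U (fun x => df x 0 i) (fun x => row i (H x)).

Definition quad A (x : 'rV[R]_n) : R := dot (x *m A) x.

Lemma C2hW U f df H : C2h U f df H -> C2g U f df.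
Proof. by move=> [f1 f2]; split => // i; eexists; exact: f2. Qed.

Lemma C2h_eq U f df H g dg K : open U -> {in U, f =1 g} -> {in U, df =1 dg} ->
  {in U, H =1 K} -> C2h U f df H -> C2h U g dg K.
Proof.
move=> oU fg dfg HK [f1 f2]; split; first exact: C1g_eq f1.
by move=> i; apply: C1g_eq (f2 i) => // x xU; rewrite ?dfg ?HK.
Qed.

Lemma C2hD U f df H g dg K : C2h U f df H -> C2h U g dg K ->
  C2h U (fun x => f x + g x) (fun x => df x + dg x) (fun x => H x + K x).
Proof.
move=> [f1 f2] [g1 g2]; split; first exact: C1gD.
move=> i; have := C1gD (f2 i) (g2 i).
rewrite (_ : (fun x => df x 0 i + dg x 0 i) = (fun x => (df x + dg x) 0 i)); last first.
  by apply/funext => x; rewrite mxE.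
rewrite (_ : (fun x => row i (H x) + row i (K x)) = (fun x => row i (H x + K x))) //.
by apply/funext => x; rewrite linearD.
Qed.

Lemma C2hZ U (c : R) f df H : open U -> C2h U f df H ->
  C2h U (fun x => c * f x) (fun x => c *: df x) (fun x => c *: H x).
Proof.
move=> oU [f1 f2]; split; first exact: C1gZ.
move=> i; have := C1gZ c oU (f2 i).
rewrite (_ : (fun x => c * df x 0 i) = (fun x => (c *: df x) 0 i)); last first.
  by apply/funext => x; rewrite mxE.
rewrite (_ : (fun x => c *: row i (H x)) = (fun x => row i (c *: H x))) //.
by apply/funext => x; rewrite linearZ.
Qed.

Lemma C2hB U f df H g dg K : open U -> C2h U f df H -> C2h U g dg K ->
  C2h U (fun x => f x - g x) (fun x => df x - dg x) (fun x => H x - K x).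
Proof.
move=> oU fU gU; have := C2hD fU (C2hZ (-1) oU gU).
by apply: C2h_eq => // x _; rewrite ?mulN1r ?scaleN1r.
Qed.

Lemma row_outer (u w : 'rV[R]_n) i : row i (u^T *m w) = u 0 i *: w.
Proof. by apply/rowP => j; rewrite !mxE big_ord1 !mxE. Qed.

Lemma C2hM U f df H g dg K : open U -> C2h U f df H -> C2h U g dg K ->
  C2h U (fun x => f x * g x) (fun x => f x *: dg x + g x *: df x)
    (fun x => f x *: K x + g x *: H x + (dg x)^T *m df x + (df x)^T *m dg x).
Proof.
move=> oU [f1 f2] [g1 g2]; split; first exact: C1gM.
move=> i; apply: C1g_eq (C1gD (C1gM oU f1 (g2 i)) (C1gM oU g1 (f2 i))) => // x _.
  by rewrite !mxE.
by rewrite !linearD/= !linearZ/= !row_outer addrACA addrA.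
Qed.

Lemma C2h_comp U f df H (phi dphi d2phi : R -> R) : open U -> C2h U f df H ->
  (forall x, U x -> is_derive (f x) 1 phi (dphi (f x)) /\
    is_derive (f x) 1 dphi (d2phi (f x)) /\ {for f x, continuous d2phi}) ->
  C2h U (fun x => phi (f x)) (fun x => dphi (f x) *: df x)
    (fun x => dphi (f x) *: H x + d2phi (f x) *: ((df x)^T *m df x)).
Proof.
move=> oU [f1 f2] HU.
have cd x : U x -> {for f x, continuous dphi}.
  move=> /HU[_ [dd _]]; apply: differentiable_continuous.
  by apply/derivable1_diffP; case: dd.
split.
  by apply: (@C1g_comp R n U f df phi dphi oU f1) => x Ux; have [] := HU x Ux; have := cd x Ux.
move=> i; have Hd : C1g U (fun x => dphi (f x)) (fun x => d2phi (f x) *: df x).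
  by apply: (@C1g_comp R n U f df dphi d2phi oU f1) => x /HU[_ []].
apply: C1g_eq (C1gM oU Hd (f2 i)) => // x _; first by rewrite mxE.
by rewrite linearD/= !linearZ/= row_outer; congr (_ + _); rewrite !scalerA// mulrC.
Qed.

Lemma is_derive_inv (t : R) : t != 0 -> is_derive t 1 (@GRing.inv R) (- t ^- 2).
Proof.
move=> t0; have := @is_deriveV R id t 1 1 t0 (is_derive_id t 1).
by rewrite [_ *: _]mulr1.
Qed.

Lemma C2h_ln U f df H : open U -> (forall x, U x -> 0 < f x) -> C2h U f df H ->
  C2h U (fun x => ln (f x)) (fun x => (f x)^-1 *: df x)
    (fun x => (f x)^-1 *: H x - (f x) ^- 2 *: ((df x)^T *m df x)).
Proof.
move=> oU f0 fU.
have HU := @C2h_comp U f df H (@ln R) (@GRing.inv R) (fun t => - t ^- 2) oU fU.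
apply: C2h_eq (HU _) => // [x _|x Ux]; first by rewrite scaleNr.
have fx := f0 x Ux; split; first exact: is_derive1_ln.
split; first by apply: is_derive_inv; rewrite gt_eqF.
apply: cvgN; apply: cvgV; first by rewrite expf_neq0// gt_eqF.
by apply: cvgM; exact: cvg_id.
Qed.

Lemma C1g_dotl U (w : 'rV[R]_n) : open U -> C1g U (fun x => dot x w) (fun=> w).
Proof.
move=> oU; have := C1g_sum (index_enum _)
  (fun i => C1gM oU (@C1g_coord R n U i) (@C1g_cst R n U (w 0 i))).
apply: C1g_eq => // x _; first by rewrite dotE.
by rewrite [RHS]row_sum_delta; apply: eq_bigr => i _; rewrite scaler0 add0r.
Qed.

Lemma C2h_quad U A : open U -> A^T = A ->
  C2h U (quad A) (fun x => 2 *: (x *m A)) (fun=> 2 *: A).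
Proof.
move=> oU sA.
have xAE x i : (x *m A) 0 i = dot x (row i A).
  by rewrite dotE mxE; apply: eq_bigr => j _; rewrite mxE -[in RHS]sA mxE.
have HA i : C1g U (fun x => (x *m A) 0 i) (fun=> row i A).
  by apply: C1g_eq (C1g_dotl (row i A) oU) => // x _; rewrite xAE.
split.
  have := C1g_sum (index_enum _) (fun i => C1gM oU (HA i) (@C1g_coord R n U i)).
  apply: C1g_eq => // x _; first by rewrite /quad dotE.
  by rewrite big_split/= -row_sum_delta -mulmx_sum_row scaler_nat mulr2n.
move=> i; have := C1gZ 2 oU (HA i); apply: C1g_eq => // x _; first by rewrite [RHS]mxE.
by rewrite linearZ.
Qed.

Lemma quadD A B x : quad (A + B) x = quad A x + quad B x.
Proof. by rewrite /quad mulmxDr dotDl. Qed.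

Lemma quadZ (c : R) A x : quad (c *: A) x = c * quad A x.
Proof. by rewrite /quad -scalemxAr dotZl. Qed.

Lemma quadN A x : quad (- A) x = - quad A x.
Proof. by rewrite /quad mulmxN dotNl. Qed.

Lemma quad1 x : quad 1%:M x = dot x x.
Proof. by rewrite /quad mulmx1. Qed.

Lemma quad_outer (u w x : 'rV[R]_n) : quad (u^T *m w) x = dot x u * dot w x.
Proof.
rewrite /quad mulmxA [x *m u^T]mx11_scalar mul_scalar_mx dotZl; congr (_ * _).
Qed.

Lemma mxtrace_outer (u w : 'rV[R]_n) : \tr (u^T *m w) = dot u w.
Proof.
by rewrite dotE; apply: eq_bigr => i _; rewrite mxE big_ord1 mxE.
Qed.

(** The mean curvature of the level sets of [f]: the Laplacian minus the second derivative in the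
    normal direction, over the length of the gradient. The strict inequalities place [x] in an open
    set on which the cutoff is 1. *)
Lemma div_normal_field f df H x : C2h punctured f df H ->
  (forall x, x != 0 -> df x != 0) -> 1 / 32 < dot x x < 16 ->
  div (normal_field df) x =
  (enorm (df x))^-1 * (\tr (H x) - quad (H x) (df x) / dot (df x) (df x)).
Proof.
move=> [f1 f2] df0 x16.
pose U := [set x : 'rV[R]_n | 1 / 32 < dot x x < 16].
have oU : open U.
  have -> : U = (fun x => dot x x) @^-1` [set t | 1 / 32 < t < 16] by [].
  apply: open_comp => [y _|].
    exact: (C1g_continuous openT (C1g_dotxx openT)).
  have -> : [set t : R | 1 / 32 < t < 16] = [set t | 1 / 32 < t] `&` [set t | t < 16].
    by apply/seteqP; split => t /=; [move=> /andP[]|move=> [-> ->]].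
  by apply: openI; [exact: open_gt|exact: open_lt].
have Up : U `<=` punctured.
  move=> y /andP[y1 _]; rewrite /punctured/=; apply/eqP => y0; move: y1.
  by rewrite y0 dot0r; lra.
have g2 i := C1gS Up (f2 i).
have Hs := C1g_sum (index_enum _) (fun j => C1gM oU (g2 j) (g2 j)).
have p y : U y -> 0 < \sum_j df y 0 j * df y 0 j by move=> /Up Uy; rewrite -dotE dot_gt0 df0.
have Hq := C1g_sqrt oU p Hs.
have q0 y : U y -> Num.sqrt (\sum_j df y 0 j * df y 0 j) != 0.
  by move=> Uy; rewrite gt_eqF// sqrtr_gt0 p.
have HX i := C1gM oU (C1gV oU q0 Hq) (g2 i).
have HN i : C1g U (fun y => normal_field df y 0 i)
    (fun y => (enorm (df y))^-1 *: row i (H y) -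
       (df y 0 i * (enorm (df y)) ^- 3) *: (df y *m H y)).
  apply: C1g_eq (HX i) => // y; rewrite inE => Uy.
    rewrite normal_fieldE ?mxE ?enormE -?dotE//.
    by move: Uy => /andP[? ?]; apply/andP; split; exact: ltW.
  rewrite /= -dotE -enormE; congr (_ + _).
  have -> : \sum_(j < n) (df y 0 j *: row j (H y) + df y 0 j *: row j (H y)) =
      2 *: (df y *m H y) by rewrite big_split/= -mulmx_sum_row scaler_nat mulr2n.
  rewrite !scalerA -scaleNr.
  have e0 : enorm (df y) != 0 by rewrite enorm_eq0 df0//; exact: Up.
  by congr (_ *: _); field.
have e0 : enorm (df x) != 0 by rewrite enorm_eq0 df0//; exact: Up.
rewrite /div (eq_bigr (fun i => (enorm (df x))^-1 * H x i i -
   enorm (df x) ^- 3 * (df x 0 i * (df x *m H x) 0 i))); last first.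
  move=> i _; rewrite (C1g_partial i (HN i) x16) !mxE.
  by rewrite mulrA [_ ^- 3 * _]mulrC.
rewrite sumrB -!mulr_sumr /mxtrace -dotE dotC -/(quad _ _) -enorm_sqr.
by field.
Qed.

End hessian_calculus.

(** * The logarithmic saddle *)

Section log_saddle.
Context {R : realType} {n : nat}.
Variables (i0 i1 : 'I_n) (a eta : R).
Implicit Types x y V : 'rV[R]_n.

(* The gradient of the saddle is of order sqrt D (1 + |log|) and its Hessian of
   order 1 + |log|: the cube is what pairs them in the second fundamental form. *)
Lemma log_cube_bound (A D : R) : 0 < D -> D <= 2 * A ->
  D * (1 + `|ln A - ln D|) ^+ 3 <= 27 * A.
Proof.
move=> D0 DA; have A0 : 0 < A by lra.
rewrite -ln_div ?posrE//; set l := ln (A / D).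
have El : A = D * expR l by rewrite lnK ?posrE ?divr_gt0// mulrC divfK// gt_eqF.
rewrite [in leRHS]El [leRHS]mulrCA ler_pM2l//.
have [l0|l0] := leP 0 l.
  rewrite ger0_norm//.
  have -> : expR l = expR (l / 3) ^+ 3.
    by rewrite -expRM_natl; congr expR; field.
  have H : 1 + l / 3 <= expR (l / 3) by exact: expR_ge1Dx.
  have H3 : (1 + l / 3) ^+ 3 <= expR (l / 3) ^+ 3.
    by rewrite lerXn2r ?nnegrE ?expR_ge0//; lra.
  apply: le_trans (_ : 27 * (1 + l / 3) ^+ 3 <= _); last by rewrite ler_pM2l.
  have -> : 27 * (1 + l / 3) ^+ 3 = (3 + l) ^+ 3 by field.
  by rewrite lerXn2r ?nnegrE; lra.
rewrite ltr0_norm//.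
have H := expR_ge1Dx (- l); have e0 := expR_gt0 l.
have Ee : expR (- l) * expR l = 1 by rewrite -expRD addNr expR0.
have e2 : 1 <= 2 * expR l by rewrite -(ler_pM2l D0) mulr1 mulrCA -El.
have E2 : expR (- l) <= 2.
  by rewrite -(ler_pM2r e0) Ee.
have l1 : - l <= 1 by lra.
apply: le_trans (_ : 2 ^+ 3 <= _); last by rewrite !exprS expr0; lra.
by rewrite lerXn2r ?nnegrE; lra.
Qed.

Lemma sqr_le_ge0 (u w : R) : 0 <= w -> u ^+ 2 <= w ^+ 2 -> u <= w.
Proof.
move=> w0 uw; have [u0|u0] := leP 0 u; first by rewrite -ler_sqr.
exact: le_trans (ltW u0) w0.
Qed.

(** Read [N] as the dimension, [r = |x|], [v] the length of the perturbed gradient, [t] and [q] the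
    trace and the normal second derivative of the saddle. After simplification the deviation is
    [(q / v^2 - t + (N - 1) (2 - v)) / v], and only [2 - v] feels the distance of [r] from 1. *)
Lemma calibration_arith (e N r v t q : R) : 0 < e -> 42 * e <= 1 -> 1 <= N ->
  1 / 2 <= r <= 2 -> `|t| <= (6 * N + 56) * e -> `|q| <= 2400 * e * r ^+ 2 ->
  (2 - 42 * e) * r <= v -> v <= (2 + 42 * e) * r ->
  `|v^-1 * (2 * N - t - (2 * v ^+ 2 - q) / v ^+ 2) - (N - 1)| <=
  (180 * N + 5000) * e + 4 * N * `|r - 1|.
Proof.
move=> e0 e1 N1 /andP[r1 r2] ht hq v1 v2.
have vr : r <= v.
  by apply: le_trans v1; rewrite -[leLHS]mul1r ler_wpM2r; lra.
have v0 : 0 < v by lra.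
have vn : v != 0 by rewrite gt_eqF.
have -> : v^-1 * (2 * N - t - (2 * v ^+ 2 - q) / v ^+ 2) - (N - 1) =
    v^-1 * (q / v ^+ 2 - t + (N - 1) * (2 - v)) by field.
have hq' : `|q / v ^+ 2| <= 2400 * e.
  rewrite normrM normfV (ger0_norm (sqr_ge0 v)) ler_pdivrMr ?exprn_gt0//.
  apply: le_trans hq _; apply: ler_wpM2l; first by apply: mulr_ge0; [exact: ler0n|exact: ltW].
  by rewrite ler_sqr ?nnegrE; lra.
have hv : `|(N - 1) * (2 - v)| <= N * (2 * `|r - 1| + 84 * e).
  rewrite normrM ger0_norm; last by lra.
  apply: ler_pM; [by lra|exact: normr_ge0|by lra|].
  have er : e * r <= 2 * e by rewrite mulrC ler_wpM2r// ltW.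
  have := ler_norm (r - 1); have := ler_norm (- (r - 1)); rewrite normrN => h1 h2.
  by rewrite ler_norml; apply/andP; split; lra.
have vi : v^-1 <= 2 by rewrite -(ler_pM2r v0) mulVf//; lra.
rewrite normrM gtr0_norm ?invr_gt0//.
have B : `|q / v ^+ 2 - t + (N - 1) * (2 - v)| <=
    2400 * e + (6 * N + 56) * e + N * (2 * `|r - 1| + 84 * e).
  apply: le_trans (ler_normD _ _) _; apply: lerD hv.
  by apply: le_trans (ler_normB _ _) _; exact: lerD.
apply: le_trans (_ : 2 * (2400 * e + (6 * N + 56) * e + N * (2 * `|r - 1| + 84 * e)) <= _).
  by apply: ler_pM => //; rewrite invr_ge0 ltW.
have : 0 <= N * e by apply: mulr_ge0; lra.
lra.
Qed.

Definition plane_mx : 'M[R]_n := delta_mx i0 i0 + delta_mx i1 i1.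
Definition saddle_mx : 'M[R]_n := delta_mx i0 i0 - delta_mx i1 i1.
(** Its quadratic form is [s + eta |x|^2], the regularised squared distance to the subspace
    [x_i0 = x_i1 = 0]. *)
Definition cone_mx : 'M[R]_n := plane_mx + eta *: 1%:M.

Definition log_cone x := ln (dot x x) - ln (quad cone_mx x).

Definition dlog_cone x := (dot x x)^-1 *: (2 *: x) -
  (quad cone_mx x)^-1 *: (2 *: (x *m cone_mx)).

Definition Hlog_cone x : 'M[R]_n :=
  ((dot x x)^-1 *: (2 *: 1%:M) - (dot x x) ^- 2 *: ((2 *: x)^T *m (2 *: x))) -
  ((quad cone_mx x)^-1 *: (2 *: cone_mx) -
   (quad cone_mx x) ^- 2 *: ((2 *: (x *m cone_mx))^T *m (2 *: (x *m cone_mx)))).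

(* As eta tends to 0, the Hessian blows up like a log eta on the subspace
   x_i0 = x_i1 = 0, whereas the gradient and the Laplacian stay of order a. *)
Definition log_saddle x := a * (quad saddle_mx x * log_cone x).

Definition dlog_saddle x := a *: (quad saddle_mx x *: dlog_cone x +
  log_cone x *: (2 *: (x *m saddle_mx))).

Definition Hlog_saddle x := a *: (quad saddle_mx x *: Hlog_cone x +
  log_cone x *: (2 *: saddle_mx) + (dlog_cone x)^T *m (2 *: (x *m saddle_mx)) +
  (2 *: (x *m saddle_mx))^T *m dlog_cone x).

Definition sqr_perturbed x := dot x x - log_saddle x.

Definition dsqr_perturbed x := 2 *: x - dlog_saddle x.

Definition Hsqr_perturbed x := 2 *: 1%:M - Hlog_saddle x.

Hypothesis i01 : i0 != i1.
Hypotheses (a0 : 0 < a) (eta0 : 0 < eta) (eta1 : eta <= 1).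

Lemma mulmx_delta x (i j : 'I_n) : x *m delta_mx i j = x 0 i *: delta_mx 0 j.
Proof.
apply/rowP => k; rewrite !mxE (bigD1 i)//= big1 ?addr0 => [|m mi].
  by rewrite !mxE eqxx.
by rewrite mxE (negPf mi) mulr0.
Qed.

Lemma mul_planeE x : x *m plane_mx = x 0 i0 *: delta_mx 0 i0 + x 0 i1 *: delta_mx 0 i1.
Proof. by rewrite mulmxDr !mulmx_delta. Qed.

Lemma mul_saddleE x : x *m saddle_mx = x 0 i0 *: delta_mx 0 i0 - x 0 i1 *: delta_mx 0 i1.
Proof. by rewrite mulmxBr !mulmx_delta. Qed.

Lemma mul_coneE x : x *m cone_mx = x *m plane_mx + eta *: x.
Proof. by rewrite mulmxDr -scalemxAr mulmx1. Qed.

Lemma dot_plane x y : dot (x *m plane_mx) y = x 0 i0 * y 0 i0 + x 0 i1 * y 0 i1.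
Proof. by rewrite mul_planeE dotDl !dotZl !dot_deltal. Qed.

Lemma dot_saddle x y : dot (x *m saddle_mx) y = x 0 i0 * y 0 i0 - x 0 i1 * y 0 i1.
Proof. by rewrite mul_saddleE dotBl !dotZl !dot_deltal. Qed.

Lemma quad_saddleE x : quad saddle_mx x = x 0 i0 ^+ 2 - x 0 i1 ^+ 2.
Proof. by rewrite /quad dot_saddle. Qed.

Let i10 : (i1 == i0) = false. Proof. by rewrite eq_sym (negPf i01). Qed.

Lemma enorm_plane x : enorm (x *m plane_mx) ^+ 2 = x 0 i0 ^+ 2 + x 0 i1 ^+ 2.
Proof.
rewrite enorm_sqr dot_plane mul_planeE !mxE !eqxx i10 (negPf i01)/=.
by rewrite !mulr1n !mulr0n !mulr0 !mulr1 addr0 add0r.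
Qed.

Lemma enorm_saddle x : enorm (x *m saddle_mx) = enorm (x *m plane_mx).
Proof.
apply/eqP; rewrite -(@eqrXn2 _ 2%N) ?enorm_ge0//; apply/eqP; rewrite enorm_plane.
rewrite enorm_sqr dot_saddle mul_saddleE !mxE !eqxx i10 (negPf i01)/=.
by rewrite !mulr1n !mulr0n !mulr0 !mulr1 subr0 sub0r mulrN opprK.
Qed.

Lemma normr_dot_saddle x y :
  `|dot (x *m saddle_mx) y| <= enorm (x *m plane_mx) * enorm (y *m plane_mx).
Proof.
rewrite -(@ler_pXn2r _ 2%N)// ?nnegrE ?mulr_ge0 ?enorm_ge0//.
rewrite real_normK ?num_real// exprMn !enorm_plane dot_saddle -subr_ge0.
apply: le_trans (sqr_ge0 (x 0 i0 * y 0 i1 + x 0 i1 * y 0 i0)) _.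
by rewrite le_eqVlt; apply/orP; left; apply/eqP; ring.
Qed.

Lemma enorm_plane_le x : enorm (x *m plane_mx) <= enorm x.
Proof.
have := cauchy_schwarz_dot (x *m plane_mx) x.
rewrite dot_plane -!expr2 -enorm_plane expr2.
have := enorm_ge0 (x *m plane_mx); rewrite le_eqVlt => /predU1P[<- _|p0]; first exact: enorm_ge0.
by rewrite ler_pM2l.
Qed.

Lemma quad_coneE x : quad cone_mx x = enorm (x *m plane_mx) ^+ 2 + eta * enorm x ^+ 2.
Proof. by rewrite /quad mul_coneE dotDl dotZl -enorm_sqr dot_plane enorm_plane. Qed.

Lemma normr_quad_saddle x : `|quad saddle_mx x| <= enorm (x *m plane_mx) ^+ 2.
Proof. by rewrite expr2; exact: normr_dot_saddle. Qed.

Lemma mxtrace_delta (i : 'I_n) : \tr (delta_mx i i : 'M[R]_n) = 1.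
Proof.
rewrite /mxtrace (bigD1 i)//= big1 ?addr0 ?mxE ?eqxx// => j ji.
by rewrite mxE (negPf ji).
Qed.

Section estimates.
Variable x : 'rV[R]_n.
Hypothesis x0 : x != 0.
Let r := enorm x.
Let p := enorm (x *m plane_mx).
(** All estimates are expressed in [d], the regularised distance to the singular subspace, and in
    [L]. The plane part of [x] and [eta * r] are at most [d]; the gradient and Hessian of [log_cone]
    are of order [1 / d] and [1 / d^2]. The unbounded [L] is absorbed through
    [d^2 L^3 <= 27 r^2]. *)
Let D := quad cone_mx x.
Let d := Num.sqrt D.
Let L := 1 + `|log_cone x|.

Let r0 : 0 < r. Proof. by rewrite enorm_gt0. Qed.
Let p0 : 0 <= p. Proof. exact: enorm_ge0. Qed.
Let pr : p <= r. Proof. exact: enorm_plane_le. Qed.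
Let DE : D = p ^+ 2 + eta * r ^+ 2. Proof. exact: quad_coneE. Qed.
Let D0 : 0 < D. Proof. by rewrite DE ltr_wpDl ?sqr_ge0// mulr_gt0// exprn_gt0. Qed.
Let d0 : 0 < d. Proof. by rewrite sqrtr_gt0. Qed.
Let dE : d ^+ 2 = D. Proof. by rewrite sqr_sqrtr// ltW. Qed.
Let D2r : D <= 2 * r ^+ 2. Proof.
have : p ^+ 2 <= r ^+ 2 by rewrite ler_sqr ?nnegrE ?p0 ?(ltW r0).
have : eta * r ^+ 2 <= r ^+ 2 by rewrite ler_piMl ?sqr_ge0.
by rewrite DE; lra.
Qed.
Let pd : p <= d. Proof.
apply: (sqr_le_ge0 (ltW d0)); rewrite dE DE lerDl mulr_ge0 ?sqr_ge0//; exact: ltW.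
Qed.
Let er : eta * r <= d.
Proof.
apply: (sqr_le_ge0 (ltW d0)); rewrite dE DE exprMn.
have : 0 <= p ^+ 2 by exact: sqr_ge0.
have : 0 <= r ^+ 2 by exact: sqr_ge0.
have : eta ^+ 2 <= eta by rewrite expr2 ler_piMl// ltW.
by move: (r ^+ 2) (p ^+ 2) (eta ^+ 2) => u w e; nra.
Qed.
Let L1 : 1 <= L. Proof. by rewrite lerDl. Qed.

Let L0 : 0 <= L. Proof. exact: le_trans L1. Qed.

Let dL3 : d ^+ 2 * L ^+ 3 <= 27 * r ^+ 2.
Proof. have D2 : D <= 2 * dot x x by rewrite -enorm_sqr; exact: D2r.
by rewrite dE /r enorm_sqr; exact: log_cube_bound D0 D2. Qed.

Let dL : d * L <= 6 * r.
Proof.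
apply: sqr_le_ge0; first by rewrite mulr_ge0 ?(ltW r0).
rewrite !exprMn; apply: le_trans (_ : d ^+ 2 * L ^+ 3 <= _).
  by rewrite ler_wpM2l ?sqr_ge0// [leRHS]exprSr ler_peMr ?sqr_ge0.
by apply: le_trans dL3 _; have := sqr_ge0 r; lra.
Qed.

Let dr : d <= 3 / 2 * r.
Proof.
apply: sqr_le_ge0; first by rewrite mulr_ge0 ?(ltW r0).
by rewrite dE exprMn; apply: le_trans D2r _; have := sqr_ge0 r; move: (r ^+ 2) => u; lra.
Qed.

Let cone_le : enorm (x *m cone_mx) <= 2 * d.
Proof.
rewrite mul_coneE; apply: le_trans (enorm_triangle _ _) _.
by rewrite enormZ gtr0_norm// -/r -/p; move: pd er; lra.
Qed.

Let dlog_le : d * enorm (dlog_cone x) <= 7.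
Proof.
have H : enorm (dlog_cone x) <= 2 / r + 4 / d.
  rewrite /dlog_cone; apply: le_trans (enorm_triangle _ _) _.
  rewrite enormN !enormZ -/D -/r -enorm_sqr -/r !ger0_norm ?invr_ge0 ?sqr_ge0//; last exact: ltW.
  apply: lerD.
    by rewrite le_eqVlt; apply/orP; left; apply/eqP; field; rewrite gt_eqF.
  rewrite -dE; apply: le_trans (_ : (d ^+ 2)^-1 * (2 * (2 * d)) <= _).
    by rewrite ler_pM2l ?invr_gt0 ?exprn_gt0// ler_pM2l.
  by rewrite le_eqVlt; apply/orP; left; apply/eqP; field; rewrite gt_eqF.
apply: le_trans (_ : d * (2 / r + 4 / d) <= _); first by rewrite ler_pM2l.
have -> : d * (2 / r + 4 / d) = 2 * (d / r) + 4 by field; rewrite !gt_eqF.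
have : d / r <= 3 / 2 by rewrite (ler_pdivrMr _ _ r0); exact: dr.
by lra.
Qed.

Let Q_le : `|quad saddle_mx x| <= d ^+ 2.
Proof.
apply: le_trans (normr_quad_saddle x) _; rewrite ler_sqr ?nnegrE//; exact: ltW.
Qed.

Let ll : `|log_cone x| <= L. Proof. by rewrite lerDr. Qed.

Lemma normr_log_saddle : `|log_saddle x| <= 27 * a * r ^+ 2.
Proof.
rewrite /log_saddle !normrM gtr0_norm//.
have -> : 27 * a * r ^+ 2 = a * (27 * r ^+ 2) by ring.
apply: ler_wpM2l; first exact: ltW.
apply: le_trans dL3; apply: ler_pM; rewrite ?normr_ge0//.
apply: le_trans ll _; rewrite exprS ler_peMr ?exprn_ege1//; exact: le_trans L1.
Qed.

(** The factor [d * L] is kept instead of being estimated by [r], because the plane component of the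
    perturbed gradient must be seen to be small near the singular subspace. *)
Lemma dlog_saddle_cone : enorm (dlog_saddle x) <= 7 * a * (d * L).
Proof.
rewrite /dlog_saddle enormZ gtr0_norm// [7 * a]mulrC -mulrA ler_pM2l//.
apply: le_trans (enorm_triangle _ _) _; rewrite !enormZ enorm_saddle -/p.
rewrite (@ger0_norm _ 2)//.
have e0 := enorm_ge0 (dlog_cone x); have l0 := normr_ge0 (log_cone x).
have H1 : `|quad saddle_mx x| * enorm (dlog_cone x) <= 7 * d.
  apply: le_trans (_ : d ^+ 2 * enorm (dlog_cone x) <= _); first by apply: ler_wpM2r Q_le.
  by rewrite expr2 -mulrA mulrC; apply: ler_wpM2r dlog_le; exact: ltW.
have H2 : `|log_cone x| * (2 * p) <= 2 * d * `|log_cone x|.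
  by rewrite mulrC ler_wpM2r// ler_pM2l.
rewrite /L mulrDr mulr1; apply: le_trans (lerD H1 H2) _.
by have := mulr_ge0 (ltW d0) l0; lra.
Qed.

Lemma enorm_dlog_saddle : enorm (dlog_saddle x) <= 42 * a * r.
Proof.
apply: le_trans dlog_saddle_cone _.
have -> : 42 * a * r = 7 * a * (6 * r) by ring.
by apply: ler_wpM2l dL; rewrite mulr_ge0 ?(ltW a0).
Qed.

Let tau : 0 <= D / r ^+ 2 <= 2.
Proof.
rewrite divr_ge0 ?sqr_ge0 ?(ltW D0)//= ler_pdivrMr ?exprn_gt0//; exact: D2r.
Qed.

Let sq_cone V : dot V (x *m cone_mx) ^+ 2 <= 4 * D * enorm V ^+ 2.
Proof.
apply: le_trans (_ : (enorm V * (2 * d)) ^+ 2 <= _).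
  rewrite -real_normK ?num_real// ler_sqr ?nnegrE ?mulr_ge0 ?enorm_ge0 ?(ltW d0)//.
  by apply: le_trans (normr_dot _ _) _; rewrite ler_wpM2l ?enorm_ge0.
by rewrite !exprMn dE; have := sqr_ge0 (enorm V); lra.
Qed.

Lemma quad_Hlog_cone V : D * `|quad (Hlog_cone x) V| <= 32 * enorm V ^+ 2.
Proof.
rewrite -[D in D * _](gtr0_norm D0) -normrM /Hlog_cone -/D.
have -> : quad ((dot x x)^-1 *: (2 *: 1%:M) - dot x x ^- 2 *: ((2 *: x)^T *m (2 *: x)) -
    (D^-1 *: (2 *: cone_mx) -
     D ^- 2 *: ((2 *: (x *m cone_mx))^T *m (2 *: (x *m cone_mx))))) V =
  (r ^+ 2)^-1 * (2 * enorm V ^+ 2) - r ^+ 2 ^- 2 * (2 * dot V x * (2 * dot x V)) -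
    (D^-1 * (2 * quad cone_mx V) -
     D ^- 2 * (2 * dot V (x *m cone_mx) * (2 * dot (x *m cone_mx) V))).
  move: cone_mx D => K e; rewrite !(quadD, quadN, quadZ) quad1 !quad_outer.
  by rewrite !dotZl !dotZr -!enorm_sqr.
rewrite quad_coneE.
set q := dot V x; set c := dot V (x *m cone_mx); set v := enorm V.
set w := enorm (V *m plane_mx).
rewrite [dot x V]dotC -/q [dot (x *m _) V]dotC -/c.
have rn : r != 0 by rewrite gt_eqF.
have Dn : D != 0 by rewrite gt_eqF.
have -> : D * ((r ^+ 2)^-1 * (2 * v ^+ 2) - r ^+ 2 ^- 2 * (2 * q * (2 * q)) -
    (D^-1 * (2 * (w ^+ 2 + eta * v ^+ 2)) - D ^- 2 * (2 * c * (2 * c)))) =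
  D / r ^+ 2 * (2 * v ^+ 2 - 4 * (q ^+ 2 / r ^+ 2)) - 2 * (w ^+ 2 + eta * v ^+ 2)
   + 4 * (c ^+ 2 / D) by field; rewrite rn Dn.
have v0 : 0 <= v ^+ 2 by exact: sqr_ge0.
have w0 : 0 <= w ^+ 2 <= v ^+ 2.
  by rewrite sqr_ge0 ler_sqr ?nnegrE ?enorm_ge0// enorm_plane_le.
have q0 : 0 <= q ^+ 2 / r ^+ 2 <= v ^+ 2.
  rewrite divr_ge0 ?sqr_ge0//= ler_pdivrMr ?exprn_gt0// -exprMn.
  by rewrite -real_normK ?num_real// ler_sqr ?nnegrE ?mulr_ge0 ?enorm_ge0//; exact: normr_dot.
have c0 : 0 <= c ^+ 2 / D <= 4 * v ^+ 2.
  rewrite divr_ge0 ?sqr_ge0 ?(ltW D0)//= ler_pdivrMr// mulrAC; exact: sq_cone.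
have e0 : 0 <= eta * v ^+ 2 <= v ^+ 2.
  by rewrite mulr_ge0 ?(ltW eta0)//= ler_piMl.
move: w0 q0 c0 e0 (tau).
set A := w ^+ 2; set B := _ / r ^+ 2; set C := c ^+ 2 / D; set e := eta * _; set t := D / _.
move=> /andP[? ?] /andP[? ?] /andP[? ?] /andP[? ?] /andP[t0 t2].
have H1 : t * (2 * v ^+ 2 - 4 * B) <= 4 * v ^+ 2 by nra.
have H2 : - (8 * v ^+ 2) <= t * (2 * v ^+ 2 - 4 * B) by nra.
by rewrite ler_norml; apply/andP; split; lra.
Qed.

Lemma mxtrace_Hlog_cone : D * `|\tr (Hlog_cone x)| <= 6 * n%:R + 28.
Proof.
rewrite -[D in D * _](gtr0_norm D0) -normrM /Hlog_cone -/D.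
have -> : \tr ((dot x x)^-1 *: (2 *: 1%:M) - dot x x ^- 2 *: ((2 *: x)^T *m (2 *: x)) -
    (D^-1 *: (2 *: cone_mx) -
     D ^- 2 *: ((2 *: (x *m cone_mx))^T *m (2 *: (x *m cone_mx))))) =
  (r ^+ 2)^-1 * (2 * n%:R) - r ^+ 2 ^- 2 * (4 * r ^+ 2) -
    (D^-1 * (2 * \tr cone_mx) - D ^- 2 * (4 * enorm (x *m cone_mx) ^+ 2)).
  move: cone_mx D => K e.
  do ?rewrite (mxtraceD, raddfN, mxtraceZ)/=.
  rewrite !mxtrace_outer !dotZl !dotZr mxtrace1 -!enorm_sqr.
  congr (_ - _ * _ - (_ - _ * _)); rewrite -/r; ring.
have -> : \tr cone_mx = 2 + eta * n%:R.
  by rewrite mxtraceD mxtraceZ mxtrace1 mxtraceD !mxtrace_delta.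
have rn : r != 0 by rewrite gt_eqF.
have Dn : D != 0 by rewrite gt_eqF.
have N0 : 0 <= n%:R :> R by rewrite ler0n.
set c := enorm (x *m cone_mx).
have -> : D * ((r ^+ 2)^-1 * (2 * n%:R) - r ^+ 2 ^- 2 * (4 * r ^+ 2) -
    (D^-1 * (2 * (2 + eta * n%:R)) - D ^- 2 * (4 * c ^+ 2))) =
  D / r ^+ 2 * (2 * n%:R - 4) - 2 * (2 + eta * n%:R) + 4 * (c ^+ 2 / D).
  by field; rewrite rn Dn.
have c0 : 0 <= c ^+ 2 / D <= 4.
  rewrite divr_ge0 ?sqr_ge0 ?(ltW D0)//= ler_pdivrMr//.
  apply: le_trans (_ : (2 * d) ^+ 2 <= _); last by rewrite exprMn dE; lra.
  by rewrite ler_sqr ?nnegrE ?enorm_ge0 ?mulr_ge0 ?(ltW d0).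
have e0 : 0 <= eta * n%:R <= n%:R by rewrite mulr_ge0 ?(ltW eta0)//= ler_piMl.
move: c0 e0 tau; set C := c ^+ 2 / D; set e := eta * _; set t := D / _.
move=> /andP[? ?] /andP[? ?] /andP[t0 t2].
have H1 : t * (2 * n%:R - 4) <= 4 * n%:R by nra.
have H2 : - 8 <= t * (2 * n%:R - 4) by nra.
by rewrite ler_norml; apply/andP; split; lra.
Qed.

(** [saddle_mx] has trace zero, so the term carrying the bare logarithm disappears; this is the
    harmonicity of [Q]. What remains is bounded because [Q] and the plane part of [x] compensate the
    negative powers of [d]. *)
Lemma mxtrace_Hlog_saddle : `|\tr (Hlog_saddle x)| <= (6 * n%:R + 56) * a.
Proof.
rewrite /Hlog_saddle mxtraceZ normrM gtr0_norm// mulrC ler_wpM2r ?(ltW a0)//.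
have -> : \tr (quad saddle_mx x *: Hlog_cone x + log_cone x *: (2 *: saddle_mx) +
    (dlog_cone x)^T *m (2 *: (x *m saddle_mx)) +
    (2 *: (x *m saddle_mx))^T *m dlog_cone x) =
  quad saddle_mx x * \tr (Hlog_cone x) + 4 * dot (dlog_cone x) (x *m saddle_mx).
  move: (Hlog_cone x) => Hl; rewrite !mxtraceD !mxtraceZ !mxtrace_outer.
  have -> : \tr saddle_mx = 0 by rewrite raddfB/= !mxtrace_delta subrr.
  by rewrite dotZl dotZr [dot (x *m _) _]dotC; ring.
apply: le_trans (ler_normD _ _) _; rewrite !normrM.
have H1 : `|quad saddle_mx x| * `|\tr (Hlog_cone x)| <= 6 * n%:R + 28.
  apply: le_trans mxtrace_Hlog_cone; rewrite -/D -dE; apply: ler_wpM2r Q_le.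
  exact: normr_ge0.
have H2 : `|dot (dlog_cone x) (x *m saddle_mx)| <= 7.
  apply: le_trans (normr_dot _ _) _; rewrite enorm_saddle -/p mulrC.
  apply: le_trans dlog_le; apply: ler_wpM2r pd; exact: enorm_ge0.
by rewrite (@ger0_norm _ 4)//; lra.
Qed.

Hypothesis a_small : 42 * a <= 1.

Let V := dsqr_perturbed x.

Let Vr : r <= enorm V <= 3 * r.
Proof.
have H := enorm_dlog_saddle.
have H2 : enorm (2 *: x) = 2 * r by rewrite enormZ ger0_norm.
have H3 := enorm_triangle (2 *: x) (- dlog_saddle x).
have H4 := enorm_triangle (2 *: x - dlog_saddle x) (dlog_saddle x).
move: H3 H4; rewrite subrK enormN H2 -/V; move: H; rewrite -/r.
have : 42 * a * r <= r by rewrite ler_piMl// ltW.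
by move=> *; apply/andP; split; lra.
Qed.

(** The unperturbed part contributes [2 d] and the saddle at most [d * L], by the refined gradient
    bound. *)
Let VP : enorm (V *m plane_mx) <= 3 * (d * L).
Proof.
rewrite mulmxDl; apply: le_trans (enorm_triangle _ _) _.
rewrite mulNmx enormN -scalemxAl enormZ ger0_norm// -/p.
have H1 := le_trans (enorm_plane_le (dlog_saddle x)) dlog_saddle_cone.
have dL' : d <= d * L by rewrite ler_peMr// ltW.
have H2 : 7 * a * (d * L) <= d * L.
  apply: ler_piMl; first by rewrite mulr_ge0 ?(ltW d0).
  by move: a0 a_small; lra.
by move: pd H1; lra.
Qed.

(** In the direction of the gradient the logarithm survives, but multiplied by [Q] of the gradient,
    which is at most the square of its plane component. This yields [L * (d L)^2], exactly the cube
    that is controlled. The constants add up to [288 + 2 * 243 + 4 * 378 <= 2400]. *)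
Lemma quad_Hlog_saddle : `|quad (Hlog_saddle x) V| <= 2400 * a * r ^+ 2.
Proof.
rewrite /Hlog_saddle quadZ normrM gtr0_norm//.
have -> : 2400 * a * r ^+ 2 = a * (2400 * r ^+ 2) by ring.
apply: ler_wpM2l; first exact: ltW.
have -> : quad (quad saddle_mx x *: Hlog_cone x + log_cone x *: (2 *: saddle_mx) +
    (dlog_cone x)^T *m (2 *: (x *m saddle_mx)) +
    (2 *: (x *m saddle_mx))^T *m dlog_cone x) V =
  quad saddle_mx x * quad (Hlog_cone x) V + 2 * (log_cone x * quad saddle_mx V) +
  4 * (dot V (dlog_cone x) * dot (x *m saddle_mx) V).
  move: (log_cone x) (dlog_cone x) (Hlog_cone x) (quad _ x) => l dl Hl q.
  move: saddle_mx V => S W.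
  rewrite !(quadD, quadZ, quad_outer) !dotZl !dotZr.
  by rewrite [dot dl W]dotC [dot W (x *m S)]dotC; ring.
have rr := sqr_ge0 r.
have [V1 V2] := andP Vr.
have H1 : `|quad saddle_mx x| * `|quad (Hlog_cone x) V| <= 288 * r ^+ 2.
  apply: le_trans (_ : D * `|quad (Hlog_cone x) V| <= _).
    by rewrite -dE; apply: ler_wpM2r Q_le; exact: normr_ge0.
  apply: le_trans (quad_Hlog_cone _) _.
  have : enorm V ^+ 2 <= (3 * r) ^+ 2 by rewrite ler_sqr ?nnegrE ?enorm_ge0 ?mulr_ge0 ?(ltW r0).
  by rewrite exprMn; lra.
have H2 : `|log_cone x| * `|quad saddle_mx V| <= 243 * r ^+ 2.
  apply: le_trans (_ : L * (3 * (d * L)) ^+ 2 <= _).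
    apply: ler_pM; rewrite ?normr_ge0//.
    apply: le_trans (normr_quad_saddle V) _.
    rewrite ler_sqr ?nnegrE ?enorm_ge0//.
    exact: le_trans (enorm_ge0 _) VP.
  have -> : L * (3 * (d * L)) ^+ 2 = 9 * (d ^+ 2 * L ^+ 3) by ring.
  by move: dL3; lra.
have H3 : `|dot V (dlog_cone x)| * `|dot (x *m saddle_mx) V| <= 378 * r ^+ 2.
  apply: le_trans (_ : (3 * r * enorm (dlog_cone x)) * (d * (3 * (d * L))) <= _).
    apply: ler_pM; rewrite ?normr_ge0//.
      apply: le_trans (normr_dot _ _) _; apply: ler_wpM2r V2; exact: enorm_ge0.
    apply: le_trans (normr_dot_saddle _ _) _.
    by apply: ler_pM; rewrite ?enorm_ge0//; exact: VP.
  have -> : 3 * r * enorm (dlog_cone x) * (d * (3 * (d * L))) =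
    (d * enorm (dlog_cone x)) * (9 * r * (d * L)) by ring.
  apply: le_trans (_ : 7 * (9 * r * (6 * r)) <= _); last by lra.
  have r9 : 0 <= 9 * r by rewrite mulr_ge0 ?(ltW r0).
  apply: ler_pM; [|by rewrite mulr_ge0// mulr_ge0 ?(ltW d0)//; exact: le_trans L1|exact: dlog_le|].
    by rewrite mulr_ge0 ?enorm_ge0 ?(ltW d0).
  exact: ler_wpM2l dL.
apply: le_trans (ler_normD _ _) _; apply: le_trans (lerD (ler_normD _ _) (lexx _)) _.
by rewrite !normrM !(@ger0_norm _ 2)// !(@ger0_norm _ 4)//; lra.
Qed.

End estimates.

Let sym_plane : plane_mx^T = plane_mx. Proof. by rewrite raddfD/= !trmx_delta. Qed.

Let sym_saddle : saddle_mx^T = saddle_mx. Proof. by rewrite raddfB/= !trmx_delta. Qed.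

Let sym_cone : cone_mx^T = cone_mx.
Proof. by rewrite raddfD/= linearZ/= trmx1 sym_plane. Qed.

Lemma quad_cone_gt0 x : x != 0 -> 0 < quad cone_mx x.
Proof.
by move=> x0; rewrite quad_coneE ltr_wpDl ?sqr_ge0// mulr_gt0// exprn_gt0// enorm_gt0.
Qed.

Lemma C2h_log_saddle : C2h punctured log_saddle dlog_saddle Hlog_saddle.
Proof.
have oU := @open_punctured R n.
have Hr : C2h punctured (fun x => dot x x) (fun x => 2 *: x) (fun=> 2 *: 1%:M).
  have := C2h_quad oU (@trmx1 R n); apply: C2h_eq => // x _; first by rewrite quad1.
  by rewrite mulmx1.
have HL := C2hB oU (C2h_ln oU (fun x (Ux : punctured x) => (etrans (dot_gt0 x) Ux)) Hr)
  (C2h_ln oU (fun x (Ux : punctured x) => quad_cone_gt0 Ux) (C2h_quad oU sym_cone)).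
exact: (C2hZ a oU (C2hM oU (C2h_quad oU sym_saddle) HL)).
Qed.

Lemma C2h_sqr_perturbed : C2h punctured sqr_perturbed dsqr_perturbed Hsqr_perturbed.
Proof.
have oU := @open_punctured R n.
have Hr : C2h punctured (fun x => dot x x) (fun x => 2 *: x) (fun=> 2 *: 1%:M).
  have := C2h_quad oU (@trmx1 R n); apply: C2h_eq => // x _; first by rewrite quad1.
  by rewrite mulmx1.
exact: C2hB C2h_log_saddle.
Qed.

Hypothesis a_small : 42 * a <= 1.

Lemma enorm_dsqr_perturbed x : x != 0 ->
  (2 - 42 * a) * enorm x <= enorm (dsqr_perturbed x) <= (2 + 42 * a) * enorm x.
Proof.
move=> x0; have H := enorm_dlog_saddle x0.
have H2 : enorm (2 *: x) = 2 * enorm x by rewrite enormZ ger0_norm.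
have H3 := enorm_triangle (2 *: x) (- dlog_saddle x).
have H4 := enorm_triangle (2 *: x - dlog_saddle x) (dlog_saddle x).
move: H3 H4; rewrite subrK enormN H2 /dsqr_perturbed; move: H.
by move=> *; apply/andP; split; lra.
Qed.

Lemma dsqr_perturbed_neq0 x : x != 0 -> dsqr_perturbed x != 0.
Proof.
move=> x0; have /andP[H _] := enorm_dsqr_perturbed x0.
have : 0 < enorm x by rewrite enorm_gt0.
rewrite -enorm_gt0 => r0; apply: lt_le_trans H; apply: mulr_gt0 => //.
by move: a0 a_small; lra.
Qed.

(** The bound contains no [eta]. The last term reflects that spheres of radius [r] have mean
    curvature [(n - 1) / r], so smallness requires closeness to the unit sphere. *)
Lemma div_normal_sqr_perturbed x : 1 / 2 <= enorm x <= 2 ->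
  `|div (normal_field dsqr_perturbed) x - (n%:R - 1)| <=
  (180 * n%:R + 5000) * a + 4 * n%:R * `|enorm x - 1|.
Proof.
move=> /andP[r1 r2]; have x0 : x != 0 by rewrite -enorm_gt0; lra.
rewrite (div_normal_field C2h_sqr_perturbed dsqr_perturbed_neq0); last first.
  by rewrite -enorm_sqr; apply/andP; split; nra.
have T := mxtrace_Hlog_saddle x0; have Q := quad_Hlog_saddle x0 a_small.
have /andP[v1 v2] := enorm_dsqr_perturbed x0.
have -> : \tr (Hsqr_perturbed x) = 2 * n%:R - \tr (Hlog_saddle x).
  by rewrite raddfB/= mxtraceZ mxtrace1.
have -> : quad (Hsqr_perturbed x) (dsqr_perturbed x) =
   2 * dot (dsqr_perturbed x) (dsqr_perturbed x) - quad (Hlog_saddle x) (dsqr_perturbed x).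
  rewrite /Hsqr_perturbed; move: (Hlog_saddle x) (dsqr_perturbed x) => K w.
  by rewrite quadD quadN quadZ quad1.
rewrite -enorm_sqr.
move: T Q v1 v2; set t := \tr _; set q := quad _ _; set v := enorm (dsqr_perturbed x).
apply: calibration_arith => //; first by rewrite ler1n; exact: leq_ltn_trans (ltn_ord i0).
by rewrite r1.
Qed.

End log_saddle.

(** * Volumes of Euclidean balls *)

Section ball_measure.
Context {R : realType} {n : nat}.
Notation mu := (borel_lebesgue R n).

Lemma measure_eball (c : R) : 0 < c -> mu (eball c) = ((c ^+ n)%:E * mu (eball 1))%E.
Proof.
move=> c0; have := @borel_lebesgue_affine R n c 0 (eball c) (lt0r_neq0 c0) (@measurable_eball R n c).
rewrite gtr0_norm// => <-; congr (_ * mu _)%E.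
apply/seteqP; split => x; rewrite /eball/= addr0 enormZ gtr0_norm//.
  by rewrite -[ltRHS]mulr1 ltr_pM2l.
by move=> x1; rewrite -[ltRHS]mulr1 ltr_pM2l.
Qed.

Lemma measure_bounded_fin (A : set 'rV[R]_n) K : measurable A ->
  (forall x, A x -> `|x| <= K) -> mu A \is a fin_num.
Proof.
move=> mA AK; rewrite ge0_fin_numE//.
apply: le_lt_trans (borel_lebesgue_cball n K).
by apply: le_measure; rewrite ?inE//; exact: measurable_rV_cball.
Qed.

Lemma measure_eball_fin c : mu (eball c) \is a fin_num.
Proof.
apply: (@measure_bounded_fin _ c); first exact: measurable_eball.
by move=> x xc; apply: le_trans (norm_le_enorm x) _; exact: ltW.
Qed.

End ball_measure.

Lemma measure_rV_gt0 (R : realType) n : (0 < borel_lebesgue R n [set: 'rV[R]_n])%E.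
Proof.
elim: n => [|n IH]; first by rewrite /= diracT.
have -> : borel_lebesgue R n.+1 setT = ((@lebesgue_measure R \x borel_lebesgue R n) setT)%E by [].
rewrite -setXTT product_measure1E//; apply: mule_gt0 => //.
apply: (@lt_le_trans _ _ (@lebesgue_measure R `[0, 1]%classic)).
  by rewrite lebesgue_measure_itv/= lte_fin ltr01 sube0 lte_fin.
by apply: le_measure; rewrite ?inE//; exact: measurable_itv.
Qed.

(** By scaling, a null unit ball would make every ball null, and then the whole space, a countable
    union of balls. *)
Lemma measure_eball_gt0 (R : realType) n (c : R) : 0 < c -> (0 < borel_lebesgue R n (eball c))%E.
Proof.
move=> c0; rewrite measure_eball//; apply: mule_gt0; first by rewrite lte_fin exprn_gt0.
rewrite lt0e measure_ge0 andbT; apply/eqP => B0.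
have := measure_rV_gt0 R n; rewrite ltNge => /negP; apply.
have -> : [set: 'rV[R]_n] = \bigcup_k eball k.+1%:R.
  apply/seteqP; split => // x _; exists (Num.bound (enorm x)) => //=.
  rewrite /eball/=; apply: lt_le_trans (_ : (Num.bound (enorm x))%:R <= _); last by rewrite ler_nat.
  by have := archi_boundP (enorm_ge0 x).
have mb k : measurable (eball k.+1%:R : set 'rV[R]_n) by exact: measurable_eball.
apply: le_trans (@measure_sigma_subadditive _ _ _ (borel_lebesgue R n) _
  (fun k => eball k.+1%:R) mb (bigcup_measurable (fun k _ => mb k)) (@subset_refl _ _)) _.
by rewrite eseries0// => k _ _; rewrite /= measure_eball ?ltr0Sn// [X in (_ * X)%E]B0 mule0.
Qed.

(** * The set E: volume, shape and perimeter *)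

Section saddle_ball.
Context {R : realType} {n : nat}.
Variables (i0 i1 : 'I_n) (a eta : R).
Hypothesis i01 : i0 != i1.
Hypotheses (a0 : 0 < a) (eta0 : 0 < eta) (eta1 : eta <= 1) (a_small : 1000 * a <= 1).
Notation mu := (borel_lebesgue R n).
Notation G := (sqr_perturbed i0 i1 a eta).
Notation dG := (dsqr_perturbed i0 i1 a eta).
Implicit Types x : 'rV[R]_n.

Let a42 : 42 * a <= 1. Proof. by move: a0 a_small; lra. Qed.

Lemma log_saddle_bound x : `|log_saddle i0 i1 a eta x| <= 27 * a * enorm x ^+ 2.
Proof.
have [->|x0] := eqVneq x 0; last exact: normr_log_saddle.
by rewrite /log_saddle quad_saddleE !mxE subrr mul0r mulr0 normr0 enorm0 expr0n mulr0.
Qed.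

Lemma sqr_perturbed_bound x :
  (1 - 27 * a) * enorm x ^+ 2 <= G x <= (1 + 27 * a) * enorm x ^+ 2.
Proof.
have := log_saddle_bound x; rewrite ler_norml /sqr_perturbed -enorm_sqr => /andP[? ?].
by apply/andP; split; lra.
Qed.

Lemma sqr_perturbed_gt0 x : x != 0 -> 0 < G x.
Proof.
move=> x0; have /andP[H _] := sqr_perturbed_bound x.
apply: lt_le_trans H; rewrite mulr_gt0 ?exprn_gt0 ?enorm_gt0//.
by move: a0 a_small; lra.
Qed.

(** The logarithm has an argument of degree zero, so the saddle inherits the degree of [Q]. *)
Lemma sqr_perturbedZ t x : 0 < t -> G (t *: x) = t ^+ 2 * G x.
Proof.
move=> t0; have [->|x0] := eqVneq x 0.
  rewrite scaler0; have := sqr_perturbed_bound 0.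
  by rewrite enorm0 expr0n/= !mulr0 => H; rewrite -(le_anti H) mulr0.
have tt : 0 < t * t by rewrite mulr_gt0.
have q0 : 0 < quad (cone_mx i0 i1 eta) x by exact: quad_cone_gt0.
have x2 : 0 < dot x x by rewrite dot_gt0.
have quadZr A : quad A (t *: x) = t * t * quad A x.
  by rewrite /quad -scalemxAl dotZl dotZr mulrA.
rewrite /sqr_perturbed /log_saddle /log_cone !quadZr dotZl dotZr [t * (t * _)]mulrA.
rewrite !lnM ?posrE//; ring.
Qed.

Lemma dot_dsqr_perturbed x : x != 0 -> dot x (dG x) = 2 * G x.
Proof.
move=> x0; apply: (C1g_homogeneous (@open_punctured R n)) => //.
  by have [] := C2h_sqr_perturbed a i01 eta0.
by move=> t t0; rewrite sqr_perturbedZ.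
Qed.

Definition saddle_ball (k : R) : set 'rV[R]_n := [set x | G x < k ^+ 2].

Let G_C1 : C1g punctured G dG.
Proof. by have [] := C2h_sqr_perturbed a i01 eta0. Qed.

Lemma punctured_cover (c : R) x : 0 < c -> punctured x \/ eball c x.
Proof.
move=> c0; have [->|x0] := eqVneq x 0; last by left.
by right; rewrite /eball/= enorm0.
Qed.

Lemma open_saddle_ball k : 0 < k -> open (saddle_ball k).
Proof.
(* Steepness [2 / k^2] asks for [G <= k^2 / 2] near the origin, which holds on the ball of radius
   [k / 2]. *)
move=> k0; have c0 : 0 < 2 / k ^+ 2 by rewrite divr_gt0// exprn_gt0.
apply: (@open_sublevel R n punctured (eball (k / 2)) G dG (k ^+ 2) (2 / k ^+ 2)
  (@open_punctured R n) (@eball_open R n (k / 2)) _ G_C1 c0).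
  by move=> x; apply: punctured_cover; rewrite divr_gt0.
move=> x; rewrite /eball/= => xk; have /andP[_ H] := sqr_perturbed_bound x.
have k2 : enorm x ^+ 2 <= k ^+ 2 / 4.
  have -> : k ^+ 2 / 4 = (k / 2) ^+ 2 by field.
  by rewrite ler_sqr ?nnegrE ?enorm_ge0 ?divr_ge0 ?(ltW k0) ?(ltW xk).
have := sqr_ge0 (enorm x); rewrite invf_div; move: H k2 a0 a_small.
by move: (enorm x ^+ 2) (k ^+ 2) (G x) => u w g; nra.
Qed.

Lemma measurable_saddle_ball k : 0 < k -> measurable (saddle_ball k).
Proof. by move=> k0; apply: open_measurable_rV; exact: open_saddle_ball. Qed.

Lemma saddle_ball_enorm k x : 0 < k -> saddle_ball k x -> enorm x <= 2 * k.
Proof.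
move=> k0; rewrite /saddle_ball/= => Gk; have /andP[H _] := sqr_perturbed_bound x.
apply: sqr_le_ge0; first by rewrite mulr_ge0// ltW.
have := sqr_ge0 (enorm x); rewrite exprMn; move: H Gk a0 a_small.
by move: (enorm x ^+ 2) (k ^+ 2) (G x) => u w g; nra.
Qed.

(** By homogeneity the sets for different [k] are dilates of each other, so [k] is the [n]-th root
    of a ratio of volumes; both must be finite and positive. *)
Lemma saddle_ball_volume : exists2 k, 0 < k & mu (saddle_ball k) = mu (eball 1).
Proof.
have m1 := measurable_saddle_ball (@ltr01 R).
have f1 : mu (saddle_ball 1) \is a fin_num.
  apply: (@measure_bounded_fin _ _ _ 2) => // x /(saddle_ball_enorm (@ltr01 R)).
  by rewrite mulr1; exact/le_trans/norm_le_enorm.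
have fB := @measure_eball_fin R n 1.
have p1 : (0 < mu (saddle_ball 1))%E.
  apply: lt_le_trans (@measure_eball_gt0 R n 2^-1 _) _; first by rewrite invr_gt0.
  apply: le_measure; rewrite ?inE//; first exact: measurable_eball.
  move=> x; rewrite /eball /saddle_ball/= => x1; have /andP[_ H] := sqr_perturbed_bound x.
  rewrite expr1n; apply: le_lt_trans H _; have := enorm_ge0 x; move: x1 a0 a_small.
  by move: (enorm x) => u; nra.
have pB := @measure_eball_gt0 R n 1 ltr01.
pose q := fine (mu (eball 1)) / fine (mu (saddle_ball 1)).
have q0 : 0 < q by rewrite divr_gt0// fine_gt0// ltey_eq ?fB ?f1 ?pB ?p1.
have n0 : (0 < n)%N by exact: leq_ltn_trans (ltn_ord i0).
exists (q `^ (n%:R^-1)); first exact: powR_gt0.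
set k := _ `^ _; have k0 : 0 < k by exact: powR_gt0.
rewrite -(borel_lebesgue_affine 0 (lt0r_neq0 k0) (measurable_saddle_ball k0)).
have -> : (fun x => k *: x + 0) @^-1` saddle_ball k = saddle_ball 1.
  apply/funext => x; rewrite /saddle_ball/= addr0 sqr_perturbedZ// expr1n.
  by rewrite -{2}[k ^+ 2]mulr1 ltr_pM2l ?exprn_gt0.
rewrite gtr0_norm// -powR_mulrn ?(ltW k0)// -powRrM mulVf ?pnatr_eq0 -?lt0n//.
rewrite powRr1 ?(ltW q0)// -(fineK f1) -(fineK fB) -EFinM /q divfK//.
by rewrite gt_eqF// fine_gt0// p1 ltey_eq f1.
Qed.

Section unit_volume.
Variable k : R.
Hypotheses (k0 : 0 < k) (kB : mu (saddle_ball k) = mu (eball 1)).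

Let le1_of_measure r : 0 < r -> (mu (eball r) <= mu (eball 1))%E -> r <= 1.
Proof.
move=> r0; rewrite (measure_eball r0) -{2}[mu (eball 1)]mul1e.
rewrite lee_pmul2r ?measure_eball_gt0 ?measure_eball_fin// lee_fin => rn.
rewrite leNgt; apply/negP => r1; move: rn; rewrite leNgt exprn_egt1// -lt0n.
by rewrite (leq_ltn_trans _ (ltn_ord i0)).
Qed.

Let ge1_of_measure r : 0 < r -> (mu (eball 1) <= mu (eball r))%E -> 1 <= r.
Proof.
move=> r0; rewrite (measure_eball r0) -{1}[mu (eball 1)]mul1e.
rewrite lee_pmul2r ?measure_eball_gt0 ?measure_eball_fin// lee_fin => rn.
rewrite leNgt; apply/negP => r1; move: rn; rewrite leNgt exprn_ilt1 ?(ltW r0)// -lt0n.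
by rewrite (leq_ltn_trans _ (ltn_ord i0)).
Qed.

(** The set lies between the balls of radii [k / sqrt (1 + 27 a)] and [k / sqrt (1 - 27 a)]. Having
    the volume of the unit ball, it forces the first radius to be at most 1 and the second at least
    1. *)
Lemma saddle_ball_radius : 1 - 27 * a <= k ^+ 2 <= 1 + 27 * a.
Proof.
have p1 : 0 < 1 + 27 * a by move: a0; lra.
have p2 : 0 < 1 - 27 * a by move: a0 a_small; lra.
have mE := measurable_saddle_ball k0.
have root c x : 0 < c -> enorm x < k / Num.sqrt c <-> c * enorm x ^+ 2 < k ^+ 2.
  move=> c0; rewrite ltr_pdivlMr ?sqrtr_gt0//.
  have -> : c * enorm x ^+ 2 = (enorm x * Num.sqrt c) ^+ 2.
    by rewrite exprMn (sqr_sqrtr (ltW c0)) mulrC.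
  by rewrite ltr_sqr ?nnegrE ?mulr_ge0 ?enorm_ge0 ?sqrtr_ge0 ?(ltW k0).
have sq c : 0 < c -> (k / Num.sqrt c) ^+ 2 = k ^+ 2 / c.
  by move=> c0; rewrite exprMn exprVn sqr_sqrtr// ltW.
have s1 : 0 < k / Num.sqrt (1 + 27 * a) by rewrite divr_gt0// sqrtr_gt0.
have s2 : 0 < k / Num.sqrt (1 - 27 * a) by rewrite divr_gt0// sqrtr_gt0.
have H1 : k / Num.sqrt (1 + 27 * a) <= 1.
  apply: le1_of_measure s1 _; rewrite -kB.
  apply: le_measure; rewrite ?inE//; first exact: measurable_eball.
  move=> x /(root _ _ p1); rewrite /saddle_ball/=; apply: le_lt_trans.
  by have /andP[] := sqr_perturbed_bound x.
have H2 : 1 <= k / Num.sqrt (1 - 27 * a).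
  apply: ge1_of_measure s2 _; rewrite -kB.
  apply: le_measure; rewrite ?inE//; first exact: measurable_eball.
  move=> x; rewrite /saddle_ball/= => xk; apply/(root _ _ p2); apply: le_lt_trans xk.
  by have /andP[] := sqr_perturbed_bound x.
apply/andP; split.
  have : 1 ^+ 2 <= (k / Num.sqrt (1 - 27 * a)) ^+ 2.
    by rewrite ler_sqr ?nnegrE ?(ltW s2).
  by rewrite sq// expr1n ler_pdivlMr// mul1r.
have : (k / Num.sqrt (1 + 27 * a)) ^+ 2 <= 1 ^+ 2.
  by rewrite ler_sqr ?nnegrE ?(ltW s1).
by rewrite sq// expr1n ler_pdivrMr// mul1r.
Qed.

Lemma saddle_ball_inner x : enorm x < 1 - 55 * a -> saddle_ball k x.
Proof.
move=> xr; have /andP[_ H] := sqr_perturbed_bound x.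
have /andP[k1 _] := saddle_ball_radius.
rewrite /saddle_ball/=; apply: le_lt_trans H _; apply: lt_le_trans k1.
have : enorm x ^+ 2 < (1 - 55 * a) ^+ 2.
  by rewrite ltr_sqr ?nnegrE ?enorm_ge0//; move: a0 a_small; lra.
by move: a0 a_small; move: (enorm x ^+ 2) => u; nra.
Qed.

Lemma saddle_ball_outer x : saddle_ball k x -> enorm x < 1 + 55 * a.
Proof.
rewrite /saddle_ball/= => xk; have /andP[H _] := sqr_perturbed_bound x.
have /andP[_ k1] := saddle_ball_radius.
rewrite ltNge; apply/negP => xr.
have : (1 + 55 * a) ^+ 2 <= enorm x ^+ 2.
  by rewrite ler_sqr ?nnegrE ?enorm_ge0//; move: a0 a_small; lra.
move: H xk k1 a0 a_small; move: (enorm x ^+ 2) (G x) (k ^+ 2) => u g w; nra.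
Qed.

Let E_bound x : saddle_ball k x -> `|x| <= 2.
Proof.
move=> /saddle_ball_outer xk; apply: le_trans (norm_le_enorm x) _.
by move: xk a0 a_small; lra.
Qed.

Let near_ball x : eball (1 / 2) x -> G x <= k ^+ 2 - (a^-1)^-1.
Proof.
rewrite /eball/= => xr; have /andP[_ H] := sqr_perturbed_bound x.
have /andP[k1 _] := saddle_ball_radius.
have : enorm x ^+ 2 <= (1 / 2) ^+ 2 by rewrite ler_sqr ?nnegrE ?enorm_ge0 ?(ltW xr).
rewrite invrK; move: H k1 a0 a_small; move: (enorm x ^+ 2) (G x) (k ^+ 2) => u g w; nra.
Qed.

(** With steepness [1 / a] the transition layers lie in [k^2 - a < G < k^2], hence within distance
    [55 a] of the unit sphere. *)
Let shell x : k ^+ 2 - (a^-1)^-1 < G x < k ^+ 2 -> 1 - 55 * a <= enorm x < 1 + 55 * a.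
Proof.
rewrite invrK => /andP[g1 g2]; rewrite saddle_ball_outer// andbT.
have /andP[_ H] := sqr_perturbed_bound x; have /andP[k1 _] := saddle_ball_radius.
rewrite leNgt; apply/negP => xr.
have : enorm x ^+ 2 < (1 - 55 * a) ^+ 2.
  by rewrite ltr_sqr ?nnegrE ?enorm_ge0//; move: a0 a_small; lra.
move: H g1 k1 a0 a_small; move: (enorm x ^+ 2) (G x) (k ^+ 2) => u g w; nra.
Qed.

Let perimeter_le_field Y : C1_field Y ->
  (forall x, x != 0 -> 1 - 55 * a <= enorm x < 1 + 55 * a ->
     enorm (dG x) <= dot (dG x) (Y x)) ->
  (perimeter (saddle_ball k) <= (\int[mu]_x (\1_(saddle_ball k) x * div Y x))%:E)%E.
Proof.
move=> cY HY; have ai : 0 < a^-1 by rewrite invr_gt0.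
apply: (@perimeter_sublevel_le R n punctured (eball (1 / 2)) G dG (k ^+ 2) a^-1 2
  (@open_punctured R n) (@eball_open R n (1 / 2)) _ G_C1 ai near_ball E_bound Y cY).
  by move=> x; exact: punctured_cover.
by move=> x x0 /shell; exact: HY.
Qed.

Lemma perimeter_saddle_ball_normal : (perimeter (saddle_ball k) <=
  (\int[mu]_x (\1_(saddle_ball k) x * div (normal_field dG) x))%:E)%E.
Proof.
have HN := test_field_normal (C2hW (C2h_sqr_perturbed a i01 eta0))
  (dsqr_perturbed_neq0 i01 a0 eta0 eta1 a42).
apply: perimeter_le_field => [|x x0 /andP[x1 x2]]; first exact: test_field_C1.
rewrite normal_fieldE.
  rewrite dotZr -enorm_sqr expr2 mulrA mulVf ?mul1r// enorm_eq0.
  exact: dsqr_perturbed_neq0.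
by rewrite -enorm_sqr; apply/andP; split; move: x1 x2 a0 a_small (enorm_ge0 x); nra.
Qed.

(** A radial field as calibration: Euler's identity gives [x . dG = 2 G >= 2 (1 - 27 a) |x|^2], to
    be compared with [|dG| <= (2 + 42 a) |x|] for [|x| >= 1 - 55 a]. The factor [1 + 200 a] makes up
    for all the losses, and the divergence is constant. *)
Lemma perimeter_saddle_ball : (perimeter (saddle_ball k) <=
  ((1 + 200 * a) * n%:R * fine (mu (eball 1)))%:E)%E.
Proof.
pose Y x : 'rV[R]_n := (1 + 200 * a) *: x.
have HY i : C1g setT (fun x => Y x 0 i) (fun=> (1 + 200 * a) *: delta_mx 0 i).
  have := C1gZ (1 + 200 * a) openT (@C1g_coord R n setT i).
  by apply: C1g_eq => [|x _|]; rewrite ?mxE//; exact: openT.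
have cY : C1_field Y by move=> i; exact: C1gP openT (HY i).
have dY x : div Y x = (1 + 200 * a) * n%:R.
  rewrite /div (eq_bigr (fun=> 1 + 200 * a)).
    by rewrite sumr_const card_ord mulr_natr.
  by move=> i _; rewrite (C1g_partial i (HY i) I) !mxE !eqxx mulr1.
apply: le_trans (perimeter_le_field cY _) _.
  move=> x x0 /andP[x1 x2].
  have /andP[_ H] := enorm_dsqr_perturbed i01 a0 eta0 eta1 x0.
  apply: le_trans H _; rewrite dotZr dotC dot_dsqr_perturbed//.
  have /andP[H _] := sqr_perturbed_bound x.
  have r0 : 0 < enorm x by rewrite enorm_gt0.
  move: H x1 x2 a0 a_small r0; move: (enorm x) (G x) => r g H x1 x2 e0 e1 r0.
  have H1 : (1 + 200 * a) * (2 * ((1 - 27 * a) * r ^+ 2)) <= (1 + 200 * a) * (2 * g).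
    by apply: ler_wpM2l; lra.
  apply: le_trans H1.
  have -> : (1 + 200 * a) * (2 * ((1 - 27 * a) * r ^+ 2)) =
    ((1 + 200 * a) * 2 * (1 - 27 * a) * r) * r by ring.
  rewrite ler_pM2r//.
  apply: le_trans (_ : (1 + 200 * a) * 2 * (1 - 27 * a) * (1 - 55 * a) <= _); first nra.
  by apply: ler_wpM2l => //; apply: mulr_ge0; nra.
have mE := measurable_saddle_ball k0.
under eq_Rintegral do rewrite dY mulrC.
rewrite bbs_RintegralZ; last exact: bbs_indic mE E_bound.
by rewrite Rintegral_indic_rV// kB.
Qed.

End unit_volume.

End saddle_ball.

(** * The counterexample is nearly spherical *)

Section nearly_spherical_saddle.
Context {R : realType} {n : nat}.
Variables (i0 i1 : 'I_n) (a eta : R).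
Hypothesis i01 : i0 != i1.
Hypotheses (a0 : 0 < a) (eta0 : 0 < eta) (eta1 : eta <= 1) (a_small : 1000 * a <= 1).
Notation mu := (borel_lebesgue R n).
Notation G := (sqr_perturbed i0 i1 a eta).
Notation dG := (dsqr_perturbed i0 i1 a eta).
Implicit Types x : 'rV[R]_n.

(** A third coordinate is used here. The two points are [z (e_i2 + h e_i0)] and [z (e_i2 - h e_i0)]
    with [h^2 = eta]: the square of the norm gains [eta], but the logarithm is at least [2 / a]
    there, so the saddle removes at least [2 eta]. At the midpoint [Q = 0]. The choice of [z] puts
    [k^2] strictly between [z^2 (1 - eta)] and [z^2]. *)
Lemma saddle_ball_nonconvex (i2 : 'I_n) (k : R) : i2 != i0 -> i2 != i1 ->
  3 * eta <= expR (- (2 / a)) -> 0 < k ->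
  exists p q, [/\ saddle_ball i0 i1 a eta k p, saddle_ball i0 i1 a eta k q &
    k ^+ 2 < G (2^-1 *: (p + q))].
Proof.
move=> i20 i21 ea k0.
pose h := Num.sqrt eta; have hE : h ^+ 2 = eta by rewrite sqr_sqrtr// ltW.
pose z := k / Num.sqrt (1 - eta / 2).
have e2 : 0 < 1 - eta / 2 by move: eta1; lra.
have zE : z ^+ 2 = k ^+ 2 / (1 - eta / 2) by rewrite exprMn exprVn sqr_sqrtr// ltW.
have z0 : 0 < z by rewrite divr_gt0// sqrtr_gt0.
have kk : 0 < k ^+ 2 by rewrite exprn_gt0.
pose P (s : R) : 'rV[R]_n := (s * h) *: delta_mx 0 i0 + delta_mx 0 i2.
have Pi0 s : P s 0 i0 = s * h by rewrite !mxE !eqxx eq_sym (negPf i20) mulr1 addr0.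
have Pi1 s : P s 0 i1 = 0.
  by rewrite !mxE !eqxx eq_sym (negPf i01) [i1 == i2]eq_sym (negPf i21) mulr0 addr0.
have Pi2 s : P s 0 i2 = 1 by rewrite !mxE !eqxx (negPf i20) mulr0 add0r.
have PP s : dot (P s) (P s) = (s * h) ^+ 2 + 1.
  by rewrite {1}/P dotDl dotZl !dot_deltal Pi0 Pi2.
have GP s : s ^+ 2 = 1 -> G (z *: P s) <= z ^+ 2 * (1 - eta).
  move=> s1; rewrite sqr_perturbedZ// ler_pM2l ?exprn_gt0//.
  rewrite /sqr_perturbed /log_saddle /log_cone quad_saddleE quad_coneE//.
  rewrite (enorm_plane i01) enorm_sqr !PP Pi0 Pi1 exprMn s1 mul1r hE expr0n/= subr0 addr0.
  set l := ln _ - ln _; suff H : 2 / a <= l.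
    have : 2 <= a * l by rewrite -ler_pdivrMl// mulrC.
    by move: eta0 => e0 al; have := ler_wpM2l (ltW e0) al; lra.
  have p1 : 0 < eta + 1 by move: eta0; lra.
  have p2 : 0 < eta + eta * (eta + 1) by move: eta0; nra.
  rewrite /l -ln_div ?posrE// -[leLHS]expRK ler_ln ?posrE ?expR_gt0 ?divr_gt0//.
  rewrite ler_pdivlMr//; have E : expR (2 / a) * expR (- (2 / a)) = 1.
    by rewrite -expRD subrr expR0.
  have ep := expR_gt0 (2 / a).
  have H3 : expR (2 / a) * (3 * eta) <= 1 by rewrite -[leRHS]E ler_pM2l.
  have H4 : expR (2 / a) * (eta + eta * (eta + 1)) <= expR (2 / a) * (3 * eta).
    by rewrite ler_pM2l//; move: eta0 eta1; nra.
  by move: eta0; lra.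
have lt1 : z ^+ 2 * (1 - eta) < k ^+ 2.
  rewrite zE mulrAC ltr_pdivrMr// ltr_pM2l//; move: eta0; lra.
exists (z *: P 1), (z *: P (-1)); split.
- by apply: le_lt_trans lt1; apply: GP; rewrite expr1n.
- by apply: le_lt_trans lt1; apply: GP; rewrite sqrrN expr1n.
have -> : 2^-1 *: (z *: P 1 + z *: P (-1)) = z *: delta_mx 0 i2.
  rewrite -scalerDr /P mul1r mulN1r scaleNr addrACA subrr add0r -mulr2n -[delta_mx 0 i2 *+ 2]scaler_nat.
  by rewrite !scalerA; congr (_ *: _); field.
rewrite sqr_perturbedZ// /sqr_perturbed /log_saddle quad_saddleE dot_deltal !mxE !eqxx.
rewrite [i0 == i2]eq_sym [i1 == i2]eq_sym (negPf i20) (negPf i21) subrr mul0r mulr0 subr0 mulr1.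
by rewrite zE ltr_pdivlMr// -[ltRHS]mulr1 ltr_pM2l//; move: eta0; lra.
Qed.

Variable k : R.
Hypotheses (k0 : 0 < k) (kB : mu (saddle_ball i0 i1 a eta k) = mu (eball 1)).

(** On the ray through a unit vector [w] the equation [G (t w) = t^2 G w = k^2] has the solution
    [t = k / sqrt (G w)]. *)
Definition saddle_graph x : R := k / Num.sqrt (G x) - 1.

(** The gradient of [k sqrt (|x|^2 / G)], which is 1 plus the extension of [saddle_graph] constant
    along rays. *)
Definition dsaddle_graph x : 'rV[R]_n :=
  k *: ((2 * Num.sqrt (dot x x * (G x)^-1))^-1 *:
    (dot x x *: (- (G x) ^- 2 *: dG x) + (G x)^-1 *: (2 *: x))).

Let G_C1 : C1g punctured G dG.
Proof. by have [] := C2h_sqr_perturbed a i01 eta0. Qed.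

Let G0 x : x != 0 -> 0 < G x. Proof. exact: sqr_perturbed_gt0. Qed.

Lemma hext_saddle_graphE x : x != 0 ->
  hext saddle_graph x = k * enorm x / Num.sqrt (G x) - 1.
Proof.
move=> x0; have r0 : 0 < enorm x by rewrite enorm_gt0.
rewrite /hext /saddle_graph sqr_perturbedZ ?invr_gt0//.
rewrite sqrtrM ?sqr_ge0// sqrtr_sqr gtr0_norm ?invr_gt0//.
by rewrite invfM invrK mulrA.
Qed.

Lemma saddle_graph_bound w : sphere w -> `|saddle_graph w| <= 60 * a.
Proof.
move=> sw; have w0 : w != 0 by rewrite -enorm_eq0 sw oner_eq0.
have /andP[g1 g2] := sqr_perturbed_bound i01 a0 eta0 eta1 w.
have /andP[k1 k2] := saddle_ball_radius i01 a0 eta0 eta1 a_small k0 kB.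
have Gw := G0 w0; move: g1 g2; rewrite sw expr1n !mulr1 => g1 g2.
rewrite /saddle_graph; set y := k / _.
have y0 : 0 <= y by rewrite divr_ge0 ?sqrtr_ge0// ltW.
have yE : y ^+ 2 * G w = k ^+ 2.
  by rewrite exprMn exprVn sqr_sqrtr ?(ltW Gw)// divfK// gt_eqF.
have y1 : y ^+ 2 <= 1 + 60 * a.
  rewrite -(ler_pM2r Gw) yE; move: k1 k2 g1 g2 a0 a_small; nra.
have y2 : 1 - 60 * a <= y ^+ 2.
  rewrite -(ler_pM2r Gw) yE; move: k1 k2 g1 g2 a0 a_small; nra.
rewrite ler_norml; apply/andP; split; move: a0 a_small; nra.
Qed.

Let graph_half w : sphere w -> `|saddle_graph w| <= 2^-1.
Proof. by move=> /saddle_graph_bound; move: a0 a_small; lra. Qed.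

Lemma saddle_ball_graphE : saddle_ball i0 i1 a eta k = ball_graph saddle_graph.
Proof.
rewrite ball_graphE//; last exact: leq_ltn_trans (ltn_ord i0).
apply/funext => x; rewrite /saddle_ball/=; have [->|x0] := eqVneq x 0.
  rewrite gauge0; have := sqr_perturbed_bound i01 a0 eta0 eta1 (0 : 'rV[R]_n).
  rewrite enorm0 expr0n/= !mulr0 => H; rewrite -(le_anti H) exprn_gt0// ltr01.
  by rewrite propeqE.
have r0 : 0 < enorm x by rewrite enorm_gt0.
have s0 : 0 < Num.sqrt (G x) by rewrite sqrtr_gt0 G0.
have -> : gauge saddle_graph x = Num.sqrt (G x) / k.
  rewrite /gauge hext_saddle_graphE// addrC subrK; field.
  by rewrite !gt_eqF.
rewrite ltr_pdivrMr// mul1r.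
by rewrite -[in RHS]ltr_sqr ?nnegrE ?sqrtr_ge0 ?(ltW k0)// sqr_sqrtr// ltW// G0.
Qed.

Let f0 x : punctured x -> 0 < dot x x * (G x)^-1.
Proof. by move=> x0; rewrite divr_gt0 ?dot_gt0// G0. Qed.

Lemma C1g_saddle_graph : C1g punctured (hext saddle_graph) dsaddle_graph.
Proof.
have oU := @open_punctured R n.
have Gn x : punctured x -> G x != 0 by move=> x0; rewrite gt_eqF// G0.
have := C1gB oU (C1gZ k oU (C1g_sqrt oU f0 (C1gM oU (C1g_dotxx oU) (C1gV oU Gn G_C1))))
  (@C1g_cst R n punctured 1).
apply: C1g_eq => // x; rewrite inE => x0.
  rewrite hext_saddle_graphE// -enorm_sqr sqrtrM ?sqr_ge0// sqrtr_sqr.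
  by rewrite ger0_norm ?enorm_ge0// sqrtrV ?(ltW (G0 x0))// mulrA.
by rewrite subr0.
Qed.

Lemma dsaddle_graph_bound x : x != 0 -> enorm x * enorm (dsaddle_graph x) <= 800 * a.
Proof.
move=> x0; have r0 : 0 < enorm x by rewrite enorm_gt0.
have Gx := G0 x0; have f1 := f0 x0.
have /andP[g1 g2] := sqr_perturbed_bound i01 a0 eta0 eta1 x.
have dW := enorm_dlog_saddle i01 a0 eta0 eta1 x0.
have Wx := log_saddle_bound i01 a0 eta0 eta1 x.
have /andP[_ k1] := saddle_ball_radius i01 a0 eta0 eta1 a_small k0 kB.
set r := enorm x in r0 g1 g2 dW Wx *.
have r2 : 0 < r ^+ 2 by rewrite exprn_gt0.
have gr : r ^+ 2 / 2 <= G x by apply: le_trans g1; move: a0 a_small r2; nra.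
have gr2 : G x <= 4 * r ^+ 2 by apply: le_trans g2 _; move: a0 a_small r2; nra.
(* The main terms, both proportional to [|x|^2 x], cancel as they must for a function constant along
   rays when [a = 0]. Only terms containing the saddle or its gradient remain, whence a bound of
   order [a]. *)
have -> : dsaddle_graph x = (k * (2 * Num.sqrt (dot x x * (G x)^-1))^-1 * (G x) ^- 2) *:
    (r ^+ 2 *: dlog_saddle i0 i1 a eta x - (2 * log_saddle i0 i1 a eta x) *: x).
  rewrite /dsaddle_graph -[RHS]scalerA -[RHS]scalerA; congr (_ *: (_ *: _)).
  rewrite /dsqr_perturbed -enorm_sqr -/r.
  have -> : (G x)^-1 *: (2 *: x) = (G x) ^- 2 *: ((2 * G x) *: x).
    by rewrite !scalerA; congr (_ *: _); field; rewrite gt_eqF.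
  set c := G x ^- 2; rewrite /sqr_perturbed -enorm_sqr -/r.
  move: c (dlog_saddle _ _ _ _ x) (log_saddle _ _ _ _ x) => c d W.
  by apply/rowP => i; rewrite !mxE; ring.
have sf : 1 / 2 <= Num.sqrt (dot x x * (G x)^-1).
  apply: sqr_le_ge0; first exact: sqrtr_ge0.
  rewrite sqr_sqrtr ?(ltW f1)// ler_pdivlMr// -enorm_sqr -/r.
  by move: gr2; lra.
have si : (2 * Num.sqrt (dot x x * (G x)^-1))^-1 <= 1 by rewrite invf_le1; lra.
have sp : 0 <= (2 * Num.sqrt (dot x x * (G x)^-1))^-1 by rewrite invr_ge0; lra.
have k2 : k <= 2 by apply: sqr_le_ge0 => //; move: k1 a0 a_small; lra.
have gp : 0 <= (G x) ^- 2 by rewrite invr_ge0 sqr_ge0.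
have gi : (G x) ^- 2 <= 4 / r ^+ 4.
  rewrite -[leLHS]mul1r ler_pdivrMr ?exprn_gt0// mulrAC ler_pdivlMr ?exprn_gt0// mul1r.
  have -> : r ^+ 4 = (r ^+ 2) ^+ 2 by rewrite -exprM.
  have : (r ^+ 2 / 2) ^+ 2 <= G x ^+ 2 by rewrite ler_sqr ?nnegrE ?(ltW Gx)// divr_ge0// ltW.
  by rewrite exprMn; lra.
have v : enorm (r ^+ 2 *: dlog_saddle i0 i1 a eta x - (2 * log_saddle i0 i1 a eta x) *: x)
    <= 96 * a * r ^+ 3.
  move: dW Wx; move: (dlog_saddle _ _ _ _ x) (log_saddle _ _ _ _ x) => d W dW Wx.
  apply: le_trans (enorm_triangle _ _) _; rewrite enormN !enormZ -/r.
  rewrite ger0_norm ?(ltW r2)// normrM ger0_norm//.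
  have h1 := ler_wpM2l (ltW r2) dW.
  have h2 := ler_wpM2r (ltW r0) Wx.
  have -> : 96 * a * r ^+ 3 = r ^+ 2 * (42 * a * r) + 2 * (27 * a * r ^+ 2 * r) by ring.
  by apply: lerD h1 _; rewrite -[X in X <= _]mulrA ler_pM2l.
rewrite enormZ !normrM (gtr0_norm k0) (ger0_norm sp) (ger0_norm gp).
have kc : k * (2 * Num.sqrt (dot x x * (G x)^-1))^-1 * G x ^- 2 <= 2 * 1 * (4 / r ^+ 4).
  apply: ler_pM => //; first by rewrite mulr_ge0// ltW.
  by apply: ler_pM => //; exact: ltW.
apply: le_trans (_ : r * ((2 * 1 * (4 / r ^+ 4)) * (96 * a * r ^+ 3)) <= _).
  apply: ler_wpM2l; first exact: ltW.
  by apply: ler_pM => //; rewrite ?enorm_ge0// !mulr_ge0// ltW.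
have -> : r * (2 * 1 * (4 / r ^+ 4) * (96 * a * r ^+ 3)) = 768 * a.
  by field; rewrite gt_eqF.
by apply: ler_wpM2r; [exact: ltW|rewrite ler_nat].
Qed.

(** The value 0 at the origin makes the field measurable on the whole space and the bound on
    [|x| |g x|] valid at every point. *)
Definition saddle_weak_grad x : 'rV[R]_n := if x == 0 then 0 else dsaddle_graph x.

Lemma measurable_saddle_weak_grad i :
  measurable_fun [set: 'rV[R]_n] ((fun x => saddle_weak_grad x 0 i) : _ -> measurableTypeR R).
Proof.
have mp : measurable (@punctured R n) by apply: open_measurable_rV; exact: open_punctured.
rewrite -(setUv (@punctured R n)); apply/measurable_funU => //; first exact: measurableC.
split.
  apply: (eq_measurable_fun (fun x => dsaddle_graph x 0 i)).
    by move=> x; rewrite inE /saddle_weak_grad => /negPf ->.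
  apply: open_continuous_measurable_rV; first exact: open_punctured.
  by move=> x; rewrite inE => x0; apply: coord_cvg; have [] := C1g_saddle_graph x0.
apply: (eq_measurable_fun (fun=> 0 : measurableTypeR R)); last exact: measurable_cst.
by move=> x; rewrite inE /saddle_weak_grad => /negP/negPn ->; rewrite mxE.
Qed.

Lemma bbs_integral_lebesgue (f : 'rV[R]_n -> R) : bbsV R n f ->
  (\int[@lebesgue R n]_x (f x)%:E = (\int[mu]_x f x)%:E)%E.
Proof.
move=> bf; have fin := integrable_fin_num measurableT (bbsV_integrable bf).
rewrite /Rintegral fineK// integral_lebesgueE//.
by apply/measurable_EFinP; case: bf.
Qed.

(** A test function vanishes near the origin, so its product with the extended graph function is
    [C^1] with bounded support on the whole space, and its partial derivatives have zero integral.
    Regularity is glued from the punctured space and the complement of the support. *)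
Lemma weak_grad_saddle : weak_grad saddle_graph saddle_weak_grad.
Proof.
split; first by move=> i; apply: measurable_fun_lebesgue_type => //; exact: measurable_saddle_weak_grad.
move=> i phi phi1 cphi n0.
have Hp := C1_on_C1g phi1.
pose V : set 'rV[R]_n := ~` supp phi.
have oV : open V by apply: closed_openC; exact: closed_closure.
have V0 x : V x -> phi x = 0 by move=> /supp_zero /nbhs_singleton.
have Vg x : V x -> grad phi x = 0.
  move=> Vx; have HV : C1g V phi (fun=> 0).
    by apply: C1g_eq (@C1g_cst R n V 0) => // y; rewrite inE => /V0.
  exact: C1g_grad HV Vx.
have cover x : punctured x \/ V x.
  by have [->|x0] := eqVneq x 0; [right|left].
pose A x := hext saddle_graph x * partial i phi x.
pose B x := saddle_weak_grad x 0 i * phi x.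
have [K HK] := compact_supp_bound cphi.
have HdK x : K < `|x| -> grad phi x = 0 by exact: C1g_zero_out Hp HK x.
have pE x : partial i phi x = grad phi x 0 i by rewrite mxE.
have cA : continuous A.
  move=> x; have [x0|Vx] := cover x.
    apply: continuousM; first exact: C1g_continuous (@open_punctured R n) C1g_saddle_graph x0.
    by have [_] := phi1 i x I.
  have HA : C1g V A (fun=> 0).
    apply: C1g_eq (@C1g_cst R n V 0) => // y; rewrite inE => Vy.
    by rewrite /A pE Vg// mxE mulr0.
  exact: C1g_continuous oV HA Vx.
have cB : continuous B.
  move=> x; have [x0|Vx] := cover x.
    apply: continuousM; last exact: C1g_continuous openT Hp I.
    have np : nbhs x (@punctured R n).
      by move: (@open_punctured R n); rewrite openE; exact.
    have c1 : {for x, continuous (fun y => dsaddle_graph y 0 i)}.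
      by apply: coord_cvg; have [] := C1g_saddle_graph x0.
    rewrite /prop_for /continuous_at {2}/saddle_weak_grad (negPf (x0 : x != 0)).
    apply: (cvg_trans _ c1); apply: (@near_eq_cvg _ _ (nbhs x) (nbhs_filter x)).
    by apply: (@filterS _ (nbhs x) (nbhs_filter x) _ _ _ np) => y /negPf y0; rewrite /saddle_weak_grad y0.
  have HB : C1g V B (fun=> 0).
    by apply: C1g_eq (@C1g_cst R n V 0) => // y; rewrite inE => Vy; rewrite /B V0// mulr0.
  exact: C1g_continuous oV HB Vx.
have bA : bbsV R n A.
  by apply: (@continuous_bbs _ _ _ K) => // x Kx; rewrite /A pE HdK// mxE mulr0.
have bB : bbsV R n B.
  by apply: (@continuous_bbs _ _ _ K) => // x Kx; rewrite /B HK// mulr0.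
have Hf : C1g setT (fun x => hext saddle_graph x * phi x)
    (fun x => hext saddle_graph x *: grad phi x + phi x *: saddle_weak_grad x).
  have H1 : C1g punctured (fun x => hext saddle_graph x * phi x)
      (fun x => hext saddle_graph x *: grad phi x + phi x *: saddle_weak_grad x).
    have := C1gM (@open_punctured R n) C1g_saddle_graph (C1gS (@subsetT _ punctured) Hp).
    apply: C1g_eq => [|x _|x] //; first exact: open_punctured.
    by rewrite inE /saddle_weak_grad => /negPf ->.
  have H2 : C1g V (fun x => hext saddle_graph x * phi x)
      (fun x => hext saddle_graph x *: grad phi x + phi x *: saddle_weak_grad x).
    apply: C1g_eq (@C1g_cst R n V 0) => [|x|x] //; rewrite inE => Vx.
      by rewrite V0// mulr0.
    by rewrite V0// Vg// scaler0 scale0r addr0.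
  by move=> x _; have [/H1|/H2] := cover x.
have I0 : \int[mu]_x (A x + B x) = 0.
  have HK0 x : K < `|x| -> hext saddle_graph x * phi x = 0 by move=> /HK ->; rewrite mulr0.
  rewrite -(Rintegral_partial i Hf HK0).
  by apply: eq_Rintegral => x _; rewrite !mxE /A /B pE mxE [phi x * _]mulrC.
have -> : (\int[@lebesgue R n]_x (saddle_weak_grad x 0 i * phi x)%:E = (\int[mu]_x B x)%:E)%E.
  exact: bbs_integral_lebesgue bB.
rewrite (bbs_integral_lebesgue bA) -EFinN; congr (_%:E).
by move: I0; rewrite (bbs_RintegralD bA bB) => /eqP; rewrite addr_eq0 => /eqP.
Qed.

Lemma nearly_spherical_saddle_ball (sigma : R) : 900 * a <= sigma ->
  nearly_spherical sigma (saddle_ball i0 i1 a eta k).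
Proof.
move=> as_; exists saddle_graph; split.
- apply: continuous_in_subspaceT => w; rewrite inE => sw.
  have w0 : punctured w by rewrite /punctured/= -enorm_eq0 sw oner_eq0.
  have oU := @open_punctured R n.
  have sn x : punctured x -> Num.sqrt (G x) != 0 by move=> x0; rewrite gt_eqF// sqrtr_gt0 G0.
  exact: C1g_continuous oU (C1gB oU (C1gZ k oU (C1gV oU sn (C1g_sqrt oU G0 G_C1)))
    (@C1g_cst R n punctured 1)) w0.
- by apply: ge_ereal_sup => _ [w sw <-]; rewrite lee_fin graph_half.
(* The sup norm uses [60 a] and the gradient [800 a]; together they stay below [900 a]. *)
- have -> : sigma = 60 * a + (sigma - 60 * a) by rewrite addrC subrK.
  rewrite EFinD; apply: leeD.
    by apply: ge_ereal_sup => _ [w sw <-]; rewrite lee_fin saddle_graph_bound.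
  apply: (@le_trans _ _ (ess_sup (@lebesgue R n)
    (fun x => (enorm x * enorm (saddle_weak_grad x))%:E))).
    by apply: ereal_inf_lbound; exists saddle_weak_grad; [exact: weak_grad_saddle|reflexivity].
  apply/ess_supP; apply: nearW => x; rewrite lee_fin /saddle_weak_grad.
  have s8 : 800 * a <= sigma - 60 * a by move: a0 as_; lra.
  apply: le_trans s8; have [_|x0] := eqVneq x 0; last exact: dsaddle_graph_bound.
  by rewrite enorm0 mulr0; apply: mulr_ge0; [exact: ler0n|exact: ltW].
- exact: saddle_ball_graphE.
Qed.

End nearly_spherical_saddle.

(** * Convex sets close to the counterexample *)

Section convex_shell.
Context {R : realType} {n : nat}.
Notation mu := (borel_lebesgue R n).
Implicit Types (x y : 'rV[R]_n) (E F : set 'rV[R]_n).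

Lemma convex_set_segment F x y (t : R) :
  convex_set (F : set (convex_lmodType 'rV[R]_n)) -> F x -> F y ->
  0 <= t -> t <= 1 -> F (t *: x + (1 - t) *: y).
Proof.
move=> cF Fx Fy t0 t1; have := cF x y (Itv01 t0 t1) (mem_set Fx) (mem_set Fy).
by rewrite inE.
Qed.

Variables E F : set 'rV[R]_n.
Hypotheses (mE : measurable E) (mF : measurable F).
Hypothesis cF : convex_set (F : set (convex_lmodType 'rV[R]_n)).

Lemma translate_eballE x r y : translate x (eball r) y = (enorm (y - x) < r) :> Prop.
Proof. by rewrite translateE. Qed.

Let mB x r : measurable (translate x (eball r) : set 'rV[R]_n).
Proof. by apply: measurable_translate; exact: measurable_eball. Qed.

(** Reflection in [x]: if [y] and [2 x - y] were both in [F], so would be their midpoint [x]. Hence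
    the part of the ball inside [F] is reflected into [E] minus [F], and the part outside [F] is
    there already. *)
Lemma convex_contains_center x (r : R) : translate x (eball r) `<=` E -> ~ F x ->
  (mu (eball r) <= mu (E `\` F) + mu (E `\` F))%E.
Proof.
move=> BE Fx; rewrite -(measure_translate x (@measurable_eball R n r)).
set B := translate x (eball r).
have mEF : measurable (E `\` F) by exact: measurableD.
have mBx : measurable B := mB x r.
have mBF : measurable (B `&` F) by exact: measurableI.
have mBD : measurable (B `\` F) by exact: measurableD.
rewrite (measureDI mu mBx mF).
apply: leeD; first by apply: le_measure; rewrite ?inE// => y [/BE].
have N1 : (-1 : R) != 0 by rewrite oppr_eq0 oner_eq0.
have BFE : mu (B `&` F) = mu ((fun y => -1 *: y + 2 *: x) @^-1` (B `&` F)).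
  by have := borel_lebesgue_affine (2 *: x) N1 mBF; rewrite normrN1 expr1n mul1e => ->.
rewrite [leLHS]BFE; apply: le_measure; rewrite ?inE//.
  by rewrite -[X in measurable X]setTI; exact: (measurable_affine _ _ measurableT mBF).
move=> y /= [By Fy]; split.
  apply: BE; move: By; rewrite /B !translate_eballE.
  have -> : -1 *: y + 2 *: x - x = - (y - x) by apply/rowP => i; rewrite !mxE; ring.
  by rewrite enormN.
move=> Fy'; apply: Fx.
have := convex_set_segment cF Fy Fy' (_ : 0 <= 2^-1) (_ : 2^-1 <= 1).
rewrite invr_ge0 invf_le1// ler1n ler0n => /(_ isT isT).
by congr F; apply/rowP => i; rewrite !mxE; field.
Qed.

(** The homothety of ratio [t] centred at [x] maps the ball contained in [F] to a ball of radius
    [t r] around [(1 - t) x], still inside [F] by convexity and disjoint from [E]. *)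
Lemma convex_far_point x (t r : R) : eball r `<=` F -> F x -> 0 < t <= 1 ->
  (forall y, enorm (y - (1 - t) *: x) < t * r -> ~ E y) ->
  (mu (eball (t * r)) <= mu (F `\` E))%E.
Proof.
move=> BF Fx /andP[t0 t1] nE.
rewrite -(measure_translate ((1 - t) *: x) (@measurable_eball R n _)).
apply: le_measure; rewrite ?inE//; first exact: measurableD.
move=> y; rewrite translate_eballE => yt; split; last exact: nE.
have By : F (t^-1 *: (y - (1 - t) *: x)).
  apply: BF; rewrite /eball/= enormZ gtr0_norm ?invr_gt0//.
  by rewrite mulrC ltr_pdivrMr// mulrC.
have := convex_set_segment cF By Fx (ltW t0) t1.
by rewrite scalerA divff ?gt_eqF// scale1r subrK.
Qed.

Variables (d : R).
Hypotheses (d0 : 0 < d) (d1 : d <= 1 / 2).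
Hypothesis Ein : forall x, enorm x < 1 - d / 2 -> E x.
Hypothesis Eout : forall x, E x -> enorm x < 1 + d / 2.
Hypothesis small : (mu (E `+` F) + mu (E `+` F) < mu (eball (d / 10)))%E.

Let mY : measurable (E `+` F).
Proof. by apply: measurableU; exact: measurableD. Qed.

Let EF_le : (mu (E `\` F) <= mu (E `+` F))%E.
Proof. by apply: le_measure; rewrite ?inE//; [exact: measurableD|left]. Qed.

Let FE_le : (mu (F `\` E) <= mu (E `+` F))%E.
Proof. by apply: le_measure; rewrite ?inE//; [exact: measurableD|right]. Qed.

Let inner x : enorm x < 1 - d -> F x.
Proof.
move=> xd; apply: contrapT => Fx.
have BE : translate x (eball (d / 2)) `<=` E.
  move=> y; rewrite translate_eballE => yd; apply: Ein.
  have := enorm_triangle (y - x) x; rewrite subrK; move: yd xd; lra.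
have := convex_contains_center BE Fx; rewrite leNgt => /negP; apply.
apply: le_lt_trans (leeD EF_le EF_le) _; apply: lt_le_trans small _.
apply: le_measure; rewrite ?inE; [exact: measurable_eball|exact: measurable_eball|].
by move=> y; rewrite /eball/=; move: d0; lra.
Qed.

Let outer x : F x -> enorm x <= 1 + d.
Proof.
move=> Fx; rewrite leNgt; apply/negP => xd.
have BF : eball (1 / 2) `<=` F.
  by move=> y; rewrite /eball/= => y2; apply: inner; move: d1 y2; lra.
(* The ratio [d / 5] gives the radius [d / 10], and [(1 - d/5) (1 + d) - d/10 >= 1 + d/2] when
   [d <= 1/2], so the small ball avoids [E]. *)
have nE y : enorm (y - (1 - d / 5) *: x) < d / 5 * (1 / 2) -> ~ E y.
  move=> yd /Eout; apply/negP; rewrite -leNgt.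
  have := enorm_triangle (y - (1 - d / 5) *: x) (- y).
  rewrite addrAC subrr add0r !enormN enormZ ger0_norm; last by move: d1; lra.
  by move: xd yd d0 d1; nra.
have := convex_far_point BF Fx (_ : 0 < d / 5 <= 1) nE.
have -> : 0 < d / 5 <= 1 by apply/andP; split; move: d0 d1; lra.
move=> /(_ isT); rewrite leNgt => /negP; apply.
apply: le_lt_trans FE_le _; apply: (@le_lt_trans _ _ (mu (E `+` F) + mu (E `+` F))%E).
  by rewrite leeDl.
by have -> : d / 5 * (1 / 2) = d / 10 by field.
Qed.

Lemma convex_symdiff_shell x : (E `+` F) x -> 1 - d <= enorm x <= 1 + d.
Proof.
move=> [[Ex Fx]|[Fx Ex]]; apply/andP; split.
- by rewrite leNgt; apply/negP => /inner.
- by have := Eout Ex; move: d0; lra.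
- rewrite leNgt; apply/negP => xd; apply: Ex; apply: Ein; move: xd d0; lra.
- exact: outer.
Qed.

End convex_shell.

(** * A nonconvex set is not convex up to null sets *)

Section nonconvex.
Context {R : realType} {n : nat}.
Notation mu := (borel_lebesgue R n).
Implicit Types (x y : 'rV[R]_n) (E F : set 'rV[R]_n).

Lemma open_enorm_ball E x : open E -> E x ->
  exists2 r : R, 0 < r & forall y, enorm (y - x) < r -> E y.
Proof.
rewrite openE => /(_ x) oE /oE /nbhs_ballP[r r0 rE]; exists r => // y yr.
apply: rE; rewrite -ball_normE/= distrC; exact: le_lt_trans (norm_le_enorm _) yr.
Qed.

(** [F] fills almost all of small balls around [p] and [q]. Fix a point [y] of [F] near [p]: its
    midpoints with the points of [F] near [q] belong to [F], have positive measure and lie near the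
    midpoint of [p] and [q], thus outside [E]. *)
Lemma null_symdiff_nonconvex E F p q : measurable E -> measurable F ->
  convex_set (F : set (convex_lmodType 'rV[R]_n)) ->
  open E -> E p -> E q -> (~` E)^° (2^-1 *: (p + q)) -> mu (E `+` F) != 0%E.
Proof.
move=> mE mF cF oE Ep Eq Em; apply/eqP => Y0.
have [rp rp0 Hp] := open_enorm_ball oE Ep.
have [rq rq0 Hq] := open_enorm_ball oE Eq.
have [rm rm0 Hm] := open_enorm_ball (@open_interior _ (~` E)) Em.
pose r := Num.min rp (Num.min rq rm).
have r0 : 0 < r by rewrite !lt_min rp0 rq0 rm0.
have [rrp rrq rrm] : [/\ r <= rp, r <= rq & r <= rm].
  by rewrite /r !ge_min !lexx !orbT.
have mEF : measurable (E `\` F) by exact: measurableD.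
have mFE : measurable (F `\` E) by exact: measurableD.
have mB x : measurable (translate x (eball r) : set 'rV[R]_n).
  by apply: measurable_translate; exact: measurable_eball.
have EF0 : mu (E `\` F) = 0%E.
  apply/eqP; rewrite eq_le measure_ge0 andbT -Y0.
  by apply: le_measure; rewrite ?inE//; [exact: measurableU|left].
have FE0 : mu (F `\` E) = 0%E.
  apply/eqP; rewrite eq_le measure_ge0 andbT -Y0.
  by apply: le_measure; rewrite ?inE//; [exact: measurableU|right].
have pos x : translate x (eball r) `<=` E -> (0 < mu (translate x (eball r) `&` F))%E.
  move=> xE; have mBF : measurable (translate x (eball r) `&` F) by exact: measurableI.
  have mBD : measurable (translate x (eball r) `\` F) by exact: measurableD.
  rewrite lt0e measure_ge0 andbT; apply/eqP => B0.
  have := @measure_eball_gt0 R n r r0; rewrite -(measure_translate x (@measurable_eball R n r)).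
  rewrite (measureDI mu (mB x) mF) [X in (_ + X)%E]B0 adde0 ltNge => /negP; apply; rewrite -EF0.
  by apply: le_measure; rewrite ?inE// => y [/xE].
have pE : translate p (eball r) `<=` E.
  by move=> y; rewrite translate_eballE => yr; apply: Hp; exact: lt_le_trans yr rrp.
have qE : translate q (eball r) `<=` E.
  by move=> y; rewrite translate_eballE => yr; apply: Hq; exact: lt_le_trans yr rrq.
have [y [+ Fy]] : (translate p (eball r) `&` F) !=set0.
  apply/set0P/eqP => B0; have := pos p pE; rewrite B0 measure0 ltxx//.
rewrite translate_eballE => yp.
have mBF : measurable (translate q (eball r) `&` F) by exact: measurableI.
have N2 : (2 : R) != 0 by rewrite pnatr_eq0.
have := pos q qE; rewrite -(borel_lebesgue_affine (- y) N2 mBF) ltNge => /negP; apply.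
suff -> : mu ((fun x => 2 *: x - y) @^-1` (translate q (eball r) `&` F)) = 0%E.
  by rewrite mule0.
apply/eqP; rewrite eq_le measure_ge0 andbT -FE0; apply: le_measure; rewrite ?inE//.
  by rewrite -[X in measurable X]setTI; exact: (measurable_affine _ _ measurableT mBF).
move=> z /=; rewrite translate_eballE => -[zq Fz].
have zE : z = 2^-1 *: (2 *: z - y) + (1 - 2^-1) *: y.
  have -> : 1 - 2^-1 = 2^-1 :> R by field.
  by rewrite -scalerDr subrK scalerA mulVf// scale1r.
split.
  rewrite zE; apply: (convex_set_segment cF Fz Fy); first by rewrite invr_ge0.
  by rewrite invf_le1// ler1n.
have : (~` E)^° z.
  apply: Hm; apply: lt_le_trans rrm.
  have -> : z - 2^-1 *: (p + q) = 2^-1 *: ((2 *: z - y - q) + (y - p)).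
    rewrite {1}zE; have -> : 1 - 2^-1 = 2^-1 :> R by field.
    rewrite -scalerDr -scalerBr; congr (_ *: _).
    by apply/rowP => i; rewrite !mxE; ring.
  rewrite enormZ ger0_norm ?invr_ge0//.
  have := enorm_triangle (2 *: z - y - q) (y - p); move: zq yp; lra.
by move=> /interior_subset.
Qed.

End nonconvex.

(** * Comparison of perimeters by calibration *)

Section calibration.
Context {R : realType} {n : nat}.
Notation mu := (borel_lebesgue R n).
Implicit Types (E F : set 'rV[R]_n).

(** [E] and [F] have the same volume, so a constant may be subtracted from the divergence at no
    cost; the difference of the indicators lives on [E + F], where what is left is at most [e]. *)
Lemma calibrated_perimeter_diff E F (X : 'rV[R]_n -> 'rV[R]_n) (K L c e : R) :
  measurable E -> measurable F -> (forall x, E x -> `|x| <= K) ->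
  (forall x, F x -> `|x| <= L) -> mu E = mu F -> test_field X ->
  (perimeter E <= (\int[mu]_x (\1_E x * div X x))%:E)%E ->
  (forall x, (E `+` F) x -> `|div X x - c| <= e) ->
  (perimeter E - perimeter F <= (e * fine (mu (E `+` F)))%:E)%E.
Proof.
move=> mE mF EK FL EF tX PE Xe.
have PF := perimeter_ge mF tX.
have mY : measurable (E `+` F) by apply: measurableU; exact: measurableD.
have bE := bbs_indic mE EK; have bF := bbs_indic mF FL.
have [KX HX] := test_field_div0 tX.
have bEX := bbs_indic_div mE (test_field_C1 tX) (ex_intro _ KX (fun x Kx => (etrans (congr1 _ (HX x Kx)) (mulr0 _)))).
have bFX := bbs_indic_div mF (test_field_C1 tX) (ex_intro _ KX (fun x Kx => (etrans (congr1 _ (HX x Kx)) (mulr0 _)))).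
have bY : bbsV R n \1_(E `+` F).
  apply: (@bbs_indic _ _ _ _ _ (Num.max K L)) => // x.
  by move=> [[/EK + _]|[/FL + _]]; rewrite le_max => ->; rewrite ?orbT.
apply: le_trans (leeB PE PF) _; rewrite -EFinB lee_fin.
rewrite -(bbs_RintegralB bEX bFX) -(Rintegral_indic_rV mY) -bbs_RintegralZ//.
have I0 : \int[mu]_x (c * (\1_E x - \1_F x)) = 0.
  rewrite bbs_RintegralZ; last exact: bbsB.
  by rewrite bbs_RintegralB// !Rintegral_indic_rV// EF subrr mulr0.
have bc : bbsV R n (fun x => c * (\1_E x - \1_F x)) by apply: bbsZ; exact: bbsB.
rewrite -[leLHS]subr0 -I0 -bbs_RintegralB//; last exact: bbsB.
apply: bbs_le_Rintegral; [by apply: bbsB => //; exact: bbsB|exact: bbsZ|move=> x].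
rewrite !indicE.
have -> : (x \in E `+` F) = (x \in E) (+) (x \in F).
  apply/idP/idP.
    rewrite inE => -[[Ex Fx]|[Fx Ex]].
      by rewrite (mem_set Ex) (memNset Fx).
    by rewrite (mem_set Fx) (memNset Ex).
  have [xE|xE] := boolP (x \in E); have [xF|xF] := boolP (x \in F) => //= _; rewrite inE.
    by left; split; [exact: set_mem|move=> /mem_set; exact/negP].
  by right; split; [exact: set_mem|move=> /mem_set; exact/negP].
have [xE|xE] := boolP (x \in E); have [xF|xF] := boolP (x \in F) => /=.
- by rewrite !mul1r !subrr !mulr0 subrr.
- have /Xe : (E `+` F) x by left; split; [exact: set_mem|move=> /mem_set; exact/negP].
  by rewrite ler_norml mul1r mul0r !subr0 !mulr1 => /andP[].
- have /Xe : (E `+` F) x by right; split; [exact: set_mem|move=> /mem_set; exact/negP].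
  by rewrite ler_norml mul1r mul0r !sub0r mulr1 mulrN1 opprK => /andP[+ _]; lra.
- by rewrite !mul0r !subrr !mulr0 subrr.
Qed.

End calibration.

(** * Choice of the parameters and conclusion *)

Section counterexample.
Context {R : realType} {n : nat}.
Notation mu := (borel_lebesgue R n).

Lemma unit_ballE : @unit_ball R n = eball 1. Proof. by []. Qed.

Lemma saddle_ball_interior_compl (i0 i1 : 'I_n) (a eta k : R) (x : 'rV[R]_n) :
  i0 != i1 -> 0 < a -> 0 < eta -> eta <= 1 -> 1000 * a <= 1 ->
  k ^+ 2 < sqr_perturbed i0 i1 a eta x -> 0 < k -> (~` saddle_ball i0 i1 a eta k)^° x.
Proof.
move=> i01 a0 eta0 eta1 a1 kx k0.
have x0 : x != 0.
  apply/eqP => x0; move: kx; have := sqr_perturbed_bound i01 a0 eta0 eta1 (0 : 'rV[R]_n).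
  rewrite x0 enorm0 expr0n/= !mulr0 => H; rewrite -(le_anti H) ltNge.
  by rewrite exprn_ge0// ltW.
have [HC _] := C2h_sqr_perturbed a i01 eta0.
have cG := C1g_continuous (@open_punctured R n) HC x0.
have /cvgr_gt/(_ _ kx) := cG; apply: filterS => y /= ky.
by rewrite /saddle_ball/= ltNge (ltW ky).
Qed.

(** Finitely many smallness conditions at once, in the form [c * a <= 1], which needs no sign
    condition on [c]. *)
Lemma pos_small_multiples (s : seq R) : exists2 a : R, 0 < a & {in s, forall c, c * a <= 1}.
Proof.
elim: s => [|c s [a a0 IH]]; first by exists 1.
have c0 : 0 < 1 + `|c| by rewrite ltr_wpDr.
exists (Num.min a (1 + `|c|)^-1); first by rewrite lt_min a0 invr_gt0.
have m0 : 0 <= Num.min a (1 + `|c|)^-1 by rewrite le_min (ltW a0) invr_ge0 (ltW c0).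
move=> b; rewrite in_cons => /predU1P[->|bs].
  apply: le_trans (_ : (1 + `|c|) * (1 + `|c|)^-1 <= _); last by rewrite divff// gt_eqF.
  apply: le_trans (_ : (1 + `|c|) * Num.min a (1 + `|c|)^-1 <= _).
    by apply: ler_wpM2r => //; have := ler_norm c; lra.
  by apply: ler_wpM2l; rewrite ?(ltW c0)// ge_min lexx orbT.
have [b0|b0] := leP b 0.
  by apply: le_trans ler01; exact: mulr_le0_ge0.
apply: le_trans (IH b bs); apply: ler_wpM2l; first exact: ltW.
by rewrite ge_min lexx.
Qed.

(** The common core of both parts: one set, at once nearly spherical and of finite perimeter,
    defeats every convex competitor at the fixed slope [eps]. *)
Lemma no_linear_convexity_stability (eps sigma : R) : (3 <= n)%N -> 0 < eps -> 0 < sigma ->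
  exists E : set 'rV[R]_n,
    [/\ nearly_spherical sigma E, finite_perimeter E, vol E = vol (@unit_ball R n) &
      forall (x0 : 'rV[R]_n) v, C2_sphere v -> (sup_norm v <= (2^-1)%:E)%E ->
      convex_set (translate x0 (ball_graph v) : set (convex_lmodType 'rV[R]_n)) ->
      vol (translate x0 (ball_graph v)) = vol (@unit_ball R n) ->
      ~ (eps%:E * vol (E `+` translate x0 (ball_graph v)) <=
         perimeter E - perimeter (translate x0 (ball_graph v)))%E].
Proof.
move=> n3 eps0 sigma0.
have n0 : (0 < n)%N by exact: leq_trans n3.
pose i0 : 'I_n := Ordinal n0.
pose i1 : 'I_n := Ordinal (leq_trans (isT : 1 < 3)%N n3).
pose i2 : 'I_n := Ordinal (leq_trans (isT : 2 < 3)%N n3).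
have i01 : i0 != i1 by [].
pose N : R := n%:R; have N1 : 1 <= N by rewrite ler1n.
pose beta := fine (mu (eball 1)).
have beta0 : 0 < beta by rewrite fine_gt0// measure_eball_gt0//= ltey_eq measure_eball_fin.
(* The curvature deviation must stay below [eps / 2]; the width [d] of the shell is charged with
   [4 N d <= eps / 4] and the perturbation [a] with the other quarter. *)
pose d := Num.min (1 / 2) (eps / (16 * N)).
have d0 : 0 < d by rewrite lt_min !divr_gt0// mulr_gt0//; lra.
have d1 : d <= 1 / 2 by rewrite ge_min lexx.
have Nd : 4 * N * d <= eps / 4.
  have : d <= eps / (16 * N) by rewrite ge_min lexx orbT.
  rewrite ler_pdivlMr; last by rewrite mulr_gt0//; lra.
  by lra.
pose m := fine (mu (eball (d / 10))).
have mfin : mu (eball (d / 10)) = m%:E by rewrite fineK// measure_eball_fin.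
have m0 : 0 < m by rewrite -lte_fin -mfin measure_eball_gt0// divr_gt0.
(* In order: validity of the saddle estimates; [E] within [d / 2] of the unit sphere, as
   [55 a <= d / 2]; near sphericity; the curvature error; smallness of [E + F]. The final [+ 1]
   makes the last inequality strict. *)
have [a a0 Ha] := pos_small_multiples [:: 1000; 110 / d; 900 / sigma;
  (180 * N + 5000) / (eps / 4); 400 * N * beta / (eps * m) + 1].
have a1 : 1000 * a <= 1 by apply: Ha; rewrite inE eqxx.
have a2 : 110 * a <= d.
  have : 110 / d * a <= 1 by apply: Ha; rewrite !inE eqxx !orbT.
  by rewrite mulrAC ler_pdivrMr// mul1r.
have a3 : 900 * a <= sigma.
  have : 900 / sigma * a <= 1 by apply: Ha; rewrite !inE eqxx !orbT.
  by rewrite mulrAC ler_pdivrMr// mul1r.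
have a4 : (180 * N + 5000) * a <= eps / 4.
  have : (180 * N + 5000) / (eps / 4) * a <= 1 by apply: Ha; rewrite !inE eqxx !orbT.
  by rewrite mulrAC ler_pdivrMr ?divr_gt0// mul1r.
have a5 : 400 * N * beta * a < eps * m.
  have : (400 * N * beta / (eps * m) + 1) * a <= 1 by apply: Ha; rewrite !inE eqxx !orbT.
  have em : 0 < eps * m by rewrite mulr_gt0.
  move=> H; have : 400 * N * beta * a / (eps * m) < 1.
    by rewrite mulrAC; move: H; rewrite mulrDl mul1r; clear -a0; lra.
  by rewrite ltr_pdivrMr// mul1r.
clear Ha.
(* The largest [eta] for which the logarithm in [saddle_ball_nonconvex] is guaranteed to reach
   [2 / a]. *)
pose eta := expR (- (2 / a)) / 3.
have e3 : 3 * eta = expR (- (2 / a)) by rewrite /eta; field.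
have e3le : 3 * eta <= expR (- (2 / a)) by rewrite e3.
have eta0 : 0 < eta by rewrite divr_gt0// expR_gt0.
have eta1 : eta <= 1.
  have : expR (- (2 / a)) <= 1 by rewrite -expR0 ler_expR oppr_le0 divr_ge0// ltW.
  by rewrite -e3; clear; lra.
have [k k0 kB] := saddle_ball_volume i01 a0 eta0 eta1 a1.
pose E := saddle_ball i0 i1 a eta k.
have mE : measurable E := measurable_saddle_ball i01 a0 eta0 eta1 a1 k0.
have PE := perimeter_saddle_ball i01 a0 eta0 eta1 a1 k0 kB.
have EB : vol E = vol (@unit_ball R n).
  by rewrite unit_ballE !volE//; exact: measurable_eball.
have Ein x : enorm x < 1 - d / 2 -> E x.
  move=> xd; apply: saddle_ball_inner => //; clear -xd a2; lra.
have Eout x : E x -> enorm x < 1 + d / 2.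
  move=> Ex; have := saddle_ball_outer i01 a0 eta0 eta1 a1 k0 kB Ex; clear -a2; lra.
have [p [q [Ep Eq Em]]] := saddle_ball_nonconvex i01 a0 eta0 eta1
  (isT : i2 != i0) (isT : i2 != i1) e3le k0.
exists E; split => //.
- exact: nearly_spherical_saddle_ball.
- split; first exact: measurable_lebesgue_type.
  by apply: le_lt_trans PE _; rewrite ltry.
move=> x0 v C2v sv cF; set F := translate x0 (ball_graph v) in cF * => FB.
have v2 w : sphere w -> `|v w| <= 2^-1.
  by move=> sw; rewrite -lee_fin; apply: le_trans sv; apply: ereal_sup_ubound; exists w.
have mB : measurable (ball_graph v) by apply: open_measurable_rV; exact: open_ball_graph.
have mF : measurable F by exact: measurable_translate.
have mY : measurable (E `+` F) by apply: measurableU; exact: measurableD.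
have PF := isoperimetric_translate n0 v2 C2v FB.
rewrite volE//.
have EK x : E x -> `|x| <= 2.
  by move=> /Eout xd; apply: le_trans (norm_le_enorm x) _; clear -xd d1; lra.
have FK x : F x -> `|x| <= 3 / 2 + `|x0|.
  rewrite /F translateE/= => /(ball_graph_bound v2 n0) H.
  have := ler_normD (x - x0) x0; rewrite subrK => H2; apply: le_trans H2 _.
  by rewrite lerD2r; apply: le_trans (norm_le_enorm _) H.
have EF : mu E = mu F by move: FB; rewrite -EB !volE.
have Yfin : mu (E `+` F) \is a fin_num.
  apply: (@measure_bounded_fin _ _ _ (2 + (3 / 2 + `|x0|))) => // x.
  have x00 := normr_ge0 x0.
  by move=> [[/EK + _]|[/FK + _]]; clear -x00; lra.
pose D := fine (mu (E `+` F)); have DE : mu (E `+` F) = D%:E by rewrite fineK.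
have D0 : 0 <= D by exact: fine_ge0.
move=> H.
(* The perimeter of [E] is at most [(1 + 200 a) N beta] and, by the isoperimetric inequality, that
   of the competitor is at least [N beta]. *)
have D1 : eps * D <= 200 * a * N * beta.
  rewrite -lee_fin EFinM -DE; apply: le_trans H _.
  apply: le_trans (leeB PE PF) _; rewrite -EFinB lee_fin -/N -/beta.
  by clear; lra.
have small : (mu (E `+` F) + mu (E `+` F) < mu (eball (d / 10)))%E.
  rewrite DE mfin -EFinD lte_fin -(ltr_pM2l eps0); clear -D1 a5; lra.
have shell := convex_symdiff_shell mE mF cF d0 d1 Ein Eout small.
have a42 : 42 * a <= 1 by clear -a0 a1; lra.
have tX := test_field_normal (C2hW (C2h_sqr_perturbed a i01 eta0))
  (dsqr_perturbed_neq0 i01 a0 eta0 eta1 a42).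
have HX x : (E `+` F) x ->
    `|div (normal_field (dsqr_perturbed i0 i1 a eta)) x - (N - 1)| <= eps / 2.
  move=> /shell /andP[x1 x2].
  apply: le_trans (div_normal_sqr_perturbed i01 a0 eta0 eta1 a42 _) _.
    by apply/andP; split; clear -x1 x2 d1; lra.
  have : `|enorm x - 1| <= d.
    by rewrite ler_norml; apply/andP; split; clear -x1 x2; lra.
  have N40 : 0 <= 4 * N by clear -N1; lra.
  by move=> /(ler_wpM2l N40); rewrite -/N; clear -a4 Nd; lra.
have PEX := perimeter_saddle_ball_normal i01 a0 eta0 eta1 a1 k0 kB.
have := calibrated_perimeter_diff mE mF EK FK EF tX PEX HX.
move=> /(le_trans H); rewrite -/D DE -EFinM lee_fin => D2.
(* The calibration gives [eps D <= (eps / 2) D]. *)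
have DD : D = 0 by apply/eqP; rewrite eq_le D0 andbT -(ler_pM2l eps0) mulr0; clear -D2; lra.
have := null_symdiff_nonconvex mE mF cF (open_saddle_ball i01 a0 eta0 eta1 a1 k0) Ep Eq
  (saddle_ball_interior_compl i01 a0 eta0 eta1 a1 Em k0).
by move=> /eqP; apply; rewrite DE DD.
Qed.

End counterexample.

Theorem mainTheorem3 (R : realType) (n : nat) (n_ge3 : (3 <= n)%N) :
  (~ exists sigma0 lambda0 C0 : R,
      [/\ 0 < sigma0, sigma0 < 1, 0 < lambda0, 1 < C0 &
      forall sigma lambda : R, 0 < sigma < sigma0 -> 0 < lambda < lambda0 ->
      forall E : set 'rV[R]_n,
        nearly_spherical sigma E ->
        vol E = vol (@unit_ball R n) ->
      exists (x0 : 'rV[R]_n) (v : 'rV[R]_n -> R),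
        let F := translate x0 (ball_graph v) in
        [/\ C2_sphere v /\ (sup_norm v <= (2^-1)%:E)%E,
            uniformly_convex F,
            (C1_norm v <= (C0 * (lambda / `|ln sigma|))%:E)%E /\
            (C0_norm (thess v) <= (C0 * lambda)%:E)%E,
            vol F = vol E &
            (lambda%:E * vol (E `+` F) <=
             perimeter E - perimeter F)%E]]) /\
  (~ exists lambda0 c : R,
      [/\ 0 < lambda0, 0 < c &
      forall E : set 'rV[R]_n,
        finite_perimeter E ->
        vol E = vol (@unit_ball R n) ->
      forall lambda : R, 0 < lambda <= lambda0 ->
      exists F : set 'rV[R]_n,
        [/\ uniformly_convex F, C2_class lambda F &
            ((c * lambda)%:E * vol (E `+` F) <=
             perimeter E - perimeter F)%E]]).
Proof.
split.
  move=> [sigma0 [lambda0 [C0 [s0 s1 l0 C1 H]]]].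
  (* Both parameter intervals are open, so their midpoints are taken; the slope of the core
     statement is then [lambda] itself. *)
  have l2 : 0 < lambda0 / 2 by rewrite divr_gt0.
  have s2 : 0 < sigma0 / 2 by rewrite divr_gt0.
  have [E [sE _ VE nE]] := no_linear_convexity_stability n_ge3 l2 s2.
  have [||x0 [v [[C2v sv] [_ _ cF _] _ VF PEF]]] := H (sigma0 / 2) (lambda0 / 2) _ _ E sE VE.
  - by apply/andP; split; lra.
  - by apply/andP; split; lra.
  by apply: (nE x0 v C2v sv cF) PEF; rewrite VF.
move=> [lambda0 [c [l0 c0 H]]].
(* Here the endpoint [lambda = lambda0] is allowed, and the slope is [c * lambda0]. *)
have e0 : 0 < c * lambda0 by rewrite mulr_gt0.
have [E [_ fE VE nE]] := no_linear_convexity_stability n_ge3 e0 (@ltr01 R).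
have [|F [[_ _ cF _] [x0 [v [C2v sv _ FE VF]]] PEF]] := H E fE VE lambda0.
  by rewrite l0 lexx.
by rewrite FE in cF VF PEF; exact: (nE x0 v C2v sv cF VF PEF).
Qed.
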